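(* Let $X$ be a Polish space with Borel $\sigma$-field $\mathscr B$ and a Borel probability measure $m$, let $(T,\mathscr A,p)$ be a probability space, and let $(\Omega,\mathscr F,\mathbb P)=(T^{\mathbb N},\mathscr A^{\mathbb N},p^{\mathbb N})$. Let $f:T\times X\to X$ be a measurable map whose annealed Perron--Frobenius operator $\mathcal L_f:L^1(m)\to L^1(m)$ is defined. Then the following are equivalent: (i) $\mathcal L_f$ is mean constrictive; (ii) $f$ satisfies (FPM). Moreover, if $f$ satisfies either of these equivalent conditions and $\mu_1,\dots,\mu_r$ denote the measures appearing in (FPM), then (1) $(\mathbb P\times m)(B(\mu_1)\cup\dots\cup B(\mu_r))=1$; (2) $\mathbb P(B_x(\mu_1)\cup\dots\cup B_x(\mu_r))=1$ for $m$-almost every $x\in X$; (3) $m(B_\omega(\mu_1)\cup\dots\cup B_\omega(\mu_r))=1$ for $\mathbb P$-almost every $\omega\in\Omega$; where, for each $i=1,\dots,r$, $$B(\mu_i)=\Big\{(\omega,x)\in\Omega\times X:\lim_{n\to\infty}\frac1n\sum_{j=0}^{n-1}\delta_{f^j_\omega(x)}=\mu_i\Big\}$$ (limit in the weak* topology), $B_\omega(\mu_i)=\{x\in X:(\omega,x)\in B(\mu_i)\}$ and $B_x(\mu_i)=\{\omega\in\Omega:(\omega,x)\in B(\mu_i)\}$.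
   Context: Write $f_t=f(t,\cdot)$, and for $\omega=(\omega_1,\omega_2,\dots)\in\Omega$ put $f^0_\omega=\mathrm{id}$, $f^n_\omega=f_{\omega_n}\circ\dots\circ f_{\omega_1}$. Weak* convergence of probability measures means convergence of integrals of bounded continuous functions. Annealed Perron--Frobenius operator: the transition probability $P(x,A)=p(\{t:f_t(x)\in A\})$ is assumed to be $m$-nonsingular, i.e. $m(A)=0$ implies $P(x,A)=0$ for $m$-a.e. $x$. Then $\mathcal L_f\varphi$, for $\varphi\in L^1(m)$, is the Radon--Nikodym derivative with respect to $m$ of $A\mapsto\int\varphi(x)P(x,A)\,dm(x)$. When every $f_t$ is nonsingular (preimages of $m$-null sets are $m$-null), $\mathcal L_f\varphi=\int\mathcal L_t\varphi\,dp(t)$, where $\mathcal L_t$ is the Perron--Frobenius operator of $f_t$. $D(m)=\{h\in L^1(m):h\ge0\ m\text{-a.e.},\ \|h\|=1\}$. An operator $P$ on $L^1(m)$ is mean constrictive if there is a compact set $F\subset L^1(m)$ such that $\lim_{n\to\infty}d(A_nh,F)=0$ for every $h\in D(m)$, where $A_n=\frac1n\sum_{i=0}^{n-1}P^i$ and $d(\varphi,F)=\inf_{\psi\in F}\|\varphi-\psi\|$. A probability measure $\mu$ on $X$ is stationary for $f$ if $\mu(A)=\int\mu(f_t^{-1}A)\,dp(t)$ for all $A\in\mathscr B$. It is ergodic if $\mathbb P\times\mu$ is an ergodic invariant measure of $F(\omega,x)=(\sigma\omega,f_{\omega_1}(x))$, with $\sigma$ the left shift on $\Omega$. (FPM): there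 exist finitely many ergodic stationary probability measures $\mu_1,\dots,\mu_r$ of $f$ such that: 1) each $\mu_i$ is absolutely continuous with respect to $m$; 2) they have pairwise disjoint supports up to an $m$-null set, where the support of $\mu_i$ is $\{d\mu_i/dm\ne0\}$; 3) for any bounded $\mathscr B$-measurable real-valued function $\psi$, $m(B_\omega(\mu_1,\psi)\cup\dots\cup B_\omega(\mu_r,\psi))=1$ for $\mathbb P$-a.e. $\omega$, where $B_\omega(\mu_i,\psi)=\{x\in X:\lim_{n\to\infty}\frac1n\sum_{j=0}^{n-1}\psi(f^j_\omega(x))=\int\psi\,d\mu_i\}$. *)

(* Defs.v *)
From HB Require Import structures.
From mathcomp Require Import all_boot all_order all_algebra.
From mathcomp Require Import all_classical all_reals all_analysis.
From mathcomp Require Import measurable_realfun.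

Set Implicit Arguments.
Unset Strict Implicit.
Unset Printing Implicit Defensive.

Import Order.TTheory GRing.Theory Num.Theory.
Import numFieldNormedType.Exports.

Local Open Scope classical_set_scope.
Local Open Scope ring_scope.

(* [LspaceType1] is a quotient by almost-everywhere equality that comes without
   algebraic or topological structure; the operations and the norm are
   transferred here from [LfunType], making [L1 mu] a [normedModType R]. *)
Section L1.
Context d (T : measurableType d) (R : realType).
Variable mu : {measure set T -> \bar R}.

Definition L1 : Type := LspaceType1 mu.

HB.instance Definition _ := gen_eqMixin L1.
HB.instance Definition _ := gen_choiceMixin L1.

Local Notation Lfun1 := (LfunType mu (@lexx _ _ 1%E)).
Local Notation aemfun := {mfun_ mu, T >-> measurableTypeR R}.

Definition L1_fun (h : L1) : T -> R := repr (LebesgueSpace.sort h).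

Lemma L1_fun_Lfun (h : L1) : L1_fun h \in Lfun mu 1%E.
Proof.
case: h => q [[fq]]; rewrite /L1_fun/=; apply/andP; split; rewrite inE//=.
by have := @measurable_funPT _ _ _ _ (repr q).
Qed.

Definition L1_repr (h : L1) : Lfun1 := Lfun_Sub (lexx 1%E) (L1_fun_Lfun h).

Lemma Lfun1_mfun (f : Lfun1) : (f : T -> measurableTypeR R) \in mfun.
Proof. by rewrite inE; have := @measurable_funPT _ _ _ _ f. Qed.

Definition aeclass (f : Lfun1) : aemfun :=
  (\pi_aemfun (mfun_Sub (Lfun1_mfun f)))%qT.

Lemma aeclassE (f : Lfun1) : (repr (aeclass f) : T -> R) = f %[ae mu].
Proof.
have : ae_eq_op mu (repr (aeclass f)) (mfun_Sub (Lfun1_mfun f)).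
  by rewrite -eqmodE /aeclass reprK.
by move/asboolP.
Qed.

Let abs_mfun (g : T -> R) : measurable_fun setT g ->
  measurable_fun setT (fun x => `|(EFin \o g) x|%E).
Proof.
by move=> mg; apply: (@measurableT_comp _ _ _ _ _ _ abse) => //; exact/measurable_EFinP.
Qed.

Lemma aeclass_finite (f : Lfun1) : finite_norm mu 1%E (aeclass f).
Proof.
have ff : finite_norm mu 1%E f by exact: Lfunction_finite.
rewrite /finite_norm Lnorm1 in ff; rewrite /finite_norm Lnorm1.
rewrite (_ : (\int[mu]_x _)%E = (\int[mu]_x `|(EFin \o f) x|)%E)//.
apply: ae_eq_integral => //.
- exact: abs_mfun (@measurable_funPT _ _ _ _ (repr (aeclass f))).
- exact: abs_mfun.
- apply: filterS (aeclassE f) => x /= fx _.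
  by congr (`|_%:E|%E); exact: fx.
Qed.

Definition L1_class (f : Lfun1) : L1 :=
  LebesgueSpace.Pack (LebesgueSpace.Class
    (isFinLebesgue.Build _ _ _ mu 1%E (lexx 1%E) (aeclass f) (aeclass_finite f))).

Lemma L1_eqP (g h : L1) : g = h <-> L1_fun g = L1_fun h %[ae mu].
Proof.
split=> [->|gh]; first exact: ae_eq_refl.
have e : LebesgueSpace.sort g = LebesgueSpace.sort h.
  by rewrite -[LHS]reprK -[RHS]reprK; apply/eqmodP/asboolP.
case: g h e {gh} => [g [[cg]]] [h [[ch]]] /= e.
by subst h; rewrite (Prop_irrelevance cg ch).
Qed.

Lemma L1_classK (f : Lfun1) : L1_fun (L1_class f) = f %[ae mu].
Proof. exact: aeclassE. Qed.

Lemma L1_reprK (h : L1) : L1_class (L1_repr h) = h.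
Proof. by apply/L1_eqP; exact: L1_classK. Qed.

Lemma L1_class_eq (f g : Lfun1) :
  (f : T -> R) = g %[ae mu] -> L1_class f = L1_class g.
Proof.
move=> fg; apply/L1_eqP.
apply: ae_eq_trans (L1_classK f) _; apply: ae_eq_trans fg _.
exact/ae_eq_sym/L1_classK.
Qed.

Definition L1_add (g h : L1) := L1_class (L1_repr g + L1_repr h).
Definition L1_opp (g : L1) := L1_class (- L1_repr g).
Definition L1_scale (a : R) (g : L1) := L1_class (a *: L1_repr g).
Definition L1_zero : L1 := L1_class 0.
Definition L1_norm (g : L1) : R := fine ('N[mu]_1[EFin \o L1_fun g])%E.

Let addK (f g : Lfun1) : L1_add (L1_class f) (L1_class g) = L1_class (f + g).
Proof.
apply: L1_class_eq.
apply: filterS2 (L1_classK f) (L1_classK g) => x fx gx _.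
exact: (congr2 +%R (fx I) (gx I)).
Qed.

Let oppK (f : Lfun1) : L1_opp (L1_class f) = L1_class (- f).
Proof.
apply: L1_class_eq; apply: filterS (L1_classK f) => x fx _.
exact: (congr1 -%R (fx I)).
Qed.

Let scaleK a (f : Lfun1) : L1_scale a (L1_class f) = L1_class (a *: f).
Proof.
apply: L1_class_eq; apply: filterS (L1_classK f) => x fx _.
exact: (congr1 ( *%R a) (fx I)).
Qed.

Let L1_addA : associative L1_add.
Proof.
by move=> f g h; rewrite -[f]L1_reprK -[g]L1_reprK -[h]L1_reprK !addK addrA.
Qed.

Let L1_addC : commutative L1_add.
Proof. by move=> f g; rewrite -[f]L1_reprK -[g]L1_reprK !addK addrC. Qed.

Let L1_add0 : left_id L1_zero L1_add.
Proof. by move=> f; rewrite -[f]L1_reprK addK add0r. Qed.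

Let L1_addN : left_inverse L1_zero L1_opp L1_add.
Proof. by move=> f; rewrite -[f]L1_reprK oppK addK addNr. Qed.

HB.instance Definition _ :=
  GRing.isZmodule.Build L1 L1_addA L1_addC L1_add0 L1_addN.

Let L1_scaleA a b (f : L1) : L1_scale a (L1_scale b f) = L1_scale (a * b) f.
Proof. by rewrite -[f]L1_reprK !scaleK scalerA. Qed.

Let L1_scale1 : left_id 1 L1_scale.
Proof. by move=> f; rewrite -[f]L1_reprK scaleK scale1r. Qed.

Let L1_scaleDr : right_distributive L1_scale +%R.
Proof.
move=> a f g; rewrite -[f]L1_reprK -[g]L1_reprK.
by rewrite [_ + _]addK !scaleK [RHS]addK scalerDr.
Qed.

Let L1_scaleDl f : {morph L1_scale^~ f : a b / a + b}.
Proof. by move=> a b; rewrite -[f]L1_reprK !scaleK [RHS]addK scalerDl. Qed.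

HB.instance Definition _ := GRing.Zmodule_isLmodule.Build R L1
  L1_scaleA L1_scale1 L1_scaleDr L1_scaleDl.

Let normK (f : Lfun1) : L1_norm (L1_class f) = fine ('N[mu]_1[EFin \o f])%E.
Proof.
rewrite /L1_norm; congr fine; rewrite !Lnorm1; apply: ae_eq_integral => //.
- exact: abs_mfun (@measurable_funPT _ _ _ _ (L1_repr (L1_class f))).
- exact: abs_mfun.
- apply: filterS (L1_classK f) => x /= fx _.
  by congr (`|_%:E|%E); exact: fx.
Qed.

Let L1_normD (f g : L1) : L1_norm (f + g) <= L1_norm f + L1_norm g.
Proof.
rewrite -[f]L1_reprK -[g]L1_reprK [_ + _]addK !normK.
exact: ler_LnormD.
Qed.

Let L1_normZ a (f : L1) : L1_norm (a *: f) = `|a| * L1_norm f.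
Proof.
rewrite -[f]L1_reprK [_ *: _]scaleK !normK.
by apply: EFin_inj; rewrite EFinM !finite_norm_fine LnormZ.
Qed.

Let L1_norm0_eq0 (f : L1) : L1_norm f = 0 -> f = 0.
Proof.
rewrite -[f]L1_reprK normK => /fine_Lnormr_eq0 f0.
exact: L1_class_eq.
Qed.

HB.instance Definition _ :=
  Lmodule_isNormed.Build R L1 L1_normD L1_normZ L1_norm0_eq0.

End L1.



Section annealed_Perron_Frobenius.
Context dT (T : measurableType dT) dX (X : measurableType dX) (R : realType).
Variables (p : probability T R) (m : probability X R).
Variable f : {mfun (T * X)%type >-> X}.
Local Open Scope ereal_scope.

Definition transition (x : X) (A : set X) : \bar R := p [set t | A (f (t, x))].

Definition nonsingular_transition : Prop := forall A : set X,
  measurable A -> m A = 0 -> {ae m, forall x, transition x A = 0}.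

Definition transport (h : L1 m) (A : set X) : \bar R :=
  \int[m]_x ((L1_fun h x)%:E * transition x A).

Let transition_ysection A : transition^~ A = p \o ysection (f @^-1` A).
Proof.
apply/funext => x; rewrite /transition/=; congr (p _).
by apply/seteqP; split => t /=; rewrite ysectionE.
Qed.

Let mpre A : measurable A -> measurable (f @^-1` A).
Proof. by move=> mA; rewrite -[X in measurable X]setTI; exact: measurable_funPT. Qed.

Let mtransition A : measurable A -> measurable_fun setT (transition^~ A).
Proof.
by move=> mA; rewrite transition_ysection; apply: measurable_fun_ysection; exact: mpre.
Qed.

Let mtransition_set A x : measurable A -> measurable [set t | A (f (t, x))].
Proof.
move=> mA; rewrite (_ : [set t | _] = ysection (f @^-1` A) x).
  by apply: measurable_ysection; exact: mpre.
by apply/seteqP; split => t /=; rewrite ysectionE.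
Qed.

Let transition_ge0 x A : 0 <= transition x A.
Proof. exact: measure_ge0. Qed.

Let transition_le1 x A : measurable A -> transition x A <= 1.
Proof. by move=> mA; apply: probability_le1; exact: mtransition_set. Qed.

Let L1_int (h : L1 m) : m.-integrable setT (EFin \o L1_fun h).
Proof. by apply/Lfun1_integrable; exact: L1_fun_Lfun. Qed.

Let mL1 (h : L1 m) : measurable_fun setT (EFin \o L1_fun h).
Proof. exact: measurable_int (L1_int h). Qed.

Let mtr (h : L1 m) A : measurable A ->
  measurable_fun setT (fun x => (L1_fun h x)%:E * transition x A).
Proof.
by move=> mA; apply: emeasurable_funM; [exact: mL1|exact: mtransition].
Qed.

Let itr (h : L1 m) A : measurable A ->
  m.-integrable setT (fun x => (L1_fun h x)%:E * transition x A).
Proof.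
move=> mA; apply: (le_integrable _ (mtr h mA) _ (L1_int h)) => // x _.
rewrite abseM [`|transition x A|]gee0_abs// -[leRHS]mule1.
by apply: lee_pmul => //; exact: transition_le1.
Qed.

Let transport0 h : transport h set0 = 0.
Proof.
rewrite /transport; under eq_integral do rewrite /transition measure0 mule0.
by rewrite integral0.
Qed.

Let transport_fin h A : measurable A -> transport h A \is a fin_num.
Proof. by move=> mA; apply: integrable_fin_num => //; exact: itr. Qed.

Let transport_sigma_additive h : semi_sigma_additive (transport h).
Proof.
move=> F mF tF mUF.
have trU x : \sum_(0 <= i < n) transition x (F i) @[n --> \oo] -->
    transition x (\bigcup_n F n).
  rewrite /transition (_ : [set t | _] = \bigcup_n [set t | F n (f (t, x))]);
    last by apply/seteqP; split.
  apply: measure_semi_sigma_additive.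
  - by move=> i; exact: mtransition_set.
  - by apply/trivIsetP => i j _ _ ij; apply/seteqP; split => // t [/= Fi Fj];
      have /trivIsetP/(_ i j I I ij) := tF => /seteqP[/(_ (f (t, x)))/(_ (conj Fi Fj))].
  - rewrite (_ : \bigcup_n _ = [set t | (\bigcup_n F n) (f (t, x))]).
      exact: mtransition_set.
    by apply/seteqP; split.
rewrite (_ : (fun n => _) = fun n => \int[m]_x
    ((L1_fun h x)%:E * \sum_(0 <= i < n) transition x (F i))); last first.
  apply/funext => n; rewrite -integral_sum//; last by move=> i; exact: itr.
  apply: eq_integral => x _; rewrite ge0_sume_distrr//.
apply: (@dominated_cvg _ _ _ m setT measurableT _ _ (abse \o (EFin \o L1_fun h))).
- move=> n; apply: emeasurable_funM; first exact: mL1.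
  by apply: emeasurable_sum => i; exact: mtransition.
- by move=> x _; apply: cvgeZl => //; exact: trU.
- by [].
- exact: integrable_abse.
- move=> n x _; rewrite abseM -[leRHS]mule1; apply: lee_pmul => //.
  rewrite gee0_abs ?sume_ge0//.
  apply: le_trans (transition_le1 x mUF).
  rewrite -(cvg_lim _ (trU x))//; apply: nneseries_lim_ge => //.
Qed.

HB.instance Definition _ h := isCharge.Build _ _ _ (transport h)
  (transport0 h) (@transport_fin h) (@transport_sigma_additive h).

Let fine_RN_Lfun (h : L1 m) :
  fine \o Radon_Nikodym (transport h) m \in Lfun m 1.
Proof.
apply/Lfun1_integrable.
have [hm|hm] := pselect (transport h `<< m); last first.
  rewrite (_ : _ \o _ = cst 0); first exact: integrable0.
  by apply/funext => x; rewrite /= /Radon_Nikodym; case: pselect.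
apply: eq_integrable (Radon_Nikodym_integrable hm) => // x _ /=.
by rewrite fineK// Radon_Nikodym_fin_num.
Qed.

(* [Radon_Nikodym] is total, with junk value [cst -oo] when its first argument
   is not absolutely continuous with respect to [m]. *)
Definition annealed_PF (h : L1 m) : L1 m :=
  L1_class (Lfun_Sub (lexx 1) (fine_RN_Lfun h)).

Lemma transport_dominates (h : L1 m) :
  nonsingular_transition -> transport h `<< m.
Proof.
move=> ns; apply/null_content_dominatesP => A mA A0.
rewrite /transport (@ae_eq_integral _ _ _ _ _ (cst 0))//; first exact: integral0.
  exact: mtr.
by apply: filterS (ns A mA A0) => x + _; rewrite /transition => ->; rewrite mule0.
Qed.

Lemma annealed_PF_integral (h : L1 m) (A : set X) :
  nonsingular_transition -> measurable A ->
  \int[m]_(x in A) (L1_fun (annealed_PF h) x)%:E = transport h A.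
Proof.
move=> ns mA; have hm := transport_dominates h ns.
rewrite [RHS](Radon_Nikodym_integral hm mA); apply: ae_eq_integral => //.
- exact: measurable_funTS (mL1 _).
- exact: measurable_funTS (measurable_int _ (Radon_Nikodym_integrable hm)).
- apply: filterS (L1_classK (Lfun_Sub (lexx 1) (fine_RN_Lfun h))) => x fx _.
  by rewrite fx//= fineK// Radon_Nikodym_fin_num.
Qed.

End annealed_Perron_Frobenius.
Arguments annealed_PF {dT T dX X R} p m f h.

Section mean_constrictive.
Context d (X : measurableType d) (R : realType).
Variable m : probability X R.

Definition cesaro_mean (Q : L1 m -> L1 m) (n : nat) (h : L1 m) : L1 m :=
  n%:R^-1 *: \sum_(i < n) iter i Q h.

Definition densities : set (L1 m) :=
  [set h | {ae m, forall x, 0 <= L1_fun h x} /\ `|h| = 1].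

(* The infimum is taken in [\bar R], so that the distance to the empty set
   is [+oo]. *)
Definition dist_to (F : set (L1 m)) (phi : L1 m) : \bar R :=
  ereal_inf [set `|phi - psi|%:E | psi in F].

Definition mean_constrictive (Q : L1 m -> L1 m) : Prop :=
  exists F : set (L1 m), compact F /\
    forall h, densities h ->
      dist_to F (cesaro_mean Q n h) @[n --> \oo] --> 0%E.

End mean_constrictive.

Section sequence_space.
Context d (T : measurableType d).

Definition coordinate_sets : set (set (nat -> T)) :=
  \bigcup_i preimage_set_system [set: nat -> T] (fun omega => omega i) measurable.

Definition seq_space : measurableType coordinate_sets.-sigma :=
  g_sigma_algebraType coordinate_sets.

(* [P] is the product measure of countably many copies of [p]: this
   determines [P] since the cylinders are a pi-system generating the
   sigma-algebra of [seq_space]. *)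
Definition is_product_measure (R : realType) (p : probability T R)
    (P : probability seq_space R) : Prop :=
  forall (n : nat) (A : nat -> set T), (forall i, measurable (A i)) ->
    P [set omega | forall i, (i < n)%N -> A i (omega i)] =
    (\prod_(i < n) p (A i))%E.

End sequence_space.

Section random_dynamics.
Context dT (T : measurableType dT) dX (X : measurableType dX) (R : realType).
Variables (p : probability T R) (P : probability (seq_space T) R).
Variable f : {mfun (T * X)%type >-> X}.

(* The sequence [omega_1, omega_2, ...] is indexed from 0 here. *)
Fixpoint random_orbit (omega : seq_space T) (n : nat) (x : X) : X :=
  if n is k.+1 then f (omega k, random_orbit omega k x) else x.

Definition skew_product (z : seq_space T * X) : seq_space T * X :=
  (fun n => z.1 n.+1, f (z.1 0%N, z.2)).

Definition stationary (mu : probability X R) : Prop :=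
  forall A, measurable A ->
    mu A = (\int[p]_t mu ((fun x => f (t, x)) @^-1` A))%E.

Definition invariant_measure d (Y : measurableType d)
    (nu : {measure set Y -> \bar R}) (F : Y -> Y) : Prop :=
  forall A, measurable A -> nu (F @^-1` A) = nu A.

Definition ergodic_measure d (Y : measurableType d)
    (nu : {measure set Y -> \bar R}) (F : Y -> Y) : Prop :=
  invariant_measure nu F /\
  forall A, measurable A -> F @^-1` A = A -> nu A = 0%E \/ nu A = 1%E.

Definition ergodic_stationary (mu : probability X R) : Prop :=
  stationary mu /\ ergodic_measure (P \x mu)%E skew_product.

Definition psi_basin (mu : probability X R) (psi : X -> R)
    (omega : seq_space T) : set X :=
  [set x | n%:R^-1 * \sum_(j < n) psi (random_orbit omega j x) @[n --> \oo]
             --> \int[mu]_y psi y].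

Definition density_support (m mu : probability X R) : set X :=
  [set x | Radon_Nikodym (charge_of_finite_measure mu) m x != 0%E].

Definition FPM_family (m : probability X R) (r : nat)
    (mu : 'I_r -> probability X R) : Prop :=
  [/\ forall i, ergodic_stationary (mu i),
      forall i, mu i `<< m,
      forall i j, i != j ->
        m (density_support m (mu i) `&` density_support m (mu j)) = 0%E
    & forall psi : X -> R, measurable_fun setT psi -> bounded_fun psi ->
        {ae P, forall omega, m (\bigcup_i psi_basin (mu i) psi omega) = 1%E}].

Definition FPM (m : probability X R) : Prop :=
  exists (r : nat) (mu : 'I_r -> probability X R), FPM_family m mu.

End random_dynamics.

Notation borel X := (g_sigma_algebraType (@open X)).

Definition polish_space (R : realType) (X : topologicalType) : Prop :=
  (exists2 D : set X, countable D & dense D) /\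
  exists (M : metricType R) (g : X -> M) (g' : M -> X),
    [/\ cancel g g', cancel g' g, continuous g, continuous g'
      & forall F : set_system M, ProperFilter F -> cauchy F ->
          exists y : M, F --> y].

Section weak_convergence.
Context (R : realType) (X : ptopologicalType).

Definition weak_cvg (nu : nat -> {measure set (borel X) -> \bar R})
    (mu : {measure set (borel X) -> \bar R}) : Prop :=
  forall phi : X -> R, continuous phi -> bounded_fun phi ->
    \int[nu n]_x phi x @[n --> \oo] --> \int[mu]_x phi x.

Context dT (T : measurableType dT).
Variable f : {mfun (T * borel X)%type >-> borel X}.

(* For [n = 0] this is the null measure. *)
Definition empirical_measure (omega : seq_space T) (x : borel X) (n : nat)
    : {measure set (borel X) -> \bar R} :=
  mscale (n%:R^-1)%:nng (msum (fun j => \d_(random_orbit f omega j x)) n).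

Definition basin (mu : probability (borel X) R)
    : set (seq_space T * borel X) :=
  [set z | weak_cvg (empirical_measure z.1 z.2) mu].

Definition basin_at_omega (mu : probability (borel X) R) (omega : seq_space T)
    : set (borel X) := [set x | basin mu (omega, x)].

Definition basin_at_point (mu : probability (borel X) R) (x : borel X)
    : set (seq_space T) := [set omega | basin mu (omega, x)].

End weak_convergence.

(* Main.v *)
Require Import Defs.
From HB Require Import structures.
From mathcomp Require Import all_boot all_order all_algebra.
From mathcomp Require Import all_classical all_reals all_analysis.
From mathcomp Require Import measurable_realfun finmap lra ring.

(* (i) => (ii). If the Cesaro means of the Perron-Frobenius operator L approach a
   compact set, they converge in L^1 to fixed points of L, and the fixed points form
   a vector lattice in which only boundedly many densities can be pairwise disjoint.
   A maximal disjoint family g_1, ..., g_r of invariant densities consists of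
   extremal ones and carries every invariant density.  Extremality makes P x (g_i m)
   ergodic for the skew product, so Birkhoff's theorem holds on the supports; the
   set N of bad points is invariant, hence x |-> P(N_x) has the same integral
   against 1, against its Cesaro means, and against their limit, where it vanishes.

   (ii) => (i). Applying (FPM) to the function equal to i on the support of mu_i
   attaches an index to almost every (omega, x), and perturbing that function by
   c psi shows that the averages of every bounded psi converge to its mu_i-integral
   with the same index i.  Thus A_n h converges weakly to a combination of the
   densities of the mu_i.  It is also a Cauchy sequence in L^1: most of its mass is
   eventually dominated by a multiple of the invariant density g = sum_i g_i, and
   for functions dominated by g Riesz's mean ergodic argument works with the
   quadratic form \int w^2 / g.

   The statements on weak* basins follow from the index by testing against a
   countable family of continuous functions: every nonnegative continuous function
   on a separable metric space is an increasing limit of finite maxima of hats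
   max(0, a - b d(x_k, .)) with rational a and b. *)

Set Implicit Arguments.
Unset Strict Implicit.
Unset Printing Implicit Defensive.

Import Order.TTheory GRing.Theory Num.Theory.
Import numFieldNormedType.Exports.

Local Open Scope classical_set_scope.
Local Open Scope ring_scope.

(** * The space L^1 as a lattice *)

Section L1_tools.
Context d (X : measurableType d) (R : realType).
Variable m : {measure set X -> \bar R}.
Implicit Types g h : L1 m.

(** The mean ergodic theorem fails in L^1 for general Markov operators, since bounded sets need not
    be weakly compact; domination by an invariant density restores it. The form \int w^2 / g is the
    squared norm of w / g in L^2(g m), and a Markov operator fixing g does not increase it. The
    price is a preliminary estimate: the part of A_n h living where g vanishes must be small for
    some n, and this is where the weak convergence deduced from (FPM) enters.

    In (FPM) the exceptional null set, and a priori the measure to which an orbit is attached,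
    depend on psi. An index independent of psi is therefore the key both to the weak convergence of
    A_n h and to the weak* basins, where countably many tests must be passed with the same mu_i.

    Ergodicity concerns subsets of Omega x X, whereas extremality concerns functions on X. The
    bridge is the fiber function x |-> P(A_x): for an invariant A it is fixed by the Koopman
    operator dual to L, and a variance computation makes it constant along almost every step. *)

Lemma L1_integrable h : m.-integrable setT (EFin \o L1_fun h).
Proof. by apply/Lfun1_integrable; exact: L1_fun_Lfun. Qed.

Lemma measurable_L1 h : measurable_fun setT (L1_fun h).
Proof. by apply/measurable_EFinP; exact: measurable_int (L1_integrable h). Qed.

Lemma L1_funD g h : {ae m, forall x, L1_fun (g + h) x = L1_fun g x + L1_fun h x}.
Proof. by apply: filterS (L1_classK (L1_repr g + L1_repr h)) => x /(_ I). Qed.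

Lemma L1_funZ a h : {ae m, forall x, L1_fun (a *: h) x = a * L1_fun h x}.
Proof. by apply: filterS (L1_classK (a *: L1_repr h)) => x /(_ I). Qed.

Lemma L1_fun0 : {ae m, forall x, L1_fun (0 : L1 m) x = 0}.
Proof. by have := L1_funZ 0 (0 : L1 m); rewrite scale0r; apply: filterS => x ->; rewrite mul0r. Qed.

Lemma L1_funN h : {ae m, forall x, L1_fun (- h) x = - L1_fun h x}.
Proof. by rewrite -scaleN1r; apply: filterS (L1_funZ (-1) h) => x ->; rewrite mulN1r. Qed.

Lemma L1_funB g h : {ae m, forall x, L1_fun (g - h) x = L1_fun g x - L1_fun h x}.
Proof. by apply: filterS2 (L1_funD g (- h)) (L1_funN h) => x -> ->. Qed.

Lemma ae_forall_ord r (A : 'I_r -> X -> Prop) :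
  (forall i, {ae m, forall x, A i x}) -> {ae m, forall x, forall i, A i x}.
Proof.
move=> h.
have : {ae m, forall x, forall k : nat, forall i : 'I_r, (i : nat) = k -> A i x}.
  apply: ae_foralln => k; have [kr|rk] := ltnP k r.
    by apply: filterS (h (Ordinal kr)) => x Ax i ik; rewrite (_ : i = Ordinal kr)//; exact: val_inj.
  by apply: aeW => x i ik; move: (ltn_ord i); rewrite ik ltnNge rk.
by apply: filterS => x Ax i; exact: Ax.
Qed.

Lemma L1_fun_sum r (h : 'I_r -> L1 m) :
  {ae m, forall x, L1_fun (\sum_(i < r) h i) x = \sum_(i < r) L1_fun (h i) x}.
Proof.
elim: r h => [|r IH] h.
  by rewrite big_ord0; apply: filterS L1_fun0 => x ->; rewrite big_ord0.
rewrite big_ord_recr/=; apply: filterS2 (L1_funD (\sum_(i < r) h (widen_ord (leqnSn r) i)) (h ord_max))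
  (IH (fun i => h (widen_ord (leqnSn r) i))) => x -> ->.
by rewrite big_ord_recr.
Qed.

Lemma L1_eq g h : {ae m, forall x, L1_fun g x = L1_fun h x} -> g = h.
Proof. by move=> gh; apply/L1_eqP; apply: filterS gh. Qed.

Lemma eq_ae_Rintegral (u v : X -> R) :
  measurable_fun setT u -> measurable_fun setT v ->
  {ae m, forall x, u x = v x} -> \int[m]_x u x = \int[m]_x v x.
Proof.
move=> mu mv uv; congr fine; apply: ae_eq_integral => //.
- exact/measurable_EFinP.
- exact/measurable_EFinP.
- by apply: filterS uv => x ->.
Qed.

(** [max u v] agrees with [v] almost everywhere and dominates [u] at every point, which reduces the
    claim to the pointwise monotonicity of the integral. *)
Lemma le_ae_Rintegral (u v : X -> R) :
  m.-integrable setT (EFin \o u) -> m.-integrable setT (EFin \o v) ->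
  {ae m, forall x, u x <= v x} -> \int[m]_x u x <= \int[m]_x v x.
Proof.
move=> iu iv uv.
have mu : measurable_fun setT u by apply/measurable_EFinP; exact: measurable_int iu.
have mv : measurable_fun setT v by apply/measurable_EFinP; exact: measurable_int iv.
have mM : measurable_fun setT (fun x => Num.max (u x) (v x)) by exact: measurable_maxr.
have vM : {ae m, forall x, v x = Num.max (u x) (v x)}.
  by apply: filterS uv => x uvx; rewrite max_r.
rewrite (eq_ae_Rintegral mv mM vM); apply: le_Rintegral => //.
- have : m.-integrable setT (fun x => (`|u x| + `|v x|)%:E).
    by apply: eq_integrable (integrableD measurableT (integrable_abse iu) (integrable_abse iv)).
  apply: le_integrable => //; first exact/measurable_EFinP.
  move=> x _; rewrite /= lee_fin; apply: le_trans (ler_norm _).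
  by rewrite /Num.max; case: ifP => _; rewrite ?lerDr ?lerDl.
- by move=> x _; rewrite le_max lexx.
Qed.

(** Total in [u], with default value [0] outside the integrable functions; [mkL1K] is what gives
    access to a representative. *)
Definition mkL1 (u : X -> R) : L1 m :=
  if pselect (m.-integrable setT (EFin \o u)) is left H
  then L1_class (Lfun_Sub (lexx 1%E) ((Lfun1_integrable m u).2 H)) else 0.

Lemma mkL1K (u : X -> R) : m.-integrable setT (EFin \o u) ->
  {ae m, forall x, L1_fun (mkL1 u) x = u x}.
Proof.
move=> iu; rewrite /mkL1; case: pselect => // H.
by apply: filterS (L1_classK (Lfun_Sub (lexx 1%E) ((Lfun1_integrable m u).2 H))) => x /(_ I).
Qed.

Lemma L1_normE h : `|h| = \int[m]_x `|L1_fun h x|.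
Proof. by rewrite [LHS]/(L1_norm h) /L1_norm Lnorm1. Qed.

Definition L1_int h : R := \int[m]_x L1_fun h x.

Lemma L1_intD g h : L1_int (g + h) = L1_int g + L1_int h.
Proof.
rewrite /L1_int -RintegralD//; try exact: L1_integrable.
apply: eq_ae_Rintegral; last exact: L1_funD; first exact: measurable_L1.
by apply: measurable_funD; exact: measurable_L1.
Qed.

Lemma L1_intZ a h : L1_int (a *: h) = a * L1_int h.
Proof.
rewrite /L1_int -RintegralZl//; try exact: L1_integrable.
apply: eq_ae_Rintegral; last exact: L1_funZ; first exact: measurable_L1.
by apply: measurable_funM => //; exact: measurable_L1.
Qed.

Lemma L1_intN h : L1_int (- h) = - L1_int h.
Proof. by rewrite -scaleN1r L1_intZ mulN1r. Qed.

Lemma L1_intB g h : L1_int (g - h) = L1_int g - L1_int h.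
Proof. by rewrite L1_intD L1_intN. Qed.

Definition L1_le g h := {ae m, forall x, L1_fun g x <= L1_fun h x}.

Lemma le_L1_int g h : L1_le g h -> L1_int g <= L1_int h.
Proof. by move=> gh; apply: le_ae_Rintegral => //; exact: L1_integrable. Qed.

Lemma L1_norm_ge0E h : L1_le 0 h -> `|h| = L1_int h.
Proof.
move=> h0; rewrite L1_normE; apply: eq_ae_Rintegral.
- by apply: measurableT_comp => //; exact: measurable_L1.
- exact: measurable_L1.
- by apply: filterS2 L1_fun0 h0 => x e; rewrite e; exact: ger0_norm.
Qed.

Lemma L1_le0P h : L1_le 0 h <-> {ae m, forall x, 0 <= L1_fun h x}.
Proof.
by split=> h0; (apply: filterS2 L1_fun0 h0 => x e; rewrite e).
Qed.

Lemma L1_norm_int h : `|L1_int h| <= `|h|.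
Proof. by rewrite L1_normE; apply: le_normr_Rintegral => //; exact: L1_integrable. Qed.

Lemma integrable_normL1 h : m.-integrable setT (EFin \o (fun x => `|L1_fun h x|)).
Proof. exact: integrable_abse (L1_integrable h). Qed.

Lemma L1_le_norm g h : {ae m, forall x, `|L1_fun g x| <= L1_fun h x} -> `|g| <= L1_int h.
Proof.
move=> gh; rewrite L1_normE; apply: le_ae_Rintegral => //.
- exact: integrable_normL1.
- exact: L1_integrable.
Qed.

Lemma L1_norm_le g h : {ae m, forall x, `|L1_fun g x| <= `|L1_fun h x|} -> `|g| <= `|h|.
Proof. by move=> gh; rewrite !L1_normE; apply: le_ae_Rintegral => //; exact: integrable_normL1. Qed.

(** The nonnegative class [h - g] has norm [L1_int h - L1_int g = 0]. Together with preservation of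
    the integral, this turns inequalities for a Markov operator into fixed-point equations. *)
Lemma L1_anti g h : L1_le g h -> L1_int g = L1_int h -> g = h.
Proof.
move=> gh e; apply/esym/subr0_eq/normr0_eq0.
rewrite L1_norm_ge0E; first by rewrite L1_intB e subrr.
by apply/L1_le0P; apply: filterS2 gh (L1_funB h g) => x; rewrite -subr_ge0 => + ->.
Qed.

Definition L1_map (phi : R -> R) h := mkL1 (phi \o L1_fun h).

Lemma L1_mapE (phi : R -> R) h : measurable_fun setT phi -> (forall y, `|phi y| <= `|y|) ->
  {ae m, forall x, L1_fun (L1_map phi h) x = phi (L1_fun h x)}.
Proof.
move=> mphi hphi; apply: mkL1K.
apply: (le_integrable measurableT _ _ (L1_integrable h)).
- by apply/measurable_EFinP; apply: measurableT_comp => //; exact: measurable_L1.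
- by move=> x _; rewrite /= lee_fin.
Qed.

Definition L1_pos := L1_map (fun y => Num.max 0 y).

Lemma L1_posE h : {ae m, forall x, L1_fun (L1_pos h) x = Num.max 0 (L1_fun h x)}.
Proof.
apply: L1_mapE; first exact: measurable_maxr.
by move=> y /=; case: (ltP 0 y) => y0; rewrite ?normr0 ?normr_ge0.
Qed.

Lemma L1_pos_ge0 h : L1_le 0 (L1_pos h).
Proof. by apply/L1_le0P; apply: filterS (L1_posE h) => x ->; rewrite le_max lexx. Qed.

Lemma L1_posB h : L1_pos h - L1_pos (- h) = h.
Proof.
apply: L1_eq; near=> x.
rewrite (near (L1_funB (L1_pos h) (L1_pos (- h))) x)//.
rewrite (near (L1_posE h) x)// (near (L1_posE (- h)) x)// (near (L1_funN h) x)//.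
by case: (ltP 0 (L1_fun h x)) => a; case: (ltP 0 (- L1_fun h x)) => b; lra.
Unshelve. all: by end_near. Qed.

Lemma L1_norm_posD h : `|h| = L1_int (L1_pos h) + L1_int (L1_pos (- h)).
Proof.
rewrite -L1_intD L1_normE; apply: eq_ae_Rintegral.
- by apply: measurableT_comp => //; exact: measurable_L1.
- exact: measurable_L1.
near=> x.
rewrite (near (L1_funD (L1_pos h) (L1_pos (- h))) x)//.
rewrite (near (L1_posE h) x)// (near (L1_posE (- h)) x)// (near (L1_funN h) x)//.
rewrite -maxrN; case: (ltP (L1_fun h x) (- L1_fun h x)) => c;
  by case: (ltP 0 (L1_fun h x)) => a; case: (ltP 0 (- L1_fun h x)) => b; lra.
Unshelve. all: by end_near. Qed.

Lemma L1_dominated (u : nat -> X -> R) (h : L1 m) (v : X -> R) :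
  (forall n, measurable_fun setT (u n)) -> measurable_fun setT v ->
  (forall x, u n x @[n --> \oo] --> v x) ->
  (forall n x, `|u n x| <= `|L1_fun h x|) ->
  `|mkL1 (u n) - mkL1 v| @[n --> \oo] --> 0.
Proof.
move=> mu mv uv uh.
have iu n : m.-integrable setT (EFin \o u n).
  apply: (le_integrable measurableT _ _ (L1_integrable h)).
  - exact/measurable_EFinP.
  - by move=> x _; rewrite /= lee_fin uh.
have [|||||iv cv _] := @dominated_convergence _ _ _ m setT measurableT
    (fun n => EFin \o u n) (EFin \o v) (abse \o (EFin \o L1_fun h)).
- by move=> n; exact/measurable_EFinP.
- exact/measurable_EFinP.
- by apply: aeW => x _; apply: cvg_EFin; [exact: nearW|exact: uv].
- exact: integrable_abse (L1_integrable h).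
- by apply: aeW => x n _; rewrite /= lee_fin.
- have -> : (fun n => `|mkL1 (u n) - mkL1 v|) =
     fine \o (fun n => \int[m]_x `|(EFin \o u n) x - (EFin \o v) x|)%E.
    apply/funext => n /=; rewrite L1_normE; apply: eq_ae_Rintegral.
    + by apply: measurableT_comp => //; exact: measurable_L1.
    + by apply: measurableT_comp => //; exact: measurable_funB.
    by apply: filterS3 (L1_funB (mkL1 (u n)) (mkL1 v)) (mkL1K (iu n)) (mkL1K iv) => x -> -> ->.
  exact: fine_cvg.
Qed.

End L1_tools.

(** * Cesaro means of contractions and Markov operators *)

Lemma cvg0_natP (R : realType) (u : nat -> R) : u n @[n --> \oo] --> 0 <->
  forall e : R, 0 < e -> exists N, forall n, (N <= n)%N -> `|u n| < e.
Proof.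
split=> [/cvgr0Pnorm_lt H e e0|H]; first by have [N _ HN] := H e e0; exists N.
by apply/cvgr0Pnorm_lt => e e0; have [N HN] := H e e0; exists N.
Qed.

Section contraction.
Context (R : realType) d (X : measurableType d) (m : probability X R).
Variable Q : L1 m -> L1 m.
Hypothesis QD : {morph Q : g h / g + h}.
Hypothesis QZ : forall a, {morph Q : h / a *: h}.
Hypothesis Qnorm : forall h, `|Q h| <= `|h|.
Implicit Types g h : L1 m.
Local Notation A := (cesaro_mean Q).

Lemma lin_op0 : Q 0 = 0. Proof. by rewrite -(scale0r (0 : L1 m)) QZ !scale0r. Qed.

Lemma lin_opB : {morph Q : g h / g - h}.
Proof. by move=> g h; rewrite -scaleN1r QD QZ scaleN1r. Qed.

Lemma lin_op_sum r (h : 'I_r -> L1 m) : Q (\sum_(i < r) h i) = \sum_(i < r) Q (h i).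
Proof. exact: (big_morph Q QD lin_op0). Qed.

Lemma iter_opB n g h : iter n Q (g - h) = iter n Q g - iter n Q h.
Proof. by elim: n => // n /= ->; rewrite lin_opB. Qed.

Lemma iter_opD n g h : iter n Q (g + h) = iter n Q g + iter n Q h.
Proof. by elim: n => // n /= ->; rewrite QD. Qed.

Lemma iter_opZ n a h : iter n Q (a *: h) = a *: iter n Q h.
Proof. by elim: n => // n /= ->; rewrite QZ. Qed.

Lemma iter_op_norm n h : `|iter n Q h| <= `|h|.
Proof. by elim: n => //= n; exact: le_trans. Qed.

Lemma cesaroD n g h : A n (g + h) = A n g + A n h.
Proof.
by rewrite /cesaro_mean; under eq_bigr do rewrite iter_opD; rewrite big_split/= scalerDr.
Qed.

Lemma cesaroZ n a h : A n (a *: h) = a *: A n h.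
Proof.
rewrite /cesaro_mean; under eq_bigr do rewrite iter_opZ.
by rewrite -scaler_sumr !scalerA mulrC.
Qed.

Lemma cesaroB n g h : A n (g - h) = A n g - A n h.
Proof. by rewrite -scaleN1r cesaroD cesaroZ scaleN1r. Qed.

Lemma cesaroN n h : A n (- h) = - A n h.
Proof. by rewrite -scaleN1r cesaroZ scaleN1r. Qed.

Lemma cesaro0 n : A n 0 = 0.
Proof. by rewrite -(scale0r (0 : L1 m)) cesaroZ !scale0r. Qed.

Lemma cesaro_sum n r (h : 'I_r -> L1 m) : A n (\sum_(i < r) h i) = \sum_(i < r) A n (h i).
Proof. exact: (big_morph _ (cesaroD n) (cesaro0 n)). Qed.

Lemma cesaro_norm n h : `|A n h| <= `|h|.
Proof.
rewrite /cesaro_mean normrZ ger0_norm ?invr_ge0//.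
have [->|n0] := eqVneq n 0%N; first by rewrite big_ord0 normr0 mulr0.
rewrite ler_pdivrMl ?ltr0n ?lt0n// (le_trans (ler_norm_sum _ _ _))//.
rewrite mulr_natl -[in leRHS](card_ord n) -sumr_const.
by apply: ler_sum => i _; exact: iter_op_norm.
Qed.

Lemma iter_op_fix n g : Q g = g -> iter n Q g = g.
Proof. by move=> Qg; elim: n => //= n ->. Qed.

Lemma cesaro_fix n g : (0 < n)%N -> Q g = g -> A n g = g.
Proof.
move=> n0 Qg; rewrite /cesaro_mean; under eq_bigr do rewrite iter_op_fix//.
by rewrite sumr_const card_ord -(scaler_nat n g) scalerA mulVf ?scale1r// pnatr_eq0 -lt0n.
Qed.

(** The sum telescopes to [h - iter n Q h], of norm at most [2 * |h|]. *)
Lemma cesaro_coboundary n h : `|A n (h - Q h)| <= n%:R^-1 * (2 * `|h|).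
Proof.
rewrite /cesaro_mean normrZ ger0_norm ?invr_ge0//; apply: ler_wpM2l; first by rewrite invr_ge0.
have -> : \sum_(i < n) iter i Q (h - Q h) = h - iter n Q h.
  elim: n => [|n IH]; first by rewrite big_ord0/= subrr.
  by rewrite big_ord_recr/= IH iter_opB -iterSr/= addrA subrK.
by rewrite (le_trans (ler_normB _ _))// mulr_natl mulr2n lerD2l iter_op_norm.
Qed.

Lemma cesaro_iter n k h : `|A n (h - iter k Q h)| <= n%:R^-1 * (2 * `|h|) * k%:R.
Proof.
elim: k => [|k IH]; first by rewrite /= subrr cesaro0 normr0 mulr0.
rewrite (_ : h - _ = (h - iter k Q h) + (iter k Q h - Q (iter k Q h))); last first.
  by rewrite addrA subrK.
rewrite cesaroD (le_trans (ler_normD _ _))// -(natr1 k) [leRHS]mulrDr mulr1 lerD//.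
rewrite (le_trans (cesaro_coboundary _ _))// ler_wpM2l ?invr_ge0//.
by rewrite ler_pM2l// iter_op_norm.
Qed.

(** [h - A k h] is the average of the differences [h - iter i Q h] with [i < k], each a sum of [i]
    coboundaries. Hence [h] and its mean [A k h] have asymptotic Cesaro means. *)
Lemma cesaro_cesaro n k h : (0 < k)%N ->
  `|A n (h - A k h)| <= n%:R^-1 * (2 * `|h|) * k%:R.
Proof.
move=> k0; have kn0 : k%:R != 0 :> R by rewrite pnatr_eq0 -lt0n.
have -> : h - A k h = k%:R^-1 *: \sum_(i < k) (h - iter i Q h).
  by rewrite sumrB scalerBr sumr_const card_ord -(scaler_nat k h) scalerA mulVf ?scale1r.
rewrite cesaroZ normrZ ger0_norm ?invr_ge0// cesaro_sum ler_pdivrMl ?ltr0n//.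
rewrite (le_trans (ler_norm_sum _ _ _))//.
rewrite [leRHS](_ : _ = \sum_(i < k) (n%:R^-1 * (2 * `|h|) * k%:R)); last first.
  by rewrite sumr_const card_ord -[RHS]mulr_natl.
apply: ler_sum => i _; apply: le_trans (cesaro_iter _ _ _) _; apply: ler_wpM2l.
  by rewrite mulr_ge0 ?invr_ge0// mulr_ge0.
by rewrite ler_nat ltnW.
Qed.

Lemma cvg_inv_natM (c : R) : n%:R^-1 * c @[n --> \oo] --> 0.
Proof.
rewrite -[X in _ --> X](mul0r c); apply: cvgMl.
by rewrite -(cvg_shiftS (fun n : nat => n%:R^-1 : R)); exact: cvg_harmonic.
Qed.

Lemma cesaro_cesaro_cvg k h : (0 < k)%N -> `|A n (h - A k h)| @[n --> \oo] --> 0.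
Proof.
move=> k0; apply: (@squeeze_cvgr _ _ _ _ (cst 0) (fun n => n%:R^-1 * ((2 * `|h|) * k%:R))).
- by apply: nearW => n; rewrite normr_ge0/= mulrA cesaro_cesaro.
- exact: cvg_cst.
- exact: cvg_inv_natM.
Qed.

Lemma op_cesaro n h : Q (A n h) = A n (Q h).
Proof.
rewrite /cesaro_mean QZ lin_op_sum; congr (_ *: _).
by apply: eq_bigr => i _; rewrite -iterS iterSr.
Qed.

(** Approximate fixed points suffice: in [Q h - h = (Q g - g) + (g - h) - Q (g - h)] every term is
    small, [Q] being a contraction. *)
Lemma fix_closed h : (forall e : R, 0 < e -> exists2 g, `|Q g - g| < e & `|g - h| < e) -> Q h = h.
Proof.
move=> H; apply/subr0_eq/normr0_eq0/eqP; rewrite eq_le normr_ge0 andbT.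
apply/ler_addgt0Pr => e e0; rewrite add0r.
have [g Qg gh] := H (e / 3) ltac:(by rewrite divr_gt0).
rewrite (_ : Q h - h = (Q g - g) + (g - h) - Q (g - h)); last first.
  by rewrite lin_opB addrA subrK opprB addrA [RHS]addrAC (addrAC _ (- h)) subrr add0r addrC.
rewrite (le_trans (ler_normB _ _))// (le_trans (lerD (ler_normD _ _) (Qnorm _)))//.
lra.
Qed.

(** Means are asymptotically fixed, so a cluster point [g] is fixed. To see that it is the limit,
    choose one [k] with [A k h] close to [g]: in [A n h - g = A n (h - A k h) + A n (A k h - g)] the
    first term tends to [0] and the second stays small because [A n] is a contraction. *)
Lemma cesaro_cluster h g :
  (forall e : R, 0 < e -> forall N, exists2 n, (N <= n)%N & `|A n h - g| < e) ->
  Q g = g /\ `|A n h - g| @[n --> \oo] --> 0.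
Proof.
move=> H.
have Qg : Q g = g.
  apply: fix_closed => e e0.
  have [N HN] := (cvg0_natP _).1 (cvg_inv_natM (2 * `|h|)) e e0.
  have [n Nn hn] := H e e0 N; exists (A n h) => //.
  rewrite op_cesaro -cesaroB -normrN -scaleN1r -cesaroZ scaleN1r opprB.
  apply: le_lt_trans (cesaro_coboundary _ _) _.
  by apply: le_lt_trans (ler_norm _) (HN _ Nn).
split=> //; apply/cvg0_natP => e e0.
have [k k0 hk] := H (e / 2) ltac:(by rewrite divr_gt0) 1%N.
have [N HN] := (cvg0_natP _).1 (cesaro_cesaro_cvg h k0) (e / 2) ltac:(by rewrite divr_gt0).
exists (maxn 1 N) => // n; rewrite geq_max => /andP[n0 Nn].
rewrite normr_id (_ : A n h - g = A n (h - A k h) + A n (A k h - g)); last first.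
  by rewrite !cesaroB (cesaro_fix n0 Qg) subrKA.
have {}HN : `|A n (h - A k h)| < e / 2 by have := HN n Nn; rewrite normr_id.
have : `|A n (A k h - g)| < e / 2 by exact: le_lt_trans (cesaro_norm _ _) hk.
by move: HN; have := ler_normD (A n (h - A k h)) (A n (A k h - g)); lra.
Qed.

End contraction.

(** * Markov operators and the lattice of their fixed points *)

Section markov.
Context (R : realType) d (X : measurableType d) (m : probability X R).
Implicit Types g h : L1 m.

Record is_markov (Q : L1 m -> L1 m) : Prop := IsMarkov {
  markovD : {morph Q : g h / g + h} ;
  markovZ : forall a, {morph Q : h / a *: h} ;
  markov_ge0 : forall h, L1_le 0 h -> L1_le 0 (Q h) ;
  markov_int : forall h, L1_int (Q h) = L1_int h }.

Lemma L1_le0B g h : L1_le g h <-> L1_le 0 (h - g).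
Proof.
split=> H.
  by apply/L1_le0P; apply: filterS2 H (L1_funB h g) => x a ->; rewrite subr_ge0.
by apply: filterS2 ((L1_le0P _).1 H) (L1_funB h g) => x + e; rewrite e subr_ge0.
Qed.

Lemma L1_le0D g h : L1_le 0 g -> L1_le 0 h -> L1_le 0 (g + h).
Proof.
move=> /L1_le0P g0 /L1_le0P h0; apply/L1_le0P.
by apply: filterS3 g0 h0 (L1_funD g h) => x a b ->; exact: addr_ge0.
Qed.

Lemma L1_le0Z a h : 0 <= a -> L1_le 0 h -> L1_le 0 (a *: h).
Proof.
move=> a0 /L1_le0P h0; apply/L1_le0P.
by apply: filterS2 h0 (L1_funZ a h) => x b ->; exact: mulr_ge0.
Qed.

Lemma L1_le0_sum r (h : 'I_r -> L1 m) :
  (forall i, L1_le 0 (h i)) -> L1_le 0 (\sum_(i < r) h i).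
Proof.
move=> H; apply: (big_ind (L1_le 0)) => //; last exact: L1_le0D.
by apply: aeW => x.
Qed.

Lemma L1_int0 : L1_int (0 : L1 m) = 0.
Proof. by rewrite -(scale0r (0 : L1 m)) L1_intZ mul0r. Qed.

Lemma L1_int_sum r (h : 'I_r -> L1 m) : L1_int (\sum_(i < r) h i) = \sum_(i < r) L1_int (h i).
Proof. exact: (big_morph _ (@L1_intD _ _ _ m) L1_int0). Qed.

Lemma densityP h : densities h <-> L1_le 0 h /\ L1_int h = 1.
Proof.
split=> -[h0 h1].
  by split; [exact/L1_le0P|rewrite -h1 L1_norm_ge0E//; exact/L1_le0P].
by split; [exact/L1_le0P|rewrite L1_norm_ge0E].
Qed.

(** For a density [h] the negative part of [g] is at most [|h - g|] pointwise, and [L1_int] is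
    1-Lipschitz; so both conditions pass to the limit. *)
Lemma density_closed g :
  (forall e : R, 0 < e -> exists2 h, densities h & `|h - g| < e) -> densities g.
Proof.
move=> H; apply/densityP.
have g0 : L1_pos (- g) = 0.
  apply/normr0_eq0/eqP; rewrite eq_le normr_ge0 andbT.
  apply/ler_addgt0Pr => e e0; rewrite add0r.
  have [h [h0 _] hg] := H e e0; apply/ltW/(le_lt_trans _ hg)/L1_norm_le.
  near=> x.
  rewrite (near (L1_posE (- g)) x)// (near (L1_funN g) x)// (near (L1_funB h g) x)//.
  have : 0 <= L1_fun h x by near: x; exact: h0.
  case: (ltP 0 (- L1_fun g x)) => a b; last by rewrite normr0.
  by rewrite [leLHS]gtr0_norm//; apply: le_trans (ler_norm _); rewrite lerDr.
split; first by rewrite -(L1_posB g) g0 subr0; exact: L1_pos_ge0.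
apply/subr0_eq/normr0_eq0/eqP; rewrite eq_le normr_ge0 andbT.
apply/ler_addgt0Pr => e e0; rewrite add0r.
have [h /densityP[_ <-] hg] := H e e0.
by rewrite distrC -L1_intB; exact: le_trans (L1_norm_int _) (ltW hg).
Unshelve. all: by end_near. Qed.

Definition disj g h := {ae m, forall x, L1_fun g x * L1_fun h x = 0}.

Lemma disj_sym g h : disj g h -> disj h g.
Proof. by apply: filterS => x; rewrite mulrC. Qed.

(** Where the product of two nonnegative values vanishes, [|g - h| = g + h]. *)
Lemma disj_dist g h : densities g -> densities h -> disj g h -> `|g - h| = 2.
Proof.
move=> /densityP[/L1_le0P g0 g1] /densityP[/L1_le0P h0 h1] gh.
rewrite (_ : 2 = L1_int (g + h)); last by rewrite L1_intD g1 h1.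
rewrite L1_normE; apply: eq_ae_Rintegral.
- by apply: measurableT_comp => //; exact: measurable_L1.
- exact: measurable_L1.
near=> x.
rewrite (near (L1_funB g h) x)// (near (L1_funD g h) x)//.
have gx : 0 <= L1_fun g x by near: x.
have hx : 0 <= L1_fun h x by near: x.
have /eqP : L1_fun g x * L1_fun h x = 0 by near: x.
by rewrite mulf_eq0 => /orP[]/eqP ->; rewrite ?sub0r ?add0r ?subr0 ?addr0 ?normrN ger0_norm.
Unshelve. all: by end_near. Qed.

(** For nonnegative invariant [g] and [h] this stays invariant, being the limit of the lattice
    expressions [L1_pos (h - n g)]; it splits off the part of [h] that is disjoint from [g]. *)
Definition L1_off g h : L1 m := mkL1 m (fun x => if L1_fun g x == 0 then L1_fun h x else 0).

Lemma L1_offE g h :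
  {ae m, forall x, L1_fun (L1_off g h) x = if L1_fun g x == 0 then L1_fun h x else 0}.
Proof.
apply: mkL1K; apply: (le_integrable measurableT _ _ (L1_integrable h)).
  apply/measurable_EFinP; apply: measurable_fun_ifT => //; last exact: measurable_L1.
  by apply: measurable_fun_eqr => //; exact: measurable_L1.
by move=> x _; rewrite /= lee_fin; case: ifP => // _; rewrite normr0.
Qed.

Lemma L1_off_ge0 g h : L1_le 0 h -> L1_le 0 (L1_off g h).
Proof.
move/L1_le0P => h0; apply/L1_le0P; apply: filterS2 h0 (L1_offE g h) => x a ->.
by case: ifP.
Qed.

(* The functions [(h - n g)^+] are dominated by [`|h|] and converge pointwise. *)
Lemma L1_off_cvg g h : L1_le 0 g -> L1_le 0 h ->
  `|L1_pos (h - n%:R *: g) - L1_off g h| @[n --> \oo] --> 0.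
Proof.
move=> g0 h0.
pose u n x := Num.max 0 (L1_fun h x - n%:R * `|L1_fun g x|).
pose v x := if L1_fun g x == 0 then Num.max 0 (L1_fun h x) else 0.
have mg := measurable_L1 g; have mh := measurable_L1 h.
have mu n : measurable_fun setT (u n).
  apply: measurable_maxr => //; apply: measurable_funB => //; apply: measurable_funM => //.
  exact: measurableT_comp.
have mv : measurable_fun setT v.
  apply: measurable_fun_ifT => //; last exact: measurable_maxr.
  exact: measurable_fun_eqr.
have uh n x : `|u n x| <= `|L1_fun h x|.
  rewrite /u; case: (ltP 0 (L1_fun h x - n%:R * `|L1_fun g x|)) => a; last by rewrite normr0.
  rewrite gtr0_norm// (le_trans _ (ler_norm _))// gerBl mulr_ge0//.
have cu : `|mkL1 m (u n) - mkL1 m v| @[n --> \oo] --> 0.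
  apply: (L1_dominated (h := h)) => // x; rewrite /v; case: eqVneq => [gx|gx].
    by apply: cvg_near_cst; apply: nearW => n; rewrite /u gx normr0 mulr0 subr0.
  (* Where [g] is nonzero, [u n] vanishes as soon as [n >= |h| / |g|]. *)
  apply: cvg_near_cst; exists (Num.truncn (`|L1_fun h x| / `|L1_fun g x|)).+1 => // n /= Nn.
  rewrite /u max_l// subr_le0 (le_trans (ler_norm _))// -ler_pdivrMr ?normr_gt0//.
  by rewrite (le_trans (ltW (truncnS_gt _)))// ler_nat.
have offv : L1_off g h = mkL1 m v.
  apply: L1_eq; apply: filterS3 (L1_offE g h) (mkL1K (u := v) (m := m) _) ((L1_le0P h).1 h0).
    by move=> x -> ->; rewrite /v => hx; case: ifP => // _; rewrite max_r.
  apply: (le_integrable measurableT _ _ (L1_integrable h)); first exact/measurable_EFinP.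
  move=> x _; rewrite /= lee_fin /v; case: ifP => _; rewrite ?normr0//.
  by case: (ltP 0 (L1_fun h x)); rewrite ?normr0.
have iu n : m.-integrable setT (EFin \o u n).
  apply: (le_integrable measurableT _ _ (L1_integrable h)); first exact/measurable_EFinP.
  by move=> y _; rewrite /= lee_fin.
have uE n : mkL1 m (u n) = L1_pos (h - n%:R *: g).
  apply: L1_eq; near=> x.
  rewrite (near (L1_posE (h - n%:R *: g)) x)// (near (L1_funB h (n%:R *: g)) x)//.
  rewrite (near (L1_funZ n%:R g) x)// (near (mkL1K (iu n)) x)//.
  have gx : 0 <= L1_fun g x by near: x; exact/L1_le0P.
  by rewrite /u ger0_norm.
rewrite offv (_ : (fun n => _) = fun n => `|mkL1 m (u n) - mkL1 m v|)//.
by apply/funext => n; rewrite uE.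
Unshelve. all: by end_near. Qed.

Section operator.
Variable Q : L1 m -> L1 m.
Hypothesis MQ : is_markov Q.
Local Notation A := (cesaro_mean Q).

(** The norm is the sum of the integrals of the positive and negative parts, and [Q] keeps both
    parts nonnegative with the same integrals. *)
Lemma markov_norm h : `|Q h| <= `|h|.
Proof.
have QB := lin_opB (markovD MQ) (markovZ MQ).
rewrite -{1}(L1_posB h) QB (le_trans (ler_normB _ _))// L1_norm_posD.
by rewrite !(L1_norm_ge0E (markov_ge0 MQ (L1_pos_ge0 _))) !(markov_int MQ).
Qed.

Lemma markov_le g h : L1_le g h -> L1_le (Q g) (Q h).
Proof.
move=> /L1_le0B gh; apply/L1_le0B; rewrite -(lin_opB (markovD MQ) (markovZ MQ)).
exact: markov_ge0.
Qed.

Lemma cesaro_ge0 n h : L1_le 0 h -> L1_le 0 (A n h).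
Proof.
move=> h0; apply: L1_le0Z; first by rewrite invr_ge0.
by apply: L1_le0_sum => i; elim: (i : nat) => //= k; exact: markov_ge0.
Qed.

Lemma cesaro_int n h : (0 < n)%N -> L1_int (A n h) = L1_int h.
Proof.
move=> n0; rewrite /cesaro_mean L1_intZ L1_int_sum.
rewrite (eq_bigr (fun=> L1_int h)); last first.
  by move=> i _; elim: (i : nat) => //= k; rewrite (markov_int MQ).
by rewrite sumr_const card_ord -(mulr_natl (L1_int h)) mulrA mulVf ?mul1r// pnatr_eq0 -lt0n.
Qed.

Lemma cesaro_density n h : (0 < n)%N -> densities h -> densities (A n h).
Proof.
by move=> n0 /densityP[h0 h1]; apply/densityP; rewrite cesaro_int//; split=> //; exact: cesaro_ge0.
Qed.

(** [Q (L1_pos f)] dominates both [Q f = f] and [0], hence [L1_pos f]; having the same integral, the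
    two coincide. *)
Lemma markov_fix_pos f : Q f = f -> Q (L1_pos f) = L1_pos f.
Proof.
move=> Qf; apply/esym/L1_anti; last by rewrite (markov_int MQ).
have : L1_le f (L1_pos f) by apply: filterS (L1_posE f) => x ->; rewrite le_max lexx orbT.
move/markov_le; rewrite Qf => f1.
have /L1_le0P f2 := markov_ge0 MQ (L1_pos_ge0 f).
by apply: filterS3 f1 f2 (L1_posE f) => x a b ->; rewrite ge_max b.
Qed.

Lemma markov_fixB f g : Q f = f -> Q g = g -> Q (f - g) = f - g.
Proof. by move=> Qf Qg; rewrite (lin_opB (markovD MQ) (markovZ MQ)) Qf Qg. Qed.

Lemma markov_fix_off g h : Q g = g -> L1_le 0 g -> Q h = h -> L1_le 0 h ->
  Q (L1_off g h) = L1_off g h.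
Proof.
move=> Qg g0 Qh h0.
apply: (fix_closed (markovD MQ) (markovZ MQ) markov_norm) => e e0.
have [N HN] := (cvg0_natP _).1 (L1_off_cvg g0 h0) e e0.
exists (L1_pos (h - N%:R *: g)); last by have := HN N (leqnn N); rewrite normr_id.
rewrite markov_fix_pos ?subrr ?normr0//; apply: markov_fixB => //.
by rewrite (markovZ MQ) Qg.
Qed.

End operator.
End markov.

(** * Invariant densities of a mean constrictive operator *)

Section constrictive.
Context (R : realType) d (X : measurableType d) (m : probability X R).
Variable Q : L1 m -> L1 m.
Hypothesis MQ : is_markov Q.
Implicit Types g h : L1 m.
Local Notation A := (cesaro_mean Q).

Lemma dist_to_cvg0 (F : set (L1 m)) (u : nat -> L1 m) :
  dist_to F (u n) @[n --> \oo] --> 0%E ->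
  forall e : R, 0 < e -> exists N, forall n, (N <= n)%N -> exists2 psi, F psi & `|u n - psi| < e.
Proof.
move=> H e e0.
have e0' : (0 < e%:E)%E by rewrite lte_fin.
have [N _ HN] := H _ (open_ereal_lt' e0'); exists N => n /HN.
by move=> /ereal_inf_lt[_ [psi Fpsi <-]]; rewrite lte_fin; exists psi.
Qed.

Definition inv_density g := densities g /\ Q g = g.

Lemma constrictive_cvg h : mean_constrictive Q -> densities h ->
  exists2 g, inv_density g & `|A n h - g| @[n --> \oo] --> 0.
Proof.
move=> [F [cF HF]] dh.
have H := dist_to_cvg0 (HF h dh).
(* A time beyond [k], with a point of [F] near the mean at that time. Demanding [k < z.1] makes a
   cluster point of the chosen points of [F] a cluster point of the means at arbitrarily late
   times. *)
have /choice[w Hw] (k : nat) : exists z : nat * L1 m,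
    [/\ (k < z.1)%N, F z.2 & `|A z.1 h - z.2| < k.+1%:R^-1].
  have [N HN] := H k.+1%:R^-1 ltac:(by rewrite invr_gt0).
  have [psi Fpsi hpsi] := HN (maxn N k.+1) (leq_maxl _ _).
  by exists (maxn N k.+1, psi); split => //=; rewrite leq_max leqnn orbT.
have [g [_ clg]] := cF ((fun k => (w k).2) @ \oo) _ ltac:(by exists 0%N => // k _; case: (Hw k)).
have Hg (e : R) : 0 < e -> forall N, exists2 n, (N < n)%N & `|A n h - g| < e.
  move=> e0 N.
  have e2 : 0 < e / 2 by rewrite divr_gt0.
  have [N1 HN1] := (cvg0_natP (fun n => n.+1%:R^-1 : R)).1 (@cvg_harmonic R) _ e2.
  have [||y [[k /= Nk ky] yg]] := clg [set (w k).2 | k in [set k | (maxn N N1 <= k)%N]] (ball g (e / 2)).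
  - by exists (maxn N N1) => // k /= ?; exists k.
  - exact: nbhsx_ballx.
  exists (w k).1.
    by case: (Hw k) => + _ _; apply: leq_trans; rewrite ltnS (leq_trans _ Nk)// leq_maxl.
  have h1 : `|A (w k).1 h - (w k).2| < e / 2.
    case: (Hw k) => _ _ /lt_trans; apply; apply: le_lt_trans (ler_norm _) (HN1 k _).
    by rewrite (leq_trans _ Nk)// leq_maxr.
  have h2 : `|(w k).2 - g| < e / 2.
    by move: yg; rewrite -ball_normE /ball_/= -ky distrC.
  rewrite (_ : A (w k).1 h - g = (A (w k).1 h - (w k).2) + ((w k).2 - g)); last by rewrite subrKA.
  by rewrite (le_lt_trans (ler_normD _ _))// (splitr e) ltrD.
have [Qg cg] : Q g = g /\ `|A n h - g| @[n --> \oo] --> 0.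
  apply: (cesaro_cluster (markovD MQ) (markovZ MQ) (markov_norm MQ)) => e e0 N.
  by have [n /ltnW Nn] := Hg e e0 N; exists n.
exists g => //; split=> //; apply: density_closed => e e0.
have [n n0] := Hg e e0 0%N; exists (A n h) => //; exact: cesaro_density.
Qed.

Definition inv_family r (g : 'I_r -> L1 m) :=
  (forall i, inv_density (g i)) /\ forall i j, i != j -> disj (g i) (g j).

(* Disjoint densities are at distance 2, so each ball of radius 1/2 in a finite
   cover of the compact set accounts for at most one member of the family. *)
Lemma inv_family_bound : mean_constrictive Q ->
  exists N, forall r (g : 'I_r -> L1 m), inv_family g -> (r <= N)%N.
Proof.
move=> [F [cF HF]].
have e2 : 0 < 2^-1 :> R by rewrite invr_gt0.
move: cF; rewrite compact_cover => /(_ _ F (fun i => ball i (2^-1 : R)))[||D DF FD].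
- by move=> i _; exact: ball_open.
- by move=> x Fx; exists x => //; exact: ballxx.
exists (size (finmap.enum_fset D)) => r g [gi gd].
have /choice[c Hc] (i : 'I_r) : exists c, c \in D /\ `|g i - c| < 1.
  have [dg Qg] := gi i.
  have [N HN] := dist_to_cvg0 (HF _ dg) e2.
  have [psi Fpsi hpsi] := HN N.+1 (leqnSn N).
  have [c /= Dc] := FD _ Fpsi; rewrite -ball_normE /ball_/= => hc.
  exists c; split=> //; rewrite (cesaro_fix _ Qg)// in hpsi.
  rewrite (_ : g i - c = (g i - psi) - (c - psi)); last by rewrite opprB subrKA.
  by rewrite (le_lt_trans (ler_normB _ _))// (splitr 1) mul1r ltrD.
have inj : injective c.
  move=> i j cij; apply/eqP; apply: contraT => ij.
  have := disj_dist (gi i).1 (gi j).1 (gd _ _ ij).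
  have [_ hi] := Hc i; have [_ hj] := Hc j; rewrite -cij in hj.
  rewrite (_ : g i - g j = (g i - c i) - (g j - c i)); last by rewrite opprB subrKA.
  move=> eq2; have := ler_normB (g i - c i) (g j - c i); rewrite eq2 => H.
  by have := le_lt_trans H (ltrD hi hj); rewrite ltxx.
rewrite -[leqLHS]card_ord cardE -(size_map c); apply: uniq_leq_size.
  by rewrite map_inj_uniq// enum_uniq.
by move=> _ /mapP[i _ ->]; case: (Hc i).
Qed.

Lemma inv_family_extend r (g : 'I_r -> L1 m) h : inv_family g -> inv_density h ->
  (forall i, disj (g i) h) -> exists g' : 'I_r.+1 -> L1 m, inv_family g'.
Proof.
move=> [gi gd] ih gh; exists (fun j => if unlift ord_max j is Some i then g i else h).
split=> [i|i j]; first by case: unliftP.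
case: unliftP => [i' ->|->]; case: unliftP => [j' ->|->].
- by rewrite (inj_eq lift_inj) => /gd.
- by move=> _; exact: gh.
- by move=> _; exact/disj_sym/gh.
- by rewrite eqxx.
Qed.

Lemma inv_density_normalize f : f <> 0 -> L1_le 0 f -> Q f = f ->
  inv_density (`|f|^-1 *: f).
Proof.
move=> f0 f_ge0 Qf; split; last by rewrite (markovZ MQ) Qf.
apply/densityP; split; first by apply: L1_le0Z => //; rewrite invr_ge0.
by rewrite L1_intZ -L1_norm_ge0E// mulVf// normr_eq0; exact/eqP.
Qed.

Lemma disjZr a g h : disj g h -> disj g (a *: h).
Proof. by move=> gh; apply: filterS2 gh (L1_funZ a h) => x + ->; rewrite mulrCA => ->; rewrite mulr0. Qed.

(** Both properties express maximality. An invariant density charging the common zero set of the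
    [g i] would leave there a new disjoint member. If [h], carried by the support of [g i], differs
    from it, then [h - g i] has zero integral, so its positive and negative parts are both nonzero
    and invariant; one of them replaces [g i] and the other is added. *)
Theorem constrictive_decomposition : mean_constrictive Q ->
  exists r (g : 'I_r -> L1 m), [/\ inv_family g,
    forall h, inv_density h ->
      {ae m, forall x, (forall i, L1_fun (g i) x = 0) -> L1_fun h x = 0} &
    forall i h, inv_density h ->
      {ae m, forall x, L1_fun (g i) x = 0 -> L1_fun h x = 0} -> h = g i].
Proof.
move=> /inv_family_bound[N HN].
pose P r := `[< exists g : 'I_r -> L1 m, inv_family g >].
have [r /asboolP[g fg] rmax] : exists2 r, P r & forall s, P s -> (s <= r)%N.
  have exP : exists r, P r.
    by exists 0%N; apply/asboolP; exists (fun=> 0); split=> -[].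
  have ubP r : P r -> (r <= N)%N by move=> /asboolP[g]; exact: HN.
  by case: (ex_maxnP exP ubP) => r; exists r.
have nofam (g' : 'I_r -> L1 m) h : inv_family g' -> inv_density h ->
    (forall i, disj (g' i) h) -> False.
  move=> fg' ih /(inv_family_extend fg' ih) H.
  by have := rmax r.+1 (asboolT H); rewrite ltnn.
have [gi gd] := fg.
have g0 i : L1_le 0 (g i) by case: (gi i) => /densityP[].
have aeg0 i : {ae m, forall x, 0 <= L1_fun (g i) x} by exact/L1_le0P.
exists r, g; split=> // [h ih|i h ih hgi].
- pose G : L1 m := \sum_(i < r) g i.
  have QG : Q G = G.
    rewrite /G (lin_op_sum (markovD MQ) (markovZ MQ)).
    by apply: eq_bigr => i _; case: (gi i).
  have G0 : L1_le 0 G by exact: L1_le0_sum.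
  have [/densityP[h0 h1] Qh] := ih.
  have Gz : {ae m, forall x, L1_fun G x = 0 <-> forall i, L1_fun (g i) x = 0}.
    apply: filterS2 (L1_fun_sum g) (ae_forall_ord aeg0) => x -> gx; split.
      by move=> /psumr_eq0P H i; apply: H.
    by move=> H; apply: big1.
  have [e|n0] := pselect (L1_off G h = 0).
    apply: filterS3 (L1_fun0 m) (L1_offE G h) Gz => x z + Gx; rewrite e z => eh /Gx /eqP Gx0.
    by rewrite Gx0 in eh.
  exfalso.
  have Qoff := markov_fix_off MQ QG G0 Qh h0.
  apply: (nofam g) (inv_density_normalize n0 (L1_off_ge0 G h0) Qoff) _ => // i.
  apply: disjZr; apply: filterS2 (L1_offE G h) Gz => x -> Gx.
  by case: eqP => [/Gx ->|]; rewrite ?mul0r ?mulr0.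
- have [//|n0] := pselect (h = g i); exfalso.
  have [dh Qh] := ih; have [dgi Qgi] := gi i.
  set f := h - g i.
  have Qf : Q f = f by exact: markov_fixB.
  have fint : L1_int f = 0.
    by rewrite L1_intB (proj2 ((densityP h).1 dh)) (proj2 ((densityP _).1 dgi)) subrr.
  have fneq : `|f| != 0 by rewrite normr_eq0 subr_eq0; exact/eqP.
  have eqint : L1_int (L1_pos f) = L1_int (L1_pos (- f)).
    by apply/subr0_eq; rewrite -L1_intB L1_posB fint.
  have pos_neq0 (k : L1 m) : L1_int (L1_pos k) = L1_int (L1_pos f) -> L1_pos k <> 0.
    move=> kf k0; move: fneq; rewrite L1_norm_posD -eqint -kf k0 L1_int0 addr0.
    by rewrite eqxx.
  have ip : inv_density (`|L1_pos f|^-1 *: L1_pos f).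
    apply: inv_density_normalize; [exact: pos_neq0|exact: L1_pos_ge0|exact: markov_fix_pos].
  have iN : inv_density (`|L1_pos (- f)|^-1 *: L1_pos (- f)).
    apply: inv_density_normalize; [exact: pos_neq0|exact: L1_pos_ge0|].
    apply: markov_fix_pos => //; rewrite -(sub0r f); apply: markov_fixB => //.
    exact: (lin_op0 (markovZ MQ)).
  have fz : {ae m, forall x, L1_fun (g i) x = 0 -> L1_fun f x = 0}.
    by apply: filterS2 hgi (L1_funB h (g i)) => x H -> gx; rewrite H// gx subrr.
  have fz' : {ae m, forall x, L1_fun (g i) x = 0 -> L1_fun (- f) x = 0}.
    by apply: filterS2 fz (L1_funN f) => x H -> gx; rewrite H// oppr0.
  have fzp (k : L1 m) j : {ae m, forall x, L1_fun (g i) x = 0 -> L1_fun k x = 0} ->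
      j != i -> disj (g j) (L1_pos k).
    move=> kz ji; apply: filterS3 (gd j i ji) kz (L1_posE k) => x /eqP + kx ->.
    rewrite mulf_eq0 => /orP[/eqP->|/eqP gx]; first by rewrite mul0r.
    by rewrite kx// max_r// mulr0.
  apply: (nofam (fun j => if j == i then `|L1_pos f|^-1 *: L1_pos f else g j)) iN _.
    split=> [j|j k]; first by case: eqP.
    move=> jk; case: eqP => [ji|/eqP ji]; case: eqP => [ki|/eqP ki].
    + by rewrite ji ki eqxx in jk.
    + by apply/disj_sym/disjZr; exact: fzp.
    + by apply/disjZr; exact: fzp.
    + exact: gd.
  move=> j; apply: disjZr; case: eqP => [_|/eqP ji]; last exact: fzp.
  apply/disj_sym/disjZr; near=> x.
  rewrite (near (L1_posE f) x)// (near (L1_posE (- f)) x)// ?(near (L1_funN f) x)//.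
  case: (ltP 0 (L1_fun f x)) => a; last by rewrite mulr0.
  by rewrite max_l ?mul0r// oppr_le0 ltW.
Unshelve. all: by end_near. Qed.

End constrictive.

(** * The mean ergodic theorem for dominated functions *)

(** With [0^-1 = 0] inversion is discontinuous at [0]; on each half-line it agrees, up to signs,
    with the power function of exponent [-1]. *)
Lemma measurable_invr (R : realType) : measurable_fun [set: R] (@GRing.inv R).
Proof.
rewrite (_ : GRing.inv = fun x : R => if 0 <= x then x `^ (-1) else - (- x) `^ (-1)).
  apply: measurable_fun_ifT; first exact: measurable_fun_ler.
  - exact: measurable_powR.
  - apply: measurableT_comp => //; apply: (measurableT_comp (measurable_powR _)) => //.
apply/funext => x; case: leP => x0; first by rewrite powR_inv1.
by rewrite powR_inv1 ?oppr_ge0 ?ltW// invrN opprK.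
Qed.

Section quadratic.
Context (R : realType) d (X : measurableType d) (m : probability X R).
Implicit Types g h u v w : L1 m.

Lemma cesaro_markov (Q : L1 m -> L1 m) n : is_markov Q -> (0 < n)%N -> is_markov (cesaro_mean Q n).
Proof.
move=> MQ n0; split.
- exact: cesaroD (markovD MQ) _.
- by move=> a h; exact: (cesaroZ (markovZ MQ)).
- by move=> h; exact: cesaro_ge0.
- by move=> h; exact: cesaro_int.
Qed.

Variable g : L1 m.
Hypothesis g0 : L1_le 0 g.

Let aeg0 : {ae m, forall x, 0 <= L1_fun g x}. Proof. exact/L1_le0P. Qed.

Definition L1_dom M w := {ae m, forall x, `|L1_fun w x| <= M * L1_fun g x}.

(* Division by [0] makes the value [0] where [g = 0]; functions dominated by
   a multiple of [g] vanish there. *)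
Definition L1_sq w : L1 m := mkL1 m (fun x => L1_fun w x ^+ 2 / L1_fun g x).

Lemma L1_sqE M w : L1_dom M w ->
  {ae m, forall x, L1_fun (L1_sq w) x = L1_fun w x ^+ 2 / L1_fun g x}.
Proof.
move=> wM; apply: mkL1K.
(* A truncation of the quotient that satisfies [|k| <= |M * w|] at every point, and not only outside
   a null set. *)
pose k x := if `|L1_fun w x| <= M * L1_fun g x then
  if 0 < L1_fun g x then L1_fun w x ^+ 2 / L1_fun g x else 0 else 0.
have mg := measurable_L1 g; have mw := measurable_L1 w.
have mwg : measurable_fun setT (fun x => L1_fun w x ^+ 2 / L1_fun g x).
  apply: measurable_funM; first exact: measurable_funX.
  exact: (measurableT_comp (@measurable_invr R)).
have mk : measurable_fun setT k.
  apply: measurable_fun_ifT => //.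
    apply: measurable_fun_ler; first exact: measurableT_comp.
    exact: measurable_funM.
  by apply: measurable_fun_ifT => //; exact: measurable_fun_ltr.
have kw : {ae m, forall x, k x = L1_fun w x ^+ 2 / L1_fun g x}.
  apply: filterS2 wM aeg0 => x a b; rewrite /k a.
  case: ltP => // c; have -> : L1_fun g x = 0 by apply/le_anti/andP.
  by rewrite invr0 mulr0.
apply/integrableP; split; first exact/measurable_EFinP.
rewrite (ae_eq_integral (fun x => `|(k x)%:E|)%E) //=.
- suff /integrableP[] : m.-integrable setT (EFin \o k) by [].
  apply: (le_integrable measurableT _ _ (integrableZl measurableT M (L1_integrable w))).
    exact/measurable_EFinP.
  move=> x _; rewrite /= lee_fin /k; case: ifP => a; last by rewrite normr0.
  case: ifP => b; last by rewrite normr0.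
  rewrite normrM normfV normrX (gtr0_norm b) ler_pdivrMr// expr2 normrM mulrAC.
  apply: ler_wpM2r => //; apply: le_trans a _.
  by apply: ler_wpM2r; [exact: ltW|exact: ler_norm].
- by apply/measurable_EFinP; apply: measurableT_comp.
- by apply/measurable_EFinP; apply: measurableT_comp.
- by apply: filterS kw => x ->.
Qed.

Lemma L1_sq_ge0 M w : L1_dom M w -> L1_le 0 (L1_sq w).
Proof.
move=> wM; apply/L1_le0P; apply: filterS2 aeg0 (L1_sqE wM) => x a ->.
by rewrite divr_ge0// sqr_ge0.
Qed.

Lemma L1_domD M N v w : L1_dom M v -> L1_dom N w -> L1_dom (M + N) (v + w).
Proof.
move=> vM wN; apply: filterS3 vM wN (L1_funD v w) => x a b ->.
by rewrite (le_trans (ler_normD _ _))// mulrDl lerD.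
Qed.

Lemma L1_domZ M a w : L1_dom M w -> L1_dom (`|a| * M) (a *: w).
Proof.
move=> wM; apply: filterS2 wM (L1_funZ a w) => x b ->.
by rewrite normrM -mulrA ler_wpM2l.
Qed.

Lemma L1_domB M N v w : L1_dom M v -> L1_dom N w -> L1_dom (M + N) (v - w).
Proof.
move=> vM wN; apply: L1_domD => //; rewrite -scaleN1r.
by have := L1_domZ (-1) wN; rewrite normrN1 mul1r.
Qed.

Lemma markov_dom Q M w : is_markov Q -> Q g = g -> L1_dom M w -> L1_dom M (Q w).
Proof.
move=> MQ Qg wM.
have h1 : L1_le w (M *: g).
  by apply: filterS2 wM (L1_funZ M g) => x + -> => /(le_trans (ler_norm _)).
have h2 : L1_le (- w) (M *: g).
  apply: filterS3 wM (L1_funZ M g) (L1_funN w) => x + -> -> => /(le_trans _) -> //.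
  by rewrite -normrN ler_norm.
move: (markov_le MQ h1) (markov_le MQ h2); rewrite (markovZ MQ) Qg => {}h1 {}h2.
have QN : Q (- w) = - Q w by rewrite -scaleN1r (markovZ MQ) scaleN1r.
have {}h2 : {ae m, forall x, - L1_fun (Q w) x <= L1_fun (M *: g) x}.
  by move: h2; rewrite QN => h2; apply: filterS2 h2 (L1_funN (Q w)) => x + e; rewrite e.
by apply: filterS3 (L1_funZ M g) h1 h2 => x e a b; rewrite -e ler_norml lerNl b a.
Qed.

Lemma quadratic_min (a b c : R) : 0 < c ->
  (forall s : rat, 0 <= a - 2 * ratr s * b + ratr s ^+ 2 * c) -> b ^+ 2 / c <= a.
Proof.
move=> c0 H; rewrite leNgt; apply/negP => ltab.
pose e := b ^+ 2 / c - a; have e0 : 0 < e by rewrite subr_gt0.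
(* With [|t| < dl], the bounds [dl <= 1] and [dl <= e / c] give [t ^+ 2 < e / c], so the quadratic
   is negative at this rational. *)
pose dl := Num.min 1 (e / c); have dl0 : 0 < dl by rewrite lt_min ltr01 divr_gt0.
have : b / c - dl < b / c + dl by lra.
move=> /rat_in_itvoo[s]; rewrite in_itv/= => /andP[s1 s2].
have := H s; apply/negP; rewrite -ltNge.
set t := ratr s - b / c.
have -> : a - 2 * ratr s * b + ratr s ^+ 2 * c = - e + t ^+ 2 * c.
  by rewrite /t /e; field; rewrite gt_eqF.
rewrite addrC subr_lt0 -ltr_pdivlMr//.
have td : `|t| < dl by rewrite ltr_norml /t; apply/andP; split; lra.
rewrite -real_normK ?num_real// expr2 -[ltRHS]mul1r.
have [d1 d2] : dl <= 1 /\ dl <= e / c by rewrite !ge_min !lexx orbT.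
apply: ltr_pM => //; exact: lt_le_trans td _.
Qed.

(* Jensen's inequality: [(w - s g)^2 / g >= 0] for every rational [s]; apply [Q],
   then optimize over [s]. *)
Lemma markov_sq Q M w : is_markov Q -> Q g = g -> L1_dom M w ->
  L1_le (L1_sq (Q w)) (Q (L1_sq w)).
Proof.
move=> MQ Qg wM; have QwM := markov_dom MQ Qg wM.
have H (s : rat) : {ae m, forall x, 0 <= L1_fun (Q (L1_sq w)) x
    - 2 * ratr s * L1_fun (Q w) x + ratr s ^+ 2 * L1_fun g x}.
  pose k : L1 m := L1_sq w + (- (2 * ratr s)) *: w + (ratr s ^+ 2) *: g.
  have k0 : L1_le 0 k.
    apply/L1_le0P; near=> x.
    rewrite (near (L1_funD (L1_sq w + (- (2 * ratr s)) *: w) ((ratr s ^+ 2) *: g)) x)//.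
    rewrite (near (L1_funD (L1_sq w) ((- (2 * ratr s)) *: w)) x)//.
    rewrite (near (L1_funZ (ratr s ^+ 2) g) x)// (near (L1_funZ (- (2 * ratr s)) w) x)//.
    rewrite (near (L1_sqE wM) x)//.
    have a : `|L1_fun w x| <= M * L1_fun g x by near: x.
    have : 0 <= L1_fun g x by near: x.
    rewrite le_eqVlt => /predU1P[e|gx].
      move: a; rewrite -e mulr0 normr_le0 => /eqP ->; rewrite expr0n/= !mulr0.
      by rewrite mul0r !addr0.
    rewrite (_ : _ + _ = (L1_fun w x - ratr s * L1_fun g x) ^+ 2 / L1_fun g x).
      by rewrite divr_ge0 ?sqr_ge0 ?ltW.
    by field; rewrite gt_eqF.
  have /L1_le0P := markov_ge0 MQ k0; rewrite /k !(markovD MQ) !(markovZ MQ) Qg => Qk.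
  near=> x.
  have : 0 <= L1_fun (Q (L1_sq w) + - (2 * ratr s) *: Q w + ratr s ^+ 2 *: g) x by near: x.
  rewrite (near (L1_funD (Q (L1_sq w) + (- (2 * ratr s)) *: Q w) ((ratr s ^+ 2) *: g)) x)//.
  rewrite (near (L1_funD (Q (L1_sq w)) ((- (2 * ratr s)) *: Q w)) x)//.
  rewrite (near (L1_funZ (ratr s ^+ 2) g) x)// (near (L1_funZ (- (2 * ratr s)) (Q w)) x)//.
  by rewrite mulNr.
have Hall : {ae m, forall x, forall s : rat, 0 <= L1_fun (Q (L1_sq w)) x
    - 2 * ratr s * L1_fun (Q w) x + ratr s ^+ 2 * L1_fun g x}.
  (* Rationality of [s] keeps the exceptional null sets countable in number; [pickle] arranges them
     in a sequence. *)
  have := ae_foralln (fun n => H (odflt (0 : rat) (choice.unpickle n))).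
  by apply: filterS => x Hx s; have := Hx (choice.pickle s); rewrite choice.pickleK.
have /L1_le0P Qsq0 := markov_ge0 MQ (L1_sq_ge0 wM).
near=> x.
rewrite (near (L1_sqE QwM) x)//.
have : 0 <= L1_fun g x by near: x.
rewrite le_eqVlt => /predU1P[<-|gx].
  by rewrite invr0 mulr0; near: x.
by apply: quadratic_min => //; near: x.
Unshelve. all: by end_near. Qed.

Definition qform w := L1_int (L1_sq w).

Lemma qform_ge0 M w : L1_dom M w -> 0 <= qform w.
Proof. by move=> /L1_sq_ge0 /le_L1_int; rewrite L1_int0. Qed.

Lemma markov_qform Q M w : is_markov Q -> Q g = g -> L1_dom M w -> qform (Q w) <= qform w.
Proof.
by move=> MQ Qg wM; rewrite /qform -[leRHS](markov_int MQ); exact/le_L1_int/(markov_sq MQ Qg wM).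
Qed.

(** Pointwise [(p + q)^2 - p^2 = (2 p + q) q] and [|2 p + q| <= 4 M g], so an L^1-small perturbation
    increases the form only little. The bound [M + M] is the one available for a difference of two
    functions dominated by [M g]. *)
Lemma qform_add M v w : 0 <= M -> L1_dom M v -> L1_dom (M + M) w ->
  qform (v + w) <= qform v + 4 * M * `|w|.
Proof.
move=> M0 vM wM; have vwM := L1_domD vM wM.
rewrite L1_normE /qform -(RintegralZl (mu := m))//; last exact: integrable_normL1.
rewrite /L1_int -RintegralD//; [|exact: L1_integrable|]; last first.
  exact: (integrableZl measurableT (4 * M) (integrable_normL1 w)).
apply: le_ae_Rintegral; first exact: L1_integrable.
  apply: eq_integrable (integrableD measurableT (L1_integrable (L1_sq v))
    (integrableZl measurableT (4 * M) (integrable_normL1 w))) => //.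
near=> x.
rewrite (near (L1_sqE vwM) x)// (near (L1_sqE vM) x)// (near (L1_funD v w) x)//.
have a : `|L1_fun v x| <= M * L1_fun g x by near: x.
have b : `|L1_fun w x| <= (M + M) * L1_fun g x by near: x.
have : 0 <= L1_fun g x by near: x.
rewrite le_eqVlt => /predU1P[<-|gx].
  by rewrite invr0 !mulr0 add0r mulr_ge0// mulr_ge0.
rewrite -lerBlDl -mulrBl ler_pdivrMr//.
move: (L1_fun v x) (L1_fun w x) (L1_fun g x) a b gx => p q r a b gx.
have -> : (p + q) ^+ 2 - p ^+ 2 = (2 * p + q) * q by ring.
apply: le_trans (ler_norm _) _; rewrite normrM mulrAC ler_wpM2r//.
rewrite (le_trans (ler_normD _ _))// normrM ger0_norm//; lra.
Unshelve. all: by end_near. Qed.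

Lemma qform_parallelogram M v w : L1_dom M v -> L1_dom M w ->
  qform (v - w) = 2 * qform v + 2 * qform w - 4 * qform (2^-1 *: (v + w)).
Proof.
move=> vM wM; have vwM := L1_domB vM wM; have mM := L1_domZ 2^-1 (L1_domD vM wM).
rewrite /qform -!L1_intZ -L1_intD -L1_intB; congr L1_int; apply: L1_eq; near=> x.
rewrite (near (L1_funB (2 *: L1_sq v + 2 *: L1_sq w) (4 *: L1_sq (2^-1 *: (v + w)))) x)//.
rewrite (near (L1_funD (2 *: L1_sq v) (2 *: L1_sq w)) x)//.
rewrite (near (L1_funZ 2 (L1_sq v)) x)// (near (L1_funZ 2 (L1_sq w)) x)//.
rewrite (near (L1_funZ 4 (L1_sq (2^-1 *: (v + w)))) x)//.
rewrite (near (L1_sqE vM) x)// (near (L1_sqE wM) x)// (near (L1_sqE vwM) x)//.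
rewrite (near (L1_sqE mM) x)// (near (L1_funB v w) x)// (near (L1_funZ 2^-1 (v + w)) x)//.
rewrite (near (L1_funD v w) x)//.
by move: (L1_fun g x)^-1 => i; field.
Unshelve. all: by end_near. Qed.

(** Where [|w| > e g] one has [|w| <= w^2 / (e g)]; elsewhere [|w| <= e g]. This brings smallness of
    the form back to the norm of L^1. *)
Lemma norm_qform M w e : 0 < e -> L1_dom M w -> `|w| <= e * L1_int g + e^-1 * qform w.
Proof.
move=> e0 wM; rewrite /qform -!L1_intZ -L1_intD; apply: L1_le_norm; near=> x.
rewrite (near (L1_funD (e *: g) (e^-1 *: L1_sq w)) x)//.
rewrite (near (L1_funZ e g) x)// (near (L1_funZ e^-1 (L1_sq w)) x)// (near (L1_sqE wM) x)//.
have a : `|L1_fun w x| <= M * L1_fun g x by near: x.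
have : 0 <= L1_fun g x by near: x.
rewrite le_eqVlt => /predU1P[eg|gx].
  by move: a; rewrite -eg mulr0 normr_le0 => /eqP ->; rewrite normr0 expr0n/= mul0r !mulr0 addr0.
move: (L1_fun w x) (L1_fun g x) gx => p r gx.
have [h|h] := leP `|p| (e * r).
  by rewrite ler_wpDr// mulr_ge0 ?invr_ge0 ?(ltW e0)// divr_ge0 ?sqr_ge0// ltW.
apply: ler_wpDl; first by rewrite mulr_ge0 ?ltW.
rewrite ler_pdivlMl// ler_pdivlMr// -[leRHS]real_normK ?num_real// expr2 mulrAC.
by apply: ler_wpM2r => //; exact: ltW.
Unshelve. all: by end_near. Qed.

End quadratic.

Lemma subr_chain4 (V : zmodType) (a b c a' : V) : a - a' = (a - b) + (b - c) - (a' - c).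
Proof. by rewrite subrKA opprB subrKA. Qed.

(** * Cauchy property of the Cesaro means *)

Section cesaro_cauchy.
Context (R : realType) d (X : measurableType d) (m : probability X R).
Variable Q : L1 m -> L1 m.
Hypothesis MQ : is_markov Q.
Variable g : L1 m.
Hypothesis (g0 : L1_le 0 g) (Qg : Q g = g).
Implicit Types h u v w : L1 m.
Local Notation A := (cesaro_mean Q).

Definition cauchy_means h := forall e : R, 0 < e ->
  exists N, forall n k, (N <= n)%N -> (N <= k)%N -> `|A n h - A k h| < e.

(* Riesz's proof of the mean ergodic theorem, for the Hilbert norm [sqrt (qform g)]:
   minimize it over the convex set [D]. *)
Lemma cauchy_means_dom M u : 0 <= M -> L1_dom g M u -> cauchy_means u.
Proof.
move=> M0 uM.
(* Dominated functions whose means are asymptotic to those of [u]. The set contains all means of [u]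
   and is closed under midpoints, as the parallelogram argument requires. *)
pose D := [set w | L1_dom g M w /\ `|A n (w - u)| @[n --> \oo] --> 0].
have cesaro_dom w n : L1_dom g M w -> (0 < n)%N -> L1_dom g M (A n w).
  by move=> wM n0; apply: markov_dom => //; [exact: cesaro_markov|exact: cesaro_fix].
have uD : D u.
  split=> //; rewrite (_ : (fun n => _) = cst 0); first exact: cvg_cst.
  by apply/funext => n; rewrite subrr (cesaro0 (markovZ MQ)) normr0.
have AD k : (0 < k)%N -> D (A k u).
  move=> k0; split; first exact: cesaro_dom.
  rewrite (_ : (fun n => _) = fun n => `|A n (u - A k u)|).
    exact: (cesaro_cesaro_cvg (markovD MQ) (markovZ MQ) (markov_norm MQ)).
  by apply/funext => n; rewrite -(opprB u) (cesaroN (markovZ MQ)) normrN.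
have mid v w : D v -> D w -> D (2^-1 *: (v + w)).
  move=> [vM vA] [wM wA]; split.
    have := L1_domZ 2^-1 (L1_domD vM wM); rewrite ger0_norm ?invr_ge0//.
    by rewrite (_ : 2^-1 * (M + M) = M)//; field.
  apply/cvg0_natP => e e0.
  have [N1 H1] := (cvg0_natP _).1 vA e e0; have [N2 H2] := (cvg0_natP _).1 wA e e0.
  exists (maxn N1 N2) => n; rewrite geq_max normr_id => /andP[n1 n2].
  have -> : 2^-1 *: (v + w) - u = 2^-1 *: ((v - u) + (w - u)).
    rewrite addrACA -opprD scalerBr; congr (_ - _).
    by rewrite -mulr2n -(scaler_nat 2 u) scalerA mulVf// scale1r.
  rewrite (cesaroZ (markovZ MQ)) (cesaroD (markovD MQ)) normrZ ger0_norm ?invr_ge0//.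
  have := H1 n n1; have := H2 n n2; rewrite !normr_id.
  have := ler_normD (A n (v - u)) (A n (w - u)).
  move: (`|A n (v - u) + A n (w - u)|) (`|A n (v - u)|) (`|A n (w - u)|) => a b c.
  lra.
have q0 w : D w -> 0 <= qform g w by move=> [wM _]; exact: qform_ge0 wM.
pose E := [set qform g w | w in D].
have hE : has_inf E.
  by split; [exists (qform g u); exists u|exists 0 => _ [w Dw <-]; exact: q0].
pose c := inf E.
have cD w : D w -> c <= qform g w by move=> Dw; apply: ge_inf; [exact: hE.2|exists w].
(* The means of [u] are minimizing: for a near-minimizer [w], [A n u] is the sum of [A n w], whose
   form is at most that of [w], and of [A n (u - w)], which tends to [0] in norm and is handled by
   [qform_add]. *)
have limq (e : R) : 0 < e -> exists2 N, (0 < N)%N & forall n, (N <= n)%N -> qform g (A n u) < c + e.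
  move=> e0; have [_ [w [wM wA] <-] wc] := inf_adherent (divr_gt0 e0 (ltr0Sn R 1)) hE.
  (* The factor [4 * M] of [qform_add], enlarged so as to be positive. *)
  have M1 : 0 < 4 * (M + 1) by rewrite mulr_gt0// ltr_wpDl.
  have [N HN] := (cvg0_natP _).1 wA (e / 2 / (4 * (M + 1))) ltac:(by rewrite !divr_gt0).
  exists (maxn 1 N); first by rewrite leq_max.
  move=> n; rewrite geq_max => /andP[n0 /HN]; rewrite normr_id => hn.
  have AwM := cesaro_dom _ _ wM n0.
  have -> : A n u = A n w + A n (u - w).
    by rewrite (cesaroB (markovD MQ) (markovZ MQ)) addrC subrK.
  have duw : L1_dom g (M + M) (A n (u - w)).
    rewrite (cesaroB (markovD MQ) (markovZ MQ)); apply: L1_domB => //; exact: cesaro_dom.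
  apply: le_lt_trans (qform_add g0 M0 AwM duw) _.
  have qA : qform g (A n w) <= qform g w.
    by apply: markov_qform wM => //; [exact: cesaro_markov|exact: cesaro_fix].
  have : 4 * M * `|A n (u - w)| <= e / 2.
    rewrite -(opprB w) (cesaroN (markovZ MQ)) normrN.
    apply: le_trans (_ : 4 * (M + 1) * `|A n (w - u)| <= _).
      by apply: ler_wpM2r => //; lra.
    by rewrite mulrC -ler_pdivlMr// ltW.
  by rewrite /c in wc *; lra.
move=> e e0.
set G := L1_int g + 1.
have G0 : 0 < G by rewrite ltr_wpDl// -(L1_int0 m); exact: le_L1_int.
(* The parallelogram identity bounds the form of the difference by
   [4 * (dl * e / 16) = dl * (e / 4)]; [norm_qform] at [dl] then bounds its norm by
   [e / 2 + e / 4]. *)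
pose dl := e / (2 * G); have dl0 : 0 < dl by rewrite divr_gt0// mulr_gt0.
have [N N0 HN] := limq (dl * e / 16) ltac:(by rewrite divr_gt0// mulr_gt0).
exists N => n k Nn Nk.
have n0 := leq_trans N0 Nn; have k0 := leq_trans N0 Nk.
have nM := cesaro_dom _ _ uM n0; have kM := cesaro_dom _ _ uM k0.
have := qform_parallelogram g0 nM kM.
have := cD _ (mid _ _ (AD n n0) (AD k k0)).
have := HN n Nn; have := HN k Nk => h1 h2 h3 h4.
have h5 : qform g (A n u - A k u) <= dl * (e / 4).
  rewrite mulrA; move: h1 h2 h3 h4.
  move: (qform g (A n u - A k u)) (qform g (A n u)) (qform g (A k u)) (qform g _) (dl * e).
  by move=> a1 a2 a3 a4 a5; lra.
apply: le_lt_trans (norm_qform g0 dl0 (L1_domB nM kM)) _.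
have h6 : dl^-1 * qform g (A n u - A k u) <= e / 4 by rewrite ler_pdivrMl.
have h7 : dl * L1_int g <= e / 2.
  apply: le_trans (_ : dl * G <= _); first by rewrite ler_pM2l// lerDl.
  by rewrite /dl le_eqVlt; apply/orP; left; apply/eqP; field; rewrite gt_eqF.
by move: e0 h6 h7; clear; move: (_ * L1_int _) (_^-1 * _) => a1 a2; lra.
Qed.

(** Some mean [v] of [h] has little mass off the support of [g], so it is close to its truncation at
    a large multiple of [g], to which [cauchy_means_dom] applies; passing from [h] to [v] does not
    affect the asymptotics of the means. *)
Theorem cesaro_cauchy h : L1_le 0 h ->
  (forall e : R, 0 < e -> exists2 n, (0 < n)%N & L1_int (L1_off g (A n h)) < e) ->
  cauchy_means h.
Proof.
move=> h0 H e e0.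
have e10 : 0 < e / 10 by rewrite divr_gt0.
have [k k0 hk] := H _ e10.
have v0 := cesaro_ge0 MQ k h0; set v := A k h in hk v0.
have [M HM] := (cvg0_natP _).1 (L1_off_cvg g0 v0) _ e10.
have {}HM := HM M (leqnn M); rewrite normr_id in HM.
(* This is the minimum of [v] and [M g]. *)
pose u := v - L1_pos (v - M%:R *: g).
have uM : L1_dom g M%:R u.
  have ag := (L1_le0P g).1 g0; have av := (L1_le0P v).1 v0.
  near=> x; rewrite (near (L1_funB v (L1_pos (v - M%:R *: g))) x)//.
  rewrite (near (L1_posE (v - M%:R *: g)) x)// (near (L1_funB v (M%:R *: g)) x)//.
  rewrite (near (L1_funZ M%:R g) x)//.
  have a : 0 <= M%:R * L1_fun g x by rewrite mulr_ge0//; near: x.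
  have b : 0 <= L1_fun v x by near: x.
  by case: (ltP 0 (L1_fun v x - M%:R * L1_fun g x)) => c; rewrite ger0_norm; lra.
have vu : `|v - u| < e / 5.
  rewrite /u opprB addrC subrK.
  rewrite -(subrK (L1_off g v) (L1_pos _)) (le_lt_trans (ler_normD _ _))//.
  rewrite (L1_norm_ge0E (L1_off_ge0 g v0)); move: HM hk.
  move: (`|_|) (L1_int _) => a b; lra.
have e5 : 0 < e / 5 by rewrite divr_gt0.
have [N1 H1] := cauchy_means_dom (ler0n R M) uM e5.
have := cesaro_cesaro_cvg (markovD MQ) (markovZ MQ) (markov_norm MQ) h k0.
move=> /(cvg0_natP _)/(_ (e / 5) ltac:(by rewrite divr_gt0))[N2 H2].
have close n : (N2 <= n)%N -> `|A n h - A n u| < 2 * (e / 5).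
  move=> /H2; rewrite normr_id -/v => hn.
  have -> : A n h - A n u = A n (h - v) + A n (v - u).
    by rewrite !(cesaroB (markovD MQ) (markovZ MQ)) subrKA.
  rewrite (le_lt_trans (ler_normD _ _))//.
  have := cesaro_norm (markov_norm MQ) n (v - u).
  move: hn vu; move: (`|A n (h - v)|) (`|A n (v - u)|) (`|v - u|) => a b c; lra.
exists (maxn N1 N2) => n j; rewrite !geq_max => /andP[n1 n2] /andP[j1 j2].
have -> : A n h - A j h = (A n h - A n u) + (A n u - A j u) - (A j h - A j u).
  exact: subr_chain4.
rewrite (le_lt_trans (ler_normB _ _))// (le_lt_trans (lerD (ler_normD _ _) (lexx _)))//.
have := H1 n j n1 j1; have := close n n2; have := close j j2.
move: (`|A n h - A n u|) (`|A n u - A j u|) (`|A j h - A j u|) => a b c; lra.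
Unshelve. all: by end_near. Qed.

End cesaro_cauchy.

(** * The annealed Perron-Frobenius operator *)

Section L1_measure.
Context d (X : measurableType d) (R : realType) (m : probability X R).
Implicit Types g h : L1 m.
Local Open Scope ereal_scope.

(** Truncation at zero makes this a measure for every class; for [h >= 0] it is the measure with
    density [h] ([L1_measureE]). *)
Definition L1_measure h (A : set X) : \bar R :=
  \int[m]_(x in A) (Num.max 0%R (L1_fun h x))%:E.

Let mpos h : measurable_fun setT (fun x => (Num.max 0%R (L1_fun h x))%:E).
Proof. by apply/measurable_EFinP; apply: measurable_maxr => //; exact: measurable_L1. Qed.

Let pos_ge0 h x : 0 <= (Num.max 0%R (L1_fun h x))%:E.
Proof. by rewrite lee_fin le_max lexx. Qed.

Let L1_measure0 h : L1_measure h set0 = 0.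
Proof. exact: integral_set0. Qed.

Let L1_measure_ge0 h A : 0 <= L1_measure h A.
Proof. by apply: integral_ge0 => x _; exact: pos_ge0. Qed.

Let L1_measure_additive h : semi_sigma_additive (L1_measure h).
Proof. by apply: semi_sigma_additive_nng_induced; [exact: mpos|exact: pos_ge0]. Qed.

HB.instance Definition _ h := isMeasure.Build _ _ _ (L1_measure h)
  (L1_measure0 h) (L1_measure_ge0 h) (@L1_measure_additive h).

Lemma integrable_maxL1 h : m.-integrable setT (EFin \o (fun x => Num.max 0%R (L1_fun h x))).
Proof.
apply: (le_integrable measurableT (mpos h) _ (L1_integrable h)) => x _.
by rewrite /= lee_fin; case: (ltP 0%R (L1_fun h x)); rewrite ?normr0.
Qed.

Let L1_measure_fin h : fin_num_fun (L1_measure h).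
Proof.
move=> A mA; apply: integrable_fin_num => //.
exact: integrableS (integrable_maxL1 h).
Qed.

HB.instance Definition _ h := @Measure_isFinite.Build _ _ _ (L1_measure h) (@L1_measure_fin h).

Lemma L1_measureE h A : L1_le 0%R h -> measurable A ->
  L1_measure h A = \int[m]_(x in A) (L1_fun h x)%:E.
Proof.
move=> /L1_le0P h0 mA; apply: ae_eq_integral => //.
- exact: measurable_funTS.
- by apply: measurable_funTS; apply/measurable_EFinP; exact: measurable_L1.
- by apply: filterS h0 => x hx _; rewrite max_r.
Qed.

Lemma L1_measure_dominated h : L1_measure h `<< m.
Proof.
apply/null_content_dominatesP => A mA A0.
by apply: null_set_integral => //; exact: measurable_funTS.
Qed.

Lemma integrable_bounded (u : X -> R) (M : R) (mu : {finite_measure set X -> \bar R}) :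
  measurable_fun setT u -> (forall x, `|u x| <= M)%R -> mu.-integrable setT (EFin \o u).
Proof.
move=> mu' uM; apply: (le_integrable measurableT _ _ (finite_measure_integrable_cst mu M measurableT)).
  exact/measurable_EFinP.
by move=> x _; rewrite /= lee_fin (le_trans (uM x))// ler_norm.
Qed.

Lemma L1_ext g h : (forall A, measurable A ->
  \int[m]_(x in A) (L1_fun g x)%:E = \int[m]_(x in A) (L1_fun h x)%:E) -> g = h.
Proof.
move=> gh; apply: L1_eq.
have : ae_eq m setT (EFin \o L1_fun g) (EFin \o L1_fun h).
  apply: integral_ae_eq => //; first exact: L1_integrable.
    exact: measurable_int (L1_integrable h).
  by move=> A _ mA; exact: gh.
by apply: filterS => x /(_ I)[].
Qed.

(** Tested on the set where [h <= 0], the hypothesis says that the negative part has nonpositive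
    integral, hence zero norm. *)
Lemma L1_ge0_integral h :
  (forall A, measurable A -> 0 <= \int[m]_(x in A) (L1_fun h x)%:E) -> L1_le 0%R h.
Proof.
move=> H; suff posN : (L1_pos (- h) = 0)%R.
  by rewrite -(L1_posB h) posN subr0; exact: L1_pos_ge0.
apply/normr0_eq0/eqP; rewrite eq_le normr_ge0 andbT.
rewrite (L1_norm_ge0E (L1_pos_ge0 _)) -lee_fin /L1_int /Rintegral fineK; last first.
  by apply: integrable_fin_num => //; exact: L1_integrable.
pose A := [set x | L1_fun h x <= 0]%R.
have mA : measurable A.
  by rewrite -[A]setTI; apply: measurable_fun_ler => //; exact: measurable_L1.
rewrite (_ : \int[m]_x _ = - \int[m]_(x in A) (L1_fun h x)%:E); last first.
  rewrite -integralN; last first.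
    by apply: integrable_add_def => //; exact: integrableS (L1_integrable _).
  rewrite [RHS]integral_mkcond; apply: ae_eq_integral => //.
  - exact: measurable_int (L1_integrable _).
  - apply/(measurable_restrictT _ mA); apply: measurable_funTS.
    by apply: measurableT_comp => //; exact: measurable_int (L1_integrable h).
  - apply: filterS2 (L1_posE (- h)%R) (L1_funN h) => x -> -> _; rewrite patchE.
    case: ifPn => [/set_mem Ax|/negP nAx]; first by rewrite max_r// oppr_ge0.
    by rewrite max_l// oppr_le0 ltW// ltNge; apply/negP => a; apply: nAx; exact: mem_set.
by rewrite leeNl oppe0; exact: H.
Qed.

Lemma RN_ae (nu : {finite_measure set X -> \bar R}) (u : X -> R) :
  nu `<< m -> m.-integrable setT (EFin \o u) ->
  (forall A, measurable A -> nu A = \int[m]_(x in A) (u x)%:E) ->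
  {ae m, forall x, Radon_Nikodym (charge_of_finite_measure nu) m x = (u x)%:E}.
Proof.
move=> num iu H.
have num' : charge_of_finite_measure nu `<< m by [].
have : ae_eq m setT (Radon_Nikodym (charge_of_finite_measure nu) m) (EFin \o u).
  apply: integral_ae_eq => //; first exact: Radon_Nikodym_integrable.
    exact: measurable_int iu.
  by move=> A _ mA; rewrite -Radon_Nikodym_integral// -H.
by apply: filterS => x /(_ I).
Qed.

Lemma integral_L1_measure h (u : X -> R) (M : R) :
  measurable_fun setT u -> (forall x, `|u x| <= M)%R ->
  \int[L1_measure h]_x (u x)%:E = \int[m]_x ((u x)%:E * (Num.max 0%R (L1_fun h x))%:E).
Proof.
move=> mu uM; have iu := integrable_bounded (L1_measure h) mu uM.
rewrite -(Radon_Nikodym_change_of_variables (L1_measure_dominated h) measurableT iu).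
apply: ae_eq_integral => //.
- apply: emeasurable_funM; first exact/measurable_EFinP.
  apply: (measurable_int m); apply: Radon_Nikodym_integrable; exact: L1_measure_dominated.
- by apply: emeasurable_funM; first exact/measurable_EFinP.
- have := RN_ae (L1_measure_dominated h) (integrable_maxL1 h) ltac:(by []).
  by apply: filterS => x e _ /=; rewrite e.
Qed.

End L1_measure.

(** The product measure is by definition the integral over the first factor of the measures of
    sections; the opposite order of integration comes from its uniqueness. *)
Lemma product_measure_ysection d1 d2 (Y : measurableType d1) (Z : measurableType d2) (R : realType)
    (m1 : {sigma_finite_measure set Y -> \bar R}) (m2 : {sigma_finite_measure set Z -> \bar R})
    (E : set (Y * Z)) : measurable E ->
  ((m1 \x m2) E = \int[m2]_z m1 [set y | E (y, z)])%E.
Proof.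
move=> mE; rewrite (product_measure_unique (m' := product_measure2 m1 m2) _ mE); last first.
  by move=> A B mA mB; exact: product_measure2E.
apply: eq_integral => z _ /=; congr (m1 _).
by apply/seteqP; split => y /=; rewrite ysectionE.
Qed.

Lemma product_measure_xsection d1 d2 (Y : measurableType d1) (Z : measurableType d2) (R : realType)
    (m1 : {measure set Y -> \bar R}) (m2 : {measure set Z -> \bar R}) (E : set (Y * Z)) :
  ((m1 \x m2) E = \int[m1]_y m2 [set z | E (y, z)])%E.
Proof.
apply: eq_integral => y _ /=; congr (m2 _).
by apply/seteqP; split => z /=; rewrite xsectionE.
Qed.

Section annealed.
Context dT (T : measurableType dT) dX (X : measurableType dX) (R : realType).
Variables (p : probability T R) (m : probability X R).
Variable f : {mfun (T * X)%type >-> X}.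
Hypothesis ns : nonsingular_transition p m f.
Local Open Scope ereal_scope.
Implicit Types h : L1 m.
Local Notation L := (annealed_PF p m f).
Local Notation transition := (transition p f).

Lemma measurable_transition A : measurable A -> measurable_fun setT (transition^~ A).
Proof.
move=> mA; rewrite (_ : transition^~ A = p \o ysection (f @^-1` A)).
  apply: measurable_fun_ysection; rewrite -[X in measurable X]setTI.
  exact: measurable_funPT.
apply/funext => x; rewrite /transition/=; congr (p _).
by apply/seteqP; split => t /=; rewrite ysectionE.
Qed.

Lemma transition_fin x A : measurable A -> transition x A \is a fin_num.
Proof.
move=> mA; apply: fin_num_measure.
rewrite -[X in measurable X]setTI; exact: (measurableT_comp (f := f)).
Qed.

Lemma integrable_transport h A : measurable A ->
  m.-integrable setT (fun x => (L1_fun h x)%:E * transition x A).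
Proof.
move=> mA; have mtr := measurable_transition mA.
apply: (le_integrable measurableT _ _ (L1_integrable h)).
  by apply: emeasurable_funM => //; exact: measurable_int (L1_integrable h).
move=> x _; rewrite abseM -[leRHS]mule1; apply: lee_pmul => //.
rewrite gee0_abs ?measure_ge0//; apply: probability_le1.
rewrite -[X in measurable X]setTI; exact: (measurableT_comp (f := f)).
Qed.

(** [L] is accessible through integrals over measurable sets, so each identity is tested there and
    becomes a property of [transport]; the total mass is kept because [transition x setT = 1]. *)
Lemma annealed_markov : is_markov L.
Proof.
have LD g h : (L (g + h) = L g + L h)%R.
  apply: L1_ext => A mA; rewrite annealed_PF_integral//.
  have -> : \int[m]_(x in A) (L1_fun (L g + L h)%R x)%:E =
      \int[m]_(x in A) ((L1_fun (L g) x)%:E + (L1_fun (L h) x)%:E).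
    apply: ae_eq_integral => //.
    - by apply: measurable_funTS; apply/measurable_EFinP; exact: measurable_L1.
    - by apply: measurable_funTS; apply: emeasurable_funD; apply/measurable_EFinP; exact: measurable_L1.
    - by apply: filterS (L1_funD (L g) (L h)) => x -> _.
  rewrite integralD//; [|exact: integrableS (L1_integrable _)..].
  rewrite !annealed_PF_integral// /transport -integralD//; [|exact: integrable_transport..].
  apply: ae_eq_integral => //.
  - exact: measurable_int (integrable_transport _ mA).
  - by apply: emeasurable_funD; exact: measurable_int (integrable_transport _ mA).
  - apply: filterS (L1_funD g h) => x -> _.
    by rewrite EFinD -(fineK (transition_fin x mA)) -!EFinM -EFinD -mulrDl.
have LZ (a : R) h : (L (a *: h) = a *: L h)%R.
  apply: L1_ext => A mA; rewrite annealed_PF_integral//.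
  have -> : \int[m]_(x in A) (L1_fun (a *: L h)%R x)%:E =
      \int[m]_(x in A) (a%:E * (L1_fun (L h) x)%:E).
    apply: ae_eq_integral => //.
    - by apply: measurable_funTS; apply/measurable_EFinP; exact: measurable_L1.
    - by apply: measurable_funTS; apply: emeasurable_funM => //; apply/measurable_EFinP; exact: measurable_L1.
    - by apply: filterS (L1_funZ a (L h)) => x -> _.
  rewrite integralZl//; last exact: integrableS (L1_integrable _).
  rewrite annealed_PF_integral// /transport -integralZl//; last exact: integrable_transport.
  apply: ae_eq_integral => //.
  - exact: measurable_int (integrable_transport _ mA).
  - by apply: emeasurable_funM => //; exact: measurable_int (integrable_transport _ mA).
  - by apply: filterS (L1_funZ a h) => x -> _; rewrite EFinM muleA.
have Lint h : L1_int (L h) = L1_int h.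
  congr fine; rewrite (annealed_PF_integral h ns measurableT); apply: eq_integral => x _.
  by rewrite /transition probability_setT mule1.
split=> // h h0; apply: L1_ge0_integral => A mA.
rewrite annealed_PF_integral//; move/L1_le0P in h0.
rewrite /transport (ae_eq_integral (fun x => (Num.max 0%R (L1_fun h x))%:E * transition x A))//.
- by apply: integral_ge0 => x _; rewrite mule_ge0// lee_fin le_max lexx.
- exact: measurable_int (integrable_transport _ mA).
- apply: emeasurable_funM; last exact: measurable_transition.
  by apply/measurable_EFinP; apply: measurable_maxr => //; exact: measurable_L1.
- by apply: filterS h0 => x hx _; rewrite max_r.
Qed.

Definition image_measure d1 d2 (Y : measurableType d1) (Z : measurableType d2)
  (mu : {measure set Y -> \bar R}) (phi : Y -> Z) (mphi : measurable_fun setT phi) :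
  {measure set Z -> \bar R}.
Proof. by refine (pushforward mu phi : {measure set Z -> \bar R}); exact: mphi. Defined.

Lemma ge0_integral_image d1 d2 (Y : measurableType d1) (Z : measurableType d2)
  (mu : {measure set Y -> \bar R}) (phi : Y -> Z) (mphi : measurable_fun setT phi) (u : Z -> \bar R) :
  measurable_fun setT u -> (forall z, 0 <= u z) ->
  \int[image_measure mu mphi]_z u z = \int[mu]_y u (phi y).
Proof.
move=> mu' u0.
have := @ge0_integral_pushforward _ _ _ _ _ _ mphi mu setT u measurableT mu' (fun z _ => u0 z).
rewrite preimage_setT => <-; apply: eq_measure_integral => A mA _.
by [].
Qed.

(** The operator dual to [annealed_PF], see [L1_pair_koopman]. Extended nonnegative functions [u]
    let Tonelli's theorem apply without integrability conditions. *)
Definition koopman (u : X -> \bar R) (x : X) : \bar R := \int[p]_t u (f (t, x)).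

Lemma measurable_koopman u : measurable_fun setT u -> (forall x, 0 <= u x) ->
  measurable_fun setT (koopman u).
Proof.
move=> mu u0; apply: (@measurable_fun_fubini_tonelli_G _ _ _ _ _ p (u \o f)) => [|z]; [exact: measurableT_comp|exact: u0].
Qed.

Lemma koopman_ge0 u : (forall x, 0 <= u x) -> forall x, 0 <= koopman u x.
Proof. by move=> u0 x; exact: integral_ge0. Qed.

(** The hypothesis says that [nu'] is the image of [p \x nu] under [f]; both sides are the integral
    of [u \o f] against that product. *)
Lemma integral_koopman (nu : {sigma_finite_measure set X -> \bar R})
  (nu' : {measure set X -> \bar R}) (u : X -> \bar R) :
  (forall A, measurable A -> nu' A = \int[nu]_x transition x A) ->
  measurable_fun setT u -> (forall x, 0 <= u x) ->
  \int[nu]_x koopman u x = \int[nu']_x u x.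
Proof.
move=> H mu u0.
have -> : \int[nu]_x koopman u x = \int[p \x nu]_z (u \o f) z.
  by rewrite (@fubini_tonelli2 _ _ _ _ _ p nu (u \o f))// => [|z]; [exact: measurableT_comp|exact: u0].
have mf : measurable_fun setT f by [].
rewrite -[LHS](ge0_integral_image (p \x nu) mf)//; apply: eq_measure_integral => A mA _.
rewrite /= /pushforward H//.
have mfA : measurable (f @^-1` A) by rewrite -[X in measurable X]setTI; exact: mf.
by rewrite product_measure_ysection.
Qed.

Lemma L1_measure_PF h A : L1_le 0%R h -> measurable A ->
  L1_measure (L h) A = \int[L1_measure h]_x transition x A.
Proof.
move=> h0 mA; rewrite L1_measureE//; last exact: (markov_ge0 annealed_markov).
have mtr := measurable_transition mA.
rewrite annealed_PF_integral//.
rewrite (eq_integral (fun x => (fine (transition x A))%:E)); last first.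
  by move=> x _; rewrite fineK// transition_fin.
rewrite (@integral_L1_measure _ _ _ _ _ _ 1%R)//; last 2 first.
- exact: measurableT_comp.
- move=> x; rewrite ger0_norm ?fine_ge0 ?measure_ge0// -lee_fin fineK ?transition_fin//.
  apply: probability_le1; rewrite -[X in measurable X]setTI.
  exact: (measurableT_comp (f := f)).
apply: ae_eq_integral => //.
- exact: measurable_int (integrable_transport _ mA).
- apply: emeasurable_funM; first by apply/measurable_EFinP; exact: measurableT_comp.
  by apply/measurable_EFinP; apply: measurable_maxr => //; exact: measurable_L1.
- apply: filterS ((L1_le0P h).1 h0) => x hx _.
  by rewrite fineK ?transition_fin// max_r// muleC.
Qed.

Lemma stationary_transition (mu : probability X R) A : stationary p f mu -> measurable A ->
  mu A = \int[mu]_x transition x A.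
Proof.
move=> st mA; have mfA : measurable (f @^-1` A).
  by rewrite -[X in measurable X]setTI; exact: measurable_funPT.
by rewrite -(product_measure_ysection p mu mfA) product_measure_xsection st.
Qed.

End annealed.

(** * The skew product and its ergodicity *)

Section sequence_space.
Context dT (T : measurableType dT).
Local Notation Om := (seq_space T).

Lemma measurable_coord i : measurable_fun [set: Om] (fun w : Om => w i).
Proof.
move=> _ A mA; rewrite setTI; apply: sub_sigma_algebra.
by exists i => //; exists A => //; rewrite setTI.
Qed.

Lemma measurable_into_seq dY (Y : measurableType dY) (u : Y -> Om) :
  (forall i, measurable_fun setT (fun y => u y i)) -> measurable_fun setT u.
Proof.
move=> H; refine (@measurability _ _ Y (seq_space T) setT u (coordinate_sets (T := T)) erefl _).
move=> _ [_ [i _ [A mA <-]] <-]; rewrite setTI.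
by have := H i measurableT A mA; rewrite !setTI.
Qed.

Definition seq_shift (w : Om) : Om := fun n => w n.+1.

Lemma measurable_seq_shift : measurable_fun setT seq_shift.
Proof. by apply: measurable_into_seq => i; exact: measurable_coord. Qed.

Definition cylinder n (A : nat -> set T) : set Om :=
  [set w | forall i, (i < n)%N -> A i (w i)].

Lemma measurable_cylinder n A : (forall i, measurable (A i)) -> measurable (cylinder n A).
Proof.
move=> mA; rewrite (_ : cylinder n A = \bigcap_(i in [set i | (i < n)%N]) ((fun w : Om => w i) @^-1` A i)).
  apply: bigcap_measurableType => i _; rewrite -[X in measurable X]setTI.
  exact: measurable_coord.
by apply/seteqP; split => w /= H i /H.
Qed.

(** The rectangles over cylinders form a pi-system generating the product sigma-algebra, so
    agreement of the two measures extends from it, [m1] being finite. *)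
Lemma cylinder_prod_unique dY (Y : measurableType dY) (R : realType)
    (m1 m2 : {measure set (Om * Y) -> \bar R}) :
  (m1 setT < +oo)%E ->
  (forall n A B, (forall i, measurable (A i)) -> measurable B ->
    m1 (cylinder n A `*` B) = m2 (cylinder n A `*` B)) ->
  forall E, measurable E -> m1 E = m2 E.
Proof.
move=> m1oo H.
pose G : set (set (Om * Y)) := [set E | exists n A B,
  [/\ forall i, measurable (A i), measurable B & E = cylinder n A `*` B]].
have GT : G setT.
  exists 0%N, (fun=> setT), setT; split=> //.
  by apply/seteqP; split.
have GS : G `<=` measurable.
  by move=> _ [n [A [B [mA mB ->]]]]; apply: measurableX => //; exact: measurable_cylinder.
apply: (@measure_unique _ _ _ G (fun=> setT)).
- apply/seteqP; split; last by apply: smallest_sub => //; exact: sigma_algebra_measurable.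
  apply: smallest_sub; first exact: smallest_sigma_algebra.
  rewrite subUset; split.
    pose S := g_sigma_algebraType G.
    have : measurable_fun [set: S] (fst : S -> Om).
      apply: measurable_into_seq => i _ A mA; rewrite setTI; apply: sub_sigma_algebra.
      (* A condition on one coordinate is a cylinder of length [i.+1] that leaves all earlier
         coordinates free. *)
      exists i.+1, (fun k => if k == i then A else setT), setT; split=> //.
        by move=> k; case: eqP.
      apply/seteqP; split => -[w y] /=.
        by move=> Aw; split=> // k _; case: eqP => [->|].
      by move=> [/(_ i (ltnSn i))]; rewrite eqxx.
    by move=> mfst _ [A mA <-]; exact: mfst.
  move=> _ [B mB <-]; apply: sub_sigma_algebra; exists 0%N, (fun=> setT), B; split=> //.
  by apply/seteqP; split => -[w y] /= [].
- move=> _ _ [n [A [B [mA mB ->]]]] [k [C [D [mC mD ->]]]].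
  (* The shorter cylinder is padded with full sets up to the common length. *)
  exists (maxn n k), (fun i => (if (i < n)%N then A i else setT) `&` (if (i < k)%N then C i else setT)), (B `&` D).
  split.
  + by move=> i; apply: measurableI; case: ifP.
  + exact: measurableI.
  + apply/seteqP; split => -[w y] /=.
      move=> [[Aw By] [Cw Dy]]; split=> // i _.
      by split; case: ifP => // ?; [exact: Aw|exact: Cw].
    move=> [ACw [By Dy]]; split; split=> // i ik.
      by have [] := ACw i (leq_trans ik (leq_maxl _ _)); rewrite ik.
    by have [] := ACw i (leq_trans ik (leq_maxr _ _)); rewrite ik.
- by move=> _; exact: GT.
- by rewrite bigcup_const.
- by move=> _ [n [A [B [mA mB ->]]]]; exact: H.
- by move=> _.
Qed.

Context (R : realType) (p : probability T R) (P : probability Om R).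
Hypothesis prodP : is_product_measure p P.

Let mshift0 : measurable_fun setT (fun w : Om => (seq_shift w, w 0%N)).
Proof. by apply: measurable_fun_pair; [exact: measurable_seq_shift|exact: measurable_coord]. Qed.

(** Under [P] the first coordinate has law [p] and is independent of the shifted sequence, which
    again has law [P]; on cylinders this is the product formula with one more factor. *)
Lemma shift_independent (u : Om * T -> \bar R) : measurable_fun setT u -> (forall z, 0 <= u z)%E ->
  (\int[P]_w u (seq_shift w, w 0%N) = \int[p]_t \int[P]_w u (w, t))%E.
Proof.
move=> mu u0; rewrite -(ge0_integral_image P mshift0)//.
rewrite -[RHS](@fubini_tonelli2 _ _ _ _ _ P p u)//.
apply: eq_measure_integral => E mE _; apply: (@cylinder_prod_unique _ _ _ _ (P \x p)%E) mE.
  rewrite /=/pushforward preimage_setT.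
  by rewrite (le_lt_trans (probability_le1 _ _))// ltry.
move=> n A B mA mB; rewrite /= /pushforward product_measure1E//; last exact: measurable_cylinder.
have := prodP n.+1 (A := fun i => if i is k.+1 then A k else B).
rewrite big_ord_recl /= => HP.
rewrite prodP// muleC -HP; last by case.
congr (P _); apply/seteqP; split => w /=.
  by move=> [H Bw] [|i] // ?; exact: H.
by move=> H; split; [move=> i ?; exact: (H i.+1)|exact: (H 0%N)].
Qed.

End sequence_space.

Section skew_product.
Context dT (T : measurableType dT) dX (X : measurableType dX) (R : realType).
Variables (p : probability T R) (P : probability (seq_space T) R).
Hypothesis prodP : is_product_measure p P.
Variable f : {mfun (T * X)%type >-> X}.
Local Notation Om := (seq_space T).
Local Notation F := (@skew_product _ T _ X f).
Local Notation transition := (transition p f).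
Local Open Scope ereal_scope.

Lemma measurable_skew : measurable_fun setT F.
Proof.
apply: measurable_fun_pair.
  exact: (measurableT_comp (measurable_seq_shift (T := T)) measurable_fst).
apply: (measurableT_comp (f := f)) => //; apply: measurable_fun_pair; last exact: measurable_snd.
exact: (measurableT_comp (measurable_coord 0) measurable_fst).
Qed.

Lemma iter_skew n w x : iter n F (w, x) = ((fun k => w (n + k)%N), random_orbit f w n x).
Proof.
elim: n => [|n IH]; first by [].
rewrite iterS IH /skew_product/= addn0; congr pair.
by apply/funext => k; rewrite addnS.
Qed.

Lemma measurable_iter_skew n : measurable_fun setT (iter n F).
Proof.
elim: n => [|n IH]; first exact: measurable_id.
exact: (measurableT_comp measurable_skew IH).
Qed.

Lemma measurable_orbit n : measurable_fun setT (fun z : Om * X => random_orbit f z.1 n z.2).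
Proof.
rewrite (_ : (fun z => _) = snd \o iter n F).
  exact: (measurableT_comp measurable_snd (measurable_iter_skew n)).
by apply/funext => -[w x]; rewrite /= iter_skew.
Qed.

(** The step consumes the first coordinate of [omega], which is independent of the sequence that
    remains. After integration over [omega], the skew product thus acts as the Koopman operator. *)
Lemma fiber_skew (u : Om * X -> \bar R) x : measurable_fun setT u -> (forall z, 0 <= u z) ->
  \int[P]_w u (F (w, x)) = koopman p f (fun y => \int[P]_w u (w, y)) x.
Proof.
move=> mu u0; rewrite /koopman.
rewrite -(shift_independent prodP (u := fun z => u (z.1, f (z.2, x))))//.
apply: measurableT_comp => //; apply: measurable_fun_pair; first exact: measurable_fst.
by apply: (measurableT_comp (f := f)) => //; apply: measurable_fun_pair.
Qed.

Lemma fiber_indic (E : set (Om * X)) x : measurable E ->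
  \int[P]_w (\1_E (w, x))%:E = P [set w | E (w, x)].
Proof.
move=> mE; rewrite (_ : (fun w => _) = fun w => (\1_[set w | E (w, x)] w)%:E); last first.
  by apply/funext => w; rewrite !indicE; congr (_%:E); congr (_%:R); congr nat_of_bool;
    apply/idP/idP; rewrite !inE.
rewrite integral_indic// ?setIT//; rewrite (_ : mkset _ = ysection E x).
  exact: measurable_ysection.
by apply/seteqP; split => y /=; rewrite ysectionE.
Qed.

Lemma measurable_fiber (E : set (Om * X)) x : measurable E -> measurable [set w | E (w, x)].
Proof.
move=> mE; rewrite (_ : mkset _ = ysection E x); first exact: measurable_ysection.
by apply/seteqP; split => y /=; rewrite ysectionE.
Qed.

Lemma measurable_fiberx (E : set (Om * X)) w : measurable E -> measurable [set x | E (w, x)].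
Proof.
move=> mE; rewrite (_ : mkset _ = xsection E w); first exact: measurable_xsection.
by apply/seteqP; split => y /=; rewrite xsectionE.
Qed.

Lemma measurable_fiber_measure (E : set (Om * X)) : measurable E ->
  measurable_fun setT (fun x => P [set w | E (w, x)]).
Proof.
move=> mE; rewrite (_ : (fun x => _) = P \o ysection E).
  exact: measurable_fun_ysection.
by apply/funext => x /=; congr (P _); apply/seteqP; split => y /=; rewrite ysectionE.
Qed.

Lemma measurable_fiberx_measure (nu : {sigma_finite_measure set X -> \bar R}) (E : set (Om * X)) :
  measurable E -> measurable_fun setT (fun w => nu [set x | E (w, x)]).
Proof.
move=> mE; rewrite (_ : (fun w => _) = nu \o xsection E).
  exact: measurable_fun_xsection.
by apply/funext => w /=; congr (nu _); apply/seteqP; split => y /=; rewrite xsectionE.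
Qed.

Lemma preimage_skew_measurable (E : set (Om * X)) : measurable E -> measurable (F @^-1` E).
Proof. by move=> mE; rewrite -[X in measurable X]setTI; exact: measurable_skew. Qed.

Lemma fiber_skew_set (E : set (Om * X)) x : measurable E ->
  P [set w | E (F (w, x))] = koopman p f (fun y => P [set w | E (w, y)]) x.
Proof.
move=> mE; rewrite -(fiber_indic x (preimage_skew_measurable mE)).
have -> : (fun y => P [set w | E (w, y)]) = fun y => \int[P]_w (\1_E (w, y))%:E.
  by apply/funext => y; rewrite fiber_indic.
apply: (fiber_skew (u := EFin \o \1_E)) => [|z]; last by rewrite lee_fin.
by apply/measurable_EFinP; exact: measurable_indic.
Qed.

(** Integrating the fibers over [nu] reduces this to [integral_koopman]. It serves both for
    stationary measures, with [nu = nu'], and for a density and its image under [L]. *)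
Lemma skew_measure (nu nu' : {sigma_finite_measure set X -> \bar R}) (E : set (Om * X)) :
  (forall A, measurable A -> nu' A = \int[nu]_x transition x A) ->
  measurable E -> (P \x nu) (F @^-1` E) = (P \x nu') E.
Proof.
move=> H mE; rewrite !product_measure_ysection//; last exact: preimage_skew_measurable.
rewrite -(integral_koopman H)//; last exact: measurable_fiber_measure.
by apply: eq_integral => x _; rewrite -fiber_skew_set.
Qed.

Section ergodicity.
Variable mu : probability X R.
Hypothesis st : stationary p f mu.

Lemma stationary_skew : invariant_measure (P \x mu) F.
Proof.
by move=> E mE; apply: skew_measure => // A mA; exact: stationary_transition.
Qed.

Lemma stationary_koopman (u : X -> \bar R) : measurable_fun setT u -> (forall x, 0 <= u x) ->
  \int[mu]_x koopman p f u x = \int[mu]_x u x.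
Proof.
by move=> mu' u0; apply: integral_koopman => // A mA; exact: stationary_transition.
Qed.

(* By stationarity the integral of [(u (f (t, x)) - u x)^2] vanishes. *)
Lemma koopman_fix_invariant (u : X -> R) : measurable_fun setT u ->
  (forall x, 0 <= u x <= 1)%R -> (forall x, koopman p f (EFin \o u) x = (u x)%:E) ->
  {ae (p \x mu), forall z, u (f z) = u z.2}.
Proof.
move=> mu' u01 Ku.
have u0 x : (0 <= u x)%R by case/andP: (u01 x).
pose a (z : T * X) := u (f z); pose b (z : T * X) := u z.2.
have ma : measurable_fun setT a by exact: measurableT_comp.
have mb : measurable_fun setT b by exact: measurableT_comp.
have mu2 : measurable_fun setT (fun x => ((u x) ^+ 2)%:E).
  by apply/measurable_EFinP; exact: measurable_funX.
have intp (v : T * X -> R) : measurable_fun setT v -> (forall z, 0 <= v z)%R ->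
    \int[p \x mu]_z (v z)%:E = \int[mu]_x \int[p]_t (v (t, x))%:E.
  move=> mv v0; rewrite (@fubini_tonelli2 _ _ _ _ _ p mu (EFin \o v))//.
  exact/measurable_EFinP.
have Ia : \int[p \x mu]_z (a z ^+ 2)%:E = \int[mu]_x (u x ^+ 2)%:E.
  rewrite intp; [|exact: measurable_funX|by move=> z; exact: sqr_ge0].
  by rewrite -(stationary_koopman mu2)// => x; rewrite lee_fin sqr_ge0.
have Ib : \int[p \x mu]_z (b z ^+ 2)%:E = \int[mu]_x (u x ^+ 2)%:E.
  rewrite intp; [|exact: measurable_funX|by move=> z; exact: sqr_ge0].
  by apply: eq_integral => x _; rewrite -[RHS]mule1 -(probability_setT p) -integral_cst.
(* Integrating in [t] first replaces [u (f (t, x))] by the Koopman average, which is [u x]. *)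
have Iab : \int[p \x mu]_z (a z * b z)%:E = \int[mu]_x (u x ^+ 2)%:E.
  rewrite intp; [|exact: (measurable_funM ma mb)|by move=> z; apply: mulr_ge0; exact: u0].
  apply: eq_integral => x _.
  transitivity (\int[p]_t ((u (f (t, x)))%:E * (u x)%:E)).
    by apply: eq_integral => t _; rewrite -EFinM.
  rewrite ge0_integralZr ?lee_fin//; last first.
  - by move=> t _; rewrite lee_fin.
  - apply/measurable_EFinP; apply: measurableT_comp => //; exact: (measurableT_comp (f := f)).
  by rewrite -/(koopman p f (EFin \o u) x) Ku -EFinM expr2.
have fin : \int[mu]_x (u x ^+ 2)%:E < +oo.
  apply: le_lt_trans (_ : \int[mu]_x (cst 1 x) < _).
    apply: ge0_le_integral => //.
    - by move=> x _; rewrite lee_fin sqr_ge0.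
    - by move=> x _; rewrite lee_fin; have /andP[? ?] := u01 x; exact: exprn_ile1.
  by rewrite integral_cst//= probability_setT mule1 ltry.
have I0 : \int[p \x mu]_z ((a z - b z) ^+ 2)%:E = 0.
  (* The cross terms are kept on the left, so that only nonnegative functions are integrated. *)
  have : \int[p \x mu]_z ((a z - b z) ^+ 2)%:E + (\int[p \x mu]_z (a z * b z)%:E
      + \int[p \x mu]_z (a z * b z)%:E) = \int[p \x mu]_z (a z ^+ 2)%:E + \int[p \x mu]_z (b z ^+ 2)%:E.
    rewrite -!ge0_integralD//; first by apply: eq_integral => z _; rewrite -!EFinD; congr EFin; ring.
    all: try by move=> z _; rewrite lee_fin ?sqr_ge0// mulr_ge0 ?u0.
    all: try by apply/measurable_EFinP; apply: measurable_funX => //; apply: measurable_funB.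
    all: try by apply/measurable_EFinP; apply: measurable_funM.
    by move=> z _; rewrite -EFinD lee_fin addr_ge0 ?mulr_ge0 ?u0.
    by apply/measurable_EFinP; apply: measurable_funD => //; apply: measurable_funM.
  rewrite Ia Ib Iab => /eqP; rewrite -[X in _ == X]add0e.
  have fin2 : \int[mu]_x (u x ^+ 2)%:E \is a fin_num.
    by rewrite ge0_fin_numE//; apply: integral_ge0 => x _; rewrite lee_fin sqr_ge0.
  rewrite addeC [X in _ == X]addeC; move: fin2; case: (\int[mu]_x _) => // r _.
  have : 0 <= \int[p \x mu]_z ((a z - b z) ^+ 2)%:E.
    by apply: integral_ge0 => z _; rewrite lee_fin sqr_ge0.
  case: (\int[_]_z _) => // s _ /eqP[] H; congr EFin; lra.
have : ae_eq (p \x mu) setT (fun z => ((a z - b z) ^+ 2)%:E) (cst 0).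
  apply/ae_eq_integral_abs => //.
    by apply/measurable_EFinP; apply: measurable_funX => //; apply: measurable_funB.
  by rewrite -[RHS]I0; apply: eq_integral => z _; rewrite gee0_abs// lee_fin sqr_ge0.
apply: filterS => z /(_ I)[] /eqP; rewrite sqrf_eq0 subr_eq0 => /eqP; exact.
Qed.

End ergodicity.
End skew_product.

(** * From triviality of invariant sets in X to ergodicity of the skew product *)

Section ergodicity_criterion.
Context dT (T : measurableType dT) dX (X : measurableType dX) (R : realType).
Variables (p : probability T R) (P : probability (seq_space T) R).
Hypothesis prodP : is_product_measure p P.
Variable f : {mfun (T * X)%type >-> X}.
Local Notation Om := (seq_space T).
Local Notation F := (@skew_product _ T _ X f).
Variable mu : probability X R.
Hypothesis st : stationary p f mu.
Hypothesis triv : forall B, measurable B ->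
  {ae (p \x mu)%E, forall z, B (f z) <-> B z.2} -> mu B = 0%E \/ mu B = 1%E.
Local Open Scope ereal_scope.

(** By invariance of [A] the fiber measure [u] is a Koopman fixed point, hence invariant along
    almost every step. Its superlevel set at the mean [a] then has measure 0 or 1, and a function
    lying almost everywhere on one side of its mean equals it. *)
Lemma invariant_fiber_const (A : set (Om * X)) : measurable A -> F @^-1` A = A ->
  {ae mu, forall x, P [set w | A (w, x)] = (P \x mu) A}.
Proof.
move=> mA FA.
pose u x := fine (P [set w | A (w, x)]).
have uE x : (u x)%:E = P [set w | A (w, x)].
  by rewrite fineK// fin_num_measure//; exact: measurable_fiber.
have mu' : measurable_fun setT u.
  by apply: measurableT_comp => //; exact: measurable_fiber_measure.
have u01 x : (0 <= u x <= 1)%R.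
  rewrite -!lee_fin uE measure_ge0/=; apply: probability_le1.
  exact: measurable_fiber.
have Ku x : koopman p f (EFin \o u) x = (u x)%:E.
  rewrite (_ : EFin \o u = fun y => P [set w | A (w, y)]); last by apply/funext.
  rewrite -(fiber_skew_set prodP)// uE; congr (P _).
  by rewrite -[in RHS]FA.
have inv := koopman_fix_invariant st mu' u01 Ku.
have iu : mu.-integrable setT (EFin \o u).
  apply: (integrable_bounded (M := 1%R)) => // x.
  by have /andP[? ?] := u01 x; rewrite ger0_norm.
pose a := (\int[mu]_x u x)%R.
have aE : a%:E = (P \x mu) A.
  rewrite product_measure_ysection// /a /Rintegral fineK; last exact: integrable_fin_num.
  by apply: eq_integral => x _; exact: uE.
rewrite -aE; suff : {ae mu, forall x, u x = a} by apply: filterS => x <-; rewrite uE.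
pose B := [set x | (a < u x)%R].
have mB : measurable B by rewrite -[B]setTI; exact: measurable_fun_ltr.
have cst_int : mu.-integrable setT (EFin \o cst a) by exact: finite_measure_integrable_cst.
have int_cst : (\int[mu]_x cst a x = a)%R.
  by rewrite Rintegral_cst//= probability_setT mulr1.
have ae_of_le (v w : X -> R) : mu.-integrable setT (EFin \o v) -> mu.-integrable setT (EFin \o w) ->
    (\int[mu]_x v x = \int[mu]_x w x)%R -> {ae mu, forall x, (v x <= w x)%R} -> {ae mu, forall x, v x = w x}.
  move=> iv iw vw le.
  have mv : measurable_fun setT v by apply/measurable_EFinP; exact: measurable_int iv.
  have mw : measurable_fun setT w by apply/measurable_EFinP; exact: measurable_int iw.
  have mwv : measurable_fun setT (fun x => (w x - v x)%:E).
    by apply/measurable_EFinP; exact: measurable_funB.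
  have iwv : mu.-integrable setT (fun x => (w x - v x)%:E).
    by apply: eq_integrable (integrableB measurableT iw iv) => // x _; rewrite EFinB.
  have : \int[mu]_x `|(w x - v x)%:E| = 0.
    rewrite (ae_eq_integral (fun x => (w x - v x)%:E))//.
    - rewrite (_ : \int[mu]_x _ = \int[mu]_x ((EFin \o w) x - (EFin \o v) x)); last first.
        by apply: eq_integral => x _; rewrite EFinB.
      rewrite integralB//= -(fineK (integrable_fin_num _ iw))// -(fineK (integrable_fin_num _ iv))//.
      by rewrite -EFinB -[fine _]/(Rintegral mu setT w) -[X in (_ - X)%R]/(Rintegral mu setT v) vw subrr.
    - exact: measurableT_comp.
    - by apply: filterS le => x vwx _; rewrite gee0_abs// lee_fin subr_ge0.
  move/(ae_eq_integral_abs mu measurableT mwv); apply: filterS => x /(_ I)[] /eqP.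
  by rewrite subr_eq0 => /eqP.
have [B0|B1] : mu B = 0 \/ mu B = 1.
  by apply: triv => //; apply: filterS inv => z; rewrite /B/= => ->.
- apply: ae_of_le => //; exists B; split=> // x /= H.
  by rewrite /B/= ltNge; exact/negP.
- have aB : {ae mu, forall x, (a < u x)%R}.
    exists (~` B); split=> //; first exact: measurableC.
    by rewrite probability_setC// B1 subee.
  have : {ae mu, forall x, a = u x}.
    by apply: (@ae_of_le (cst a) u) => //; apply: filterS aB => x /ltW.
  by apply: filterS => x.
Qed.

(* Induction on [n]: as [A] is invariant, one step of the skew product removes
   the first coordinate of the cylinder. *)
Lemma invariant_cylinder (A : set (Om * X)) : measurable A -> F @^-1` A = A ->
  forall n C, (forall i, measurable (C i)) ->
  {ae mu, forall x, P [set w | cylinder n C w /\ A (w, x)] = P (cylinder n C) * (P \x mu) A}.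
Proof.
move=> mA FA; elim=> [|n IH] C mC.
  have c0 : cylinder 0 C = setT by apply/seteqP; split.
  rewrite c0 probability_setT; apply: filterS (invariant_fiber_const mA FA) => x <-.
  by rewrite mul1e; congr (P _); apply/seteqP; split => w /=; [by case|by split].
set a := (P \x mu) A in IH *.
pose D := fun i => C i.+1.
have mD i : measurable (D i) by exact: mC.
pose E : set (Om * X) := (cylinder n D `*` setT) `&` A.
have mE : measurable E.
  by apply: measurableI => //; apply: measurableX => //; exact: measurable_cylinder.
pose phi y := P [set w | E (w, y)].
have phi_ae : {ae mu, forall y, phi y = P (cylinder n D) * a}.
  apply: filterS (IH D mD) => y <-; congr (P _).
  by apply/seteqP; split => w /=; rewrite /E/=; tauto.
have mphi : measurable_fun setT phi by exact: measurable_fiber_measure.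
pose N := [set y | phi y != P (cylinder n D) * a].
have mN : measurable N.
  by rewrite -[N]setTI; exact: emeasurable_neq.
have N0 : mu N = 0.
  have [N' [mN' N'0 NN']] := phi_ae; apply: subset_measure0 N'0 => // y /= Ny.
  by apply: NN' => /= H; rewrite /N/= H eqxx in Ny.
(* By stationarity almost no point is sent into the null set [N] with positive probability, so the
   induction hypothesis may be used at [f (t, x)]. *)
have tN : {ae mu, forall x, transition p f x N = 0}.
  have : \int[mu]_x `|transition p f x N| = 0.
    rewrite -[RHS]N0 (stationary_transition st mN).
    by apply: eq_integral => x _; rewrite gee0_abs// measure_ge0.
  move/(ae_eq_integral_abs mu measurableT (measurable_transition p f mN)).
  by apply: filterS => x /(_ I).
apply: filterS tN => x tx.
have pt t : measurable [set w | E (w, f (t, x))] by exact: measurable_fiber.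
have mfx : measurable_fun setT (fun t => f (t, x)) by exact: (measurableT_comp (f := f)).
transitivity (\int[P]_w ((fun z : Om * T => (\1_(C 0%N) z.2)%:E * (\1_E (z.1, f (z.2, x)))%:E) (seq_shift w, w 0%N))).
  rewrite -(fiber_indic P x (E := [set z | cylinder n.+1 C z.1 /\ A z])); last first.
    rewrite (_ : mkset _ = (cylinder n.+1 C `*` setT) `&` A).
      by apply: measurableI => //; apply: measurableX => //; exact: measurable_cylinder.
    by apply/seteqP; split => -[w y] /=; tauto.
  apply: eq_integral => w _ /=; rewrite -EFinM !indicE -natrM mulnb; congr (_%:R%:E).
  congr nat_of_bool; apply/idP/andP => [/set_mem[H1 H2]|[/set_mem H1 /set_mem[[H2 _] H3]]].
    split; apply/mem_set; first exact: (H1 0%N).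
    by split; [split=> // i ?; exact: (H1 i.+1)|rewrite -FA in H2].
  by apply/mem_set; split; [case=> // i ?; exact: H2|rewrite -FA].
rewrite (shift_independent prodP (u := fun z : Om * T => (\1_(C 0%N) z.2)%:E * (\1_E (z.1, f (z.2, x)))%:E)); last 2 first.
- apply: emeasurable_funM.
    apply/measurable_EFinP; apply: (measurableT_comp (measurable_indic (mC 0%N))).
    exact: measurable_snd.
  apply/measurable_EFinP; apply: (measurableT_comp (measurable_indic mE)).
  apply: measurable_fun_pair; first exact: measurable_fst.
  exact: (measurableT_comp mfx measurable_snd).
- by move=> z; rewrite -EFinM lee_fin mulr_ge0.
have step t : \int[P]_w ((\1_(C 0%N) t)%:E * (\1_E (w, f (t, x)))%:E) = (\1_(C 0%N) t)%:E * phi (f (t, x)).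
  rewrite ge0_integralZl ?lee_fin// ?fiber_indic//.
  apply/measurable_EFinP; apply: (measurableT_comp (measurable_indic mE)).
  exact: measurable_pair2.
under eq_integral do rewrite step.
have -> : P (cylinder n.+1 C) = p (C 0%N) * P (cylinder n D).
  by rewrite !prodP// big_ord_recl.
have tae : {ae p, forall t, phi (f (t, x)) = P (cylinder n D) * a}.
  exists [set t | N (f (t, x))]; split => //=.
    by rewrite -[X in measurable X]setTI; exact: mfx.
  by move=> t /= H; rewrite /N/=; exact/eqP.
have Pa0 : 0 <= P (cylinder n D) * a by rewrite mule_ge0 ?measure_ge0.
rewrite (ae_eq_integral (fun t => (\1_(C 0%N) t)%:E * (P (cylinder n D) * a)))//.
- rewrite ge0_integralZr//.
  + by rewrite integral_indic// setIT muleA.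
  + by apply/measurable_EFinP; exact: measurable_indic.
- apply: emeasurable_funM; first by apply/measurable_EFinP; exact: measurable_indic.
  exact: (measurableT_comp mphi mfx).
- apply: emeasurable_funM => //; by apply/measurable_EFinP; exact: measurable_indic.
- by apply: filterS tae => t -> _.
Qed.

(** By [invariant_cylinder], the restriction of [P \x mu] to [A] and the multiple of [P \x mu] by
    [a = (P \x mu) A] agree on rectangles over cylinders, hence everywhere. Evaluated at [A] this
    reads [a = a * a]. *)
Theorem ergodic_criterion : ergodic_stationary p P f mu.
Proof.
split=> //; split; first exact: (stationary_skew prodP st).
move=> A mA FA.
set a := (P \x mu) A.
have a_fin : a \is a fin_num.
  rewrite ge0_fin_numE ?measure_ge0// /a product_measure_xsection.
  apply: le_lt_trans (_ : \int[P]_w cst 1 w < +oo).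
    apply: ge0_le_integral => //; first exact: measurable_fiberx_measure.
    by move=> w _; apply: probability_le1; exact: measurable_fiberx.
  by rewrite integral_cst//= probability_setT mul1e ltry.
have a0 : (0 <= fine a)%R by rewrite fine_ge0// measure_ge0.
pose m1 := mrestr (P \x mu) mA.
pose m2 := mscale (NngNum a0) (P \x mu).
have : m1 A = m2 A.
  apply: (@cylinder_prod_unique _ _ _ _ _ m1 m2) => //.
    by rewrite /m1/= /mrestr setTI -/a ltey_eq a_fin.
  move=> n C B mC mB.
  have mCB : measurable (cylinder n C `*` B) by apply: measurableX => //; exact: measurable_cylinder.
  rewrite /m1 /m2 /= /mrestr /mscale/= fineK// product_measure1E//; last exact: measurable_cylinder.
  rewrite product_measure_ysection; last exact: measurableI.
  rewrite (ae_eq_integral (fun x => (P (cylinder n C) * a) * (\1_B x)%:E))//.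
  - rewrite ge0_integralZl//; [|by apply/measurable_EFinP; exact: measurable_indic|
      by rewrite mule_ge0 ?measure_ge0].
    by rewrite integral_indic// setIT [_ * a]muleC muleA.
  - by apply: (measurable_fiber_measure P); exact: measurableI.
  - by apply: emeasurable_funM => //; apply/measurable_EFinP; exact: measurable_indic.
  - apply: filterS (invariant_cylinder mA FA n mC) => x <- _; rewrite indicE.
    have [xB|xB] := pselect (B x).
      rewrite mem_set// mule1; congr (P _).
      by apply/seteqP; split => w /=; tauto.
    rewrite memNset// mule0 (_ : mkset _ = set0) ?measure0//.
    by apply/seteqP; split => w //= [[]].
rewrite /m1 /m2 /= /mrestr /mscale/= setIid -/a fineK//.
move: a_fin; case: (a) => // r _ /eqP; rewrite -EFinM eqe => /eqP rr.
have : (r * (1 - r) = 0)%R by rewrite mulrBr mulr1 -rr subrr.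
move/eqP; rewrite mulf_eq0 subr_eq0 => /orP[/eqP->|/eqP <-]; [by left|by right].
Qed.

End ergodicity_criterion.

(** * Birkhoff's ergodic theorem *)

Section birkhoff.
Context d (Y : measurableType d) (R : realType) (nu : probability Y R).
Variable F : Y -> Y.
Hypothesis mF : measurable_fun setT F.

Definition orbit_sum (phi : Y -> R) n y : R := \sum_(j < n) phi (iter j F y).

Lemma orbit_sumS phi n y : orbit_sum phi n.+1 y = phi y + orbit_sum phi n (F y).
Proof. by rewrite /orbit_sum big_ord_recl; congr (_ + _); apply: eq_bigr => i _; rewrite -iterSr. Qed.

Lemma measurable_orbit_sum (phi : Y -> R) n : measurable_fun setT phi -> measurable_fun setT (orbit_sum phi n).
Proof.
move=> mphi; elim: n => [|n IH].
  rewrite (_ : orbit_sum phi 0 = cst 0)//; apply/funext => y; rewrite /orbit_sum big_ord0//.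
rewrite (_ : orbit_sum phi n.+1 = fun y => phi y + orbit_sum phi n (F y)).
  by apply: measurable_funD => //; exact: measurableT_comp.
by apply/funext => y; exact: orbit_sumS.
Qed.

Hypothesis inv : invariant_measure nu F.

Lemma invariant_Rintegral (u : Y -> R) (M : R) : measurable_fun setT u ->
  (forall y, 0 <= u y <= M) -> \int[nu]_y u (F y) = \int[nu]_y u y.
Proof.
move=> mu u0; congr fine.
rewrite -(ge0_integral_image nu mF (u := EFin \o u)); last 2 first.
- exact/measurable_EFinP.
- by move=> z; rewrite lee_fin; case/andP: (u0 z).
by apply: eq_measure_integral => A mA _; exact: inv.
Qed.

(** The maximum of the orbit sums of lengths [0] to [n]. The recursive form is the identity on which
    Garsia's argument rests. *)
Fixpoint orbit_max (phi : Y -> R) n (y : Y) : R :=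
  if n is k.+1 then Num.max 0 (phi y + orbit_max phi k (F y)) else 0.

Lemma orbit_max_ge0 phi n y : 0 <= orbit_max phi n y.
Proof. by case: n => //= n; rewrite le_max lexx. Qed.

Lemma orbit_max_nd phi n y : orbit_max phi n y <= orbit_max phi n.+1 y.
Proof.
elim: n y => [|n IH] y; first exact: orbit_max_ge0.
rewrite /= ge_max !le_max lexx/= lerD2l; apply/orP; right; exact: IH.
Qed.

Lemma orbit_sum_le_max phi n k y : (k <= n)%N -> orbit_sum phi k y <= orbit_max phi n y.
Proof.
elim: n k y => [|n IH] [|k] y //.
- by move=> _; rewrite /orbit_sum big_ord0.
- by move=> _; rewrite /orbit_sum big_ord0 orbit_max_ge0.
by rewrite ltnS => kn; rewrite orbit_sumS /= le_max lerD2l IH ?orbT.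
Qed.

Lemma orbit_max_le (phi : Y -> R) (M : R) n y : 0 <= M -> (forall y, `|phi y| <= M) -> orbit_max phi n y <= n%:R * M.
Proof.
move=> M0 phiM; elim: n y => [|n IH] y /=; first by rewrite mul0r.
rewrite ge_max mulr_ge0//= -natr1 mulrDl mul1r addrC lerD//.
exact: le_trans (ler_norm _) (phiM _).
Qed.

Lemma measurable_orbit_max (phi : Y -> R) n : measurable_fun setT phi -> measurable_fun setT (orbit_max phi n).
Proof.
move=> mphi; elim: n => [|n IH] //=; apply: measurable_maxr => //.
by apply: measurable_funD => //; exact: measurableT_comp.
Qed.

Definition unbounded_orbit phi : set Y := [set y | forall K : nat, exists n, K%:R < orbit_sum phi n y].

Lemma measurable_unbounded_orbit (phi : Y -> R) : measurable_fun setT phi -> measurable (unbounded_orbit phi).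
Proof.
move=> mphi; rewrite (_ : unbounded_orbit phi = \bigcap_K \bigcup_n [set y | K%:R < orbit_sum phi n y]).
  apply: bigcapT_measurable => K; apply: bigcupT_measurable => n.
  rewrite -[X in measurable X]setTI; apply: measurable_fun_ltr => //; exact: measurable_orbit_sum.
apply/seteqP; split=> y /= H K; first by have [n ?] := H K; exists n.
by have [n _ ?] := H K I; exists n.
Qed.

(** Moving the starting point by one step changes the sums by one value of [phi], of size at most
    [M]; raising the threshold by [truncn M + 1] absorbs it. Equality of the sets matters because
    ergodicity is stated for strictly invariant sets. *)
Lemma unbounded_orbit_invariant (phi : Y -> R) (M : R) : (forall y, `|phi y| <= M) ->
  F @^-1` (unbounded_orbit phi) = unbounded_orbit phi.
Proof.
move=> phiM; apply/seteqP; split=> y /= H K.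
  have [n Hn] := H (K + (Num.truncn M).+1)%N; exists n.+1; rewrite orbit_sumS.
  move: Hn; rewrite natrD; have := truncnS_gt M; have := phiM y; rewrite ler_norml => /andP[].
  by move: (_.+1%:R) (orbit_sum _ _ _) (phi y) => a b c; lra.
have [n Hn] := H (K + (Num.truncn M).+1)%N.
case: n Hn => [|n]; first by rewrite /orbit_sum big_ord0 ltrn0.
move=> Hn; exists n; move: Hn; rewrite orbit_sumS.
rewrite natrD; have := truncnS_gt M; have := phiM y; rewrite ler_norml => /andP[].
by move: (_.+1%:R) (orbit_sum _ _ _) (phi y) => a b c; lra.
Qed.

(* Garsia's argument: [orbit_max n.+1 - orbit_max n \o F] has nonnegative
   integral, is dominated by [`|phi|], and equals [phi] for large [n] wherever the
   orbit sums are unbounded. *)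
Lemma maximal_ergodic (phi : Y -> R) (M : R) : measurable_fun setT phi -> (forall y, `|phi y| <= M) ->
  nu (unbounded_orbit phi) = 1%E -> 0 <= \int[nu]_y phi y.
Proof.
move=> mphi phiM A1.
have M0 : 0 <= M by exact: le_trans (phiM point).
pose D n y := orbit_max phi n.+1 y - orbit_max phi n (F y).
have mmax n : measurable_fun setT (orbit_max phi n) by exact: measurable_orbit_max.
have mmaxF n : measurable_fun setT (fun y => orbit_max phi n (F y)) by exact: measurableT_comp.
have mD n : measurable_fun setT (D n) by exact: measurable_funB.
(* This form shows both that [D n] is bounded by [|phi|] and that it equals [phi] once
   [orbit_max phi n (F y) >= M]. *)
have DE n y : D n y = Num.max (- orbit_max phi n (F y)) (phi y).
  rewrite /D /=; set a := orbit_max _ _ _.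
  by case: (ltP 0 (phi y + a)) => h1; case: (ltP (- a) (phi y)) => h2; lra.
have Dphi n y : `|D n y| <= `|phi y|.
  rewrite DE; have := orbit_max_ge0 phi n (F y); set a := orbit_max _ _ _ => a0.
  case: (ltP (- a) (phi y)) => // h; rewrite normrN (ger0_norm a0) -normrN.
  by apply: le_trans (ler_norm _); rewrite lerNr.
have bmax n y : 0 <= orbit_max phi n y <= n%:R * M.
  by rewrite orbit_max_ge0 orbit_max_le.
have imax n : nu.-integrable setT (EFin \o orbit_max phi n).
  apply: (integrable_bounded (M := n%:R * M)) => // y.
  by have /andP[? ?] := bmax n y; rewrite ger0_norm.
have imaxF n : nu.-integrable setT (EFin \o (fun y => orbit_max phi n (F y))).
  apply: (integrable_bounded (M := n%:R * M)) => // y.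
  by have /andP[? ?] := bmax n (F y); rewrite ger0_norm.
have intD n : 0 <= \int[nu]_y D n y.
  rewrite RintegralB// (invariant_Rintegral (mmax n) (bmax n)) subr_ge0.
  by apply: le_Rintegral => // y _; exact: orbit_max_nd.
have iphi : nu.-integrable setT (EFin \o phi) by exact: (integrable_bounded (M := M)).
have [|||||_ _ cv] := @dominated_convergence _ _ _ nu setT measurableT
  (fun n => EFin \o D n) (EFin \o phi) (EFin \o (fun y => `|phi y|)).
- by move=> n; exact/measurable_EFinP.
- exact/measurable_EFinP.
- have mA := measurable_unbounded_orbit mphi.
  exists (~` unbounded_orbit phi); split; first exact: measurableC.
    by have := probability_setC nu mA; rewrite A1 subee.
  (* Invariance moves the unboundedness from [y] to [F y], where the maximum in [DE] is taken. *)
  apply: subsetC => y; rewrite -(unbounded_orbit_invariant phiM) => Ay _.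
  apply: cvg_EFin; first exact: nearW.
  have [k Hk] := Ay (Num.truncn M).+1.
  apply: cvg_near_cst; exists k => // n /= kn.
  rewrite DE max_r//; have := orbit_sum_le_max phi (F y) kn.
  have := truncnS_gt M; have := phiM y; rewrite ler_norml => /andP[].
  move: Hk; move: (_.+1%:R) (orbit_sum _ _ _) (orbit_max _ _ _) (phi y) => a b c e; lra.
- exact: integrable_abse iphi.
- by apply: aeW => y n _; rewrite /= lee_fin.
have cv' : \int[nu]_y D n y @[n --> \oo] --> \int[nu]_y phi y.
  apply: fine_cvg; rewrite [X in _ --> X]fineK; last exact: integrable_fin_num.
  exact: cv.
rewrite -(cvg_lim _ cv')//; apply: limr_ge; first by apply/cvg_ex; exists (\int[nu]_y phi y).
exact: nearW.
Qed.

Hypothesis erg : forall A, measurable A -> F @^-1` A = A -> nu A = 0%E \/ nu A = 1%E.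

(** If the sums of [phi - c] were unbounded above almost everywhere, [maximal_ergodic] would give
    [c <= \int phi]. By ergodicity they are then bounded above almost everywhere, which is the
    estimate. *)
Lemma birkhoff_upper (phi : Y -> R) (M c : R) : measurable_fun setT phi -> (forall y, `|phi y| <= M) ->
  \int[nu]_y phi y < c ->
  {ae nu, forall y, exists K : nat, forall n, orbit_sum phi n y <= n%:R * c + K%:R}.
Proof.
move=> mphi phiM Ic.
pose psi y := phi y - c.
have mpsi : measurable_fun setT psi by exact: measurable_funB.
have psiM y : `|psi y| <= M + `|c| by rewrite (le_trans (ler_normB _ _))// lerD2r.
have sumE n y : orbit_sum psi n y = orbit_sum phi n y - n%:R * c.
  by rewrite /orbit_sum sumrB sumr_const card_ord -(mulr_natl c).
have mA := measurable_unbounded_orbit mpsi.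
have [A0|A1] := erg mA (unbounded_orbit_invariant psiM).
  exists (unbounded_orbit psi); split=> // y /= H K; apply: contrapT => K'; apply: H; exists K => n.
  have : orbit_sum psi n y <= K%:R by rewrite leNgt; apply/negP => ?; apply: K'; exists n.
  by rewrite sumE lerBlDl.
have := maximal_ergodic mpsi psiM A1.
rewrite RintegralB//; [|exact: (integrable_bounded (M := M))|exact: finite_measure_integrable_cst].
by rewrite Rintegral_cst//= probability_setT mulr1 subr_ge0 leNgt Ic.
Qed.

(** [birkhoff_upper] is applied to [phi] and to its opposite with the countably many margins
    [1 / (k + 1)]; division by [n] removes the bounded error [K]. *)
Theorem birkhoff (phi : Y -> R) (M : R) : measurable_fun setT phi -> (forall y, `|phi y| <= M) ->
  {ae nu, forall y, n%:R^-1 * orbit_sum phi n y @[n --> \oo] --> \int[nu]_z phi z}.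
Proof.
move=> mphi phiM; set c := \int[nu]_z phi z.
have up k : {ae nu, forall y, exists K : nat, forall n,
    orbit_sum phi n y <= n%:R * (c + k.+1%:R^-1) + K%:R}.
  by apply: birkhoff_upper phiM _ => //; rewrite ltrDl invr_gt0.
have lo k : {ae nu, forall y, exists K : nat, forall n,
    orbit_sum (fun y => - phi y) n y <= n%:R * (- c + k.+1%:R^-1) + K%:R}.
  apply: (birkhoff_upper (M := M)).
  - exact: measurableT_comp.
  - by move=> y; rewrite normrN.
  - rewrite (_ : \int[nu]_y _ = - c) ?ltrDl ?invr_gt0//.
    rewrite -mulN1r -RintegralZl//; last exact: (integrable_bounded (M := M)).
    by apply: eq_Rintegral => y _; rewrite mulN1r.
apply: filterS2 (ae_foralln up) (ae_foralln lo) => y upy loy.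
apply/cvgrPdist_lt => e e0; have e2 : 0 < e / 2 by rewrite divr_gt0.
have [k /(_ _ (leqnn _))] := (cvg0_natP (fun n => n.+1%:R^-1 : R)).1 (@cvg_harmonic R) _ e2.
rewrite ger0_norm ?invr_ge0// => ke.
have [K1 H1] := upy k; have [K2 H2] := loy k.
have [N HN] := (cvg0_natP _).1 (cvg_inv_natM ((maxn K1 K2)%:R : R)) _ e2.
exists (maxn 1 N) => // n /=; rewrite geq_max => /andP[n0 nN].
have {}HN := HN n nN; rewrite ger0_norm ?mulr_ge0 ?invr_ge0// in HN.
have npos : 0 < n%:R :> R by rewrite ltr0n.
have K1n : K1%:R <= (maxn K1 K2)%:R :> R by rewrite ler_nat leq_maxl.
have K2n : K2%:R <= (maxn K1 K2)%:R :> R by rewrite ler_nat leq_maxr.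
have {}H1 := H1 n; have {}H2 := H2 n.
have sN : orbit_sum (fun y => - phi y) n y = - orbit_sum phi n y by rewrite /orbit_sum sumrN.
rewrite sN in H2; move: H1 H2 HN; rewrite ![_^-1 * _]mulrC ltr_pdivrMr// => H1 H2 HN.
set S := orbit_sum phi n y in H1 H2 *.
have -> : c - S / n%:R = (n%:R * c - S) / n%:R by field; rewrite gt_eqF.
rewrite normrM normfV (gtr0_norm npos) ltr_pdivrMr// ltr_norml.
have kn : n%:R * k.+1%:R^-1 < n%:R * (e / 2) :> R by rewrite ltr_pM2l.
move: H1 H2; rewrite !mulrDr mulrN => H1 H2.
apply/andP; split; move: K1n K2n kn HN H1 H2; clear;
  move: (n%:R * c) (n%:R * k.+1%:R^-1) => a b; lra.
Qed.

End birkhoff.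

(** * From mean constrictivity to (FPM) *)

Lemma Rintegral_sum d (Y : measurableType d) (R : realType) (nu : {measure set Y -> \bar R}) n (u : 'I_n -> Y -> R) :
  (forall i, nu.-integrable setT (EFin \o u i)) ->
  \int[nu]_y (\sum_(i < n) u i y) = \sum_(i < n) \int[nu]_y u i y.
Proof.
move=> iu; rewrite /Rintegral [RHS]sum_fine; last by move=> i _; apply: integrable_fin_num => //; exact: iu.
congr fine; rewrite -integral_sum//.
by apply: eq_integral => y _; rewrite -sumEFin.
Qed.

Lemma integrable_sumR d (Y : measurableType d) (R : realType) (nu : {measure set Y -> \bar R}) n (u : 'I_n -> Y -> R) :
  (forall i, nu.-integrable setT (EFin \o u i)) ->
  nu.-integrable setT (EFin \o (fun y => \sum_(i < n) u i y)).
Proof.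
move=> iu; rewrite (_ : EFin \o _ = fun y => (\sum_(i < n) (u i y)%:E)%E); last by apply/funext => y /=; rewrite sumEFin.
by apply: integrable_sum => // i _; exact: iu.
Qed.

Section generic_measure.
Context d (Y : measurableType d) (R : realType).

Lemma measurable_cvg_set (u : nat -> Y -> R) (c : R) :
  (forall n, measurable_fun setT (u n)) -> measurable [set y | u n y @[n --> \oo] --> c].
Proof.
move=> mu; rewrite (_ : mkset _ = \bigcap_k \bigcup_N \bigcap_(n in [set n | (N <= n)%N])
    [set y | `|u n y - c| < k.+1%:R^-1]).
  apply: bigcapT_measurable => k; apply: bigcupT_measurable => N.
  apply: bigcap_measurableType => n _; rewrite -[X in measurable X]setTI.
  by apply: measurable_fun_ltr => //; apply: measurableT_comp => //; exact: measurable_funB.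
apply/seteqP; split=> y /=.
  move=> /cvgrPdist_lt H k _.
  have [N _ HN] := H k.+1%:R^-1 ltac:(by rewrite invr_gt0).
  by exists N => // n /= /HN; rewrite /= distrC.
move=> H; apply/cvgrPdist_lt => e e0.
have [k /(_ _ (leqnn _))] := (cvg0_natP (fun n => n.+1%:R^-1 : R)).1 (@cvg_harmonic R) _ e0.
rewrite ger0_norm ?invr_ge0// => ke.
have [N _ HN] := H k I; exists N => // n /HN /=; rewrite distrC => /lt_trans; exact.
Qed.

Lemma measure_ae_eq (nu : {measure set Y -> \bar R}) (A B : set Y) : measurable A -> measurable B ->
  {ae nu, forall y, A y <-> B y} -> nu A = nu B.
Proof.
move=> mA mB AB; rewrite -[A]setIT -[B]setIT -!integral_indic//.
apply: ae_eq_integral => //; try by apply/measurable_EFinP; exact: measurable_indic.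
apply: filterS AB => y yAB _; rewrite !indicE; congr (_%:R%:E).
by congr nat_of_bool; apply/idP/idP => /set_mem H; apply/mem_set; tauto.
Qed.

Lemma ae_probability1 (nu : probability Y R) (A : set Y) : measurable A ->
  nu A = 1%E <-> {ae nu, forall y, A y}.
Proof.
move=> mA; split=> H.
  exists (~` A); split => //; first exact: measurableC.
  by have := probability_setC nu mA; rewrite H subee.
by rewrite -(probability_setT nu); apply: measure_ae_eq => //; apply: filterS H.
Qed.

End generic_measure.

Section product_probability.
Context d1 d2 (Y : measurableType d1) (Z : measurableType d2) (R : realType).
Variables (P : probability Y R) (Q : probability Z R).

Let prod_setT : (P \x Q)%E setT = 1%E.
Proof. by rewrite -setXTT product_measure1E//= !probability_setT mule1. Qed.

Definition product_probability : probability (Y * Z)%type R :=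
  HB.pack_for (probability (Y * Z)%type R) (P \x Q)%E (Measure_isProbability.Build _ _ _ (P \x Q)%E prod_setT).

Lemma ae_product1 (E : set (Y * Z)) : measurable E ->
  (P \x Q)%E E = 1%E <-> {ae P, forall y, Q [set z | E (y, z)] = 1%E}.
Proof.
move=> mE.
have mfib y : measurable [set z | E (y, z)].
  rewrite (_ : mkset _ = xsection E y); first exact: measurable_xsection.
  by apply/seteqP; split => z /=; rewrite xsectionE.
have mf : measurable_fun setT (fun y => Q [set z | E (y, z)]).
  rewrite (_ : (fun y => _) = Q \o xsection E); first exact: measurable_fun_xsection.
  by apply/funext => y /=; congr (Q _); apply/seteqP; split => z /=; rewrite xsectionE.
split=> [E1|H]; last first.
  rewrite product_measure_xsection (ae_eq_integral (cst 1%E))//.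
    by rewrite integral_cst//= probability_setT mule1.
  by apply: filterS H => y Hy _; exact: Hy.
have mEC : measurable (~` E) by exact: measurableC.
have : (\int[P]_y `|Q [set z | (~` E) (y, z)]| = 0)%E.
  rewrite (_ : (\int[P]_y _)%E = (P \x Q)%E (~` E)).
    have := @probability_setC _ _ _ product_probability E mE.
    by rewrite [product_probability E]E1 subee.
  by rewrite product_measure_xsection; apply: eq_integral => y _; rewrite gee0_abs.
have mfC : measurable_fun setT (fun y => Q [set z | (~` E) (y, z)]).
  rewrite (_ : (fun y => _) = Q \o xsection (~` E)); first exact: measurable_fun_xsection.
  by apply/funext => y /=; congr (Q _); apply/seteqP; split => z /=; rewrite xsectionE.
move/(ae_eq_integral_abs P measurableT mfC); apply: filterS => y /(_ I) /= H.
rewrite -[[set z | _]]setCK.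
by have := probability_setC Q (measurableC (mfib y)); rewrite H sube0.
Qed.

End product_probability.

Section pairing.
Context d (X : measurableType d) (R : realType) (m : probability X R).
Implicit Types g h : L1 m.

Definition L1_pair (w : X -> R) h : R := \int[m]_x (w x * L1_fun h x).

Lemma integrable_pair (w : X -> R) (M : R) h : measurable_fun setT w -> (forall x, `|w x| <= M) ->
  m.-integrable setT (EFin \o (fun x => w x * L1_fun h x)).
Proof.
move=> mw wM; apply: (le_integrable measurableT _ _ (integrableZl measurableT M (L1_integrable h))).
  by apply/measurable_EFinP; apply: measurable_funM => //; exact: measurable_L1.
move=> x _; rewrite /= lee_fin !normrM ler_wpM2r//.
exact: le_trans (wM x) (ler_norm _).
Qed.

Section bounded.
Variables (w : X -> R) (M : R).
Hypotheses (mw : measurable_fun setT w) (wM : forall x, `|w x| <= M).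

Let mp h : measurable_fun setT (fun x => w x * L1_fun h x).
Proof. by apply: measurable_funM => //; exact: measurable_L1. Qed.

Lemma L1_pairD g h : L1_pair w (g + h) = L1_pair w g + L1_pair w h.
Proof.
rewrite /L1_pair -RintegralD//; try exact: integrable_pair wM.
apply: eq_ae_Rintegral => //; first exact: measurable_funD.
by apply: filterS (L1_funD g h) => x ->; rewrite mulrDr.
Qed.

Lemma L1_pairZ a h : L1_pair w (a *: h) = a * L1_pair w h.
Proof.
rewrite /L1_pair -RintegralZl//; last exact: integrable_pair wM.
apply: eq_ae_Rintegral => //; first exact: measurable_funM.
by apply: filterS (L1_funZ a h) => x ->; rewrite mulrCA.
Qed.

Lemma L1_pairB g h : L1_pair w (g - h) = L1_pair w g - L1_pair w h.
Proof. by rewrite -scaleN1r L1_pairD L1_pairZ mulN1r. Qed.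

Lemma L1_pair0 : L1_pair w 0 = 0.
Proof. by rewrite -(scale0r (0 : L1 m)) L1_pairZ mul0r. Qed.

Lemma L1_pair_sum r (h : 'I_r -> L1 m) :
  L1_pair w (\sum_(i < r) h i) = \sum_(i < r) L1_pair w (h i).
Proof. exact: (big_morph _ L1_pairD L1_pair0). Qed.

Lemma L1_pair_norm h : `|L1_pair w h| <= M * `|h|.
Proof.
apply: le_trans (le_normr_Rintegral _ _) _ => //; first exact: integrable_pair wM.
rewrite L1_normE -RintegralZl//; last exact: integrable_normL1.
apply: le_ae_Rintegral.
- exact: integrable_abse (integrable_pair h mw wM).
- exact (integrableZl measurableT M (integrable_normL1 h)).
- by apply: aeW => x; rewrite normrM ler_wpM2r.
Qed.

Lemma integral_L1_measure_pair h : L1_le 0 h ->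
  (\int[L1_measure h]_x (w x)%:E = (L1_pair w h)%:E)%E.
Proof.
move=> /L1_le0P h0; rewrite (integral_L1_measure h mw wM) fineK; last first.
  by apply: integrable_fin_num => //; exact: integrable_pair wM.
apply: ae_eq_integral => //; try exact/measurable_EFinP.
  apply/measurable_EFinP; apply: measurable_funM => //; apply: measurable_maxr => //.
  exact: measurable_L1.
by apply: filterS h0 => x hx _; rewrite max_r.
Qed.

End bounded.

Lemma L1_measure_setT h : densities h -> L1_measure h setT = 1%E.
Proof.
move=> /densityP[h0 h1]; rewrite L1_measureE// -h1 /L1_int fineK//.
by apply: integrable_fin_num => //; exact: L1_integrable.
Qed.

Definition density_probability h (dh : densities h) : probability X R :=
  HB.pack_for (probability X R) (L1_measure h)
    (Measure_isProbability.Build _ _ _ (L1_measure h) (L1_measure_setT dh)).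

Lemma density_probability_RN h (dh : densities h) :
  {ae m, forall x, Radon_Nikodym (charge_of_finite_measure (density_probability dh)) m x
    = (L1_fun h x)%:E}.
Proof.
apply: RN_ae => //; first exact: L1_measure_dominated.
  exact: L1_integrable.
by move=> A mA; rewrite -L1_measureE//; case: (densityP h).1.
Qed.

End pairing.

(** * Averages along random orbits as Birkhoff averages of the skew product *)

Section birkhoff_averages.
Context dT (T : measurableType dT) dX (X : measurableType dX) (R : realType).
Variables (p : probability T R) (P : probability (seq_space T) R).
Variable f : {mfun (T * X)%type >-> X}.
Local Notation Om := (seq_space T).
Local Notation F := (@skew_product _ T _ X f).

Definition orbit_avg (psi : X -> R) n (z : Om * X) : R :=
  n%:R^-1 * \sum_(j < n) psi (random_orbit f z.1 j z.2).

Lemma orbit_avgE psi n z : orbit_avg psi n z = n%:R^-1 * orbit_sum F (psi \o snd) n z.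
Proof.
congr (_ * _); apply: eq_bigr => j _ /=; case: z => w x.
by rewrite iter_skew.
Qed.

Lemma measurable_orbit_avg psi n : measurable_fun setT psi -> measurable_fun setT (orbit_avg psi n).
Proof.
move=> mpsi; rewrite (_ : orbit_avg psi n = fun z => n%:R^-1 * orbit_sum F (psi \o snd) n z).
  apply: measurable_funM => //; apply: measurable_orbit_sum; first exact: measurable_skew.
  exact: (measurableT_comp mpsi measurable_snd).
by apply/funext => z; exact: orbit_avgE.
Qed.

Definition avg_basin psi (c : R) : set (Om * X) := [set z | orbit_avg psi n z @[n --> \oo] --> c].

Lemma measurable_avg_basin psi c : measurable_fun setT psi -> measurable (avg_basin psi c).
Proof. by move=> mpsi; apply: measurable_cvg_set => n; exact: measurable_orbit_avg. Qed.

(** The averages started at [F z] and at [z] differ by the last value of [psi] minus the first,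
    divided by [n]. *)
Lemma avg_basin_invariant psi (M : R) c : (forall x, `|psi x| <= M) ->
  F @^-1` (avg_basin psi c) = avg_basin psi c.
Proof.
move=> psiM.
have diff z : orbit_avg psi n (F z) - orbit_avg psi n z @[n --> \oo] --> 0.
  apply: (@squeeze_cvgr _ _ _ _ (fun n => - (n%:R^-1 * (2 * M))) (fun n => n%:R^-1 * (2 * M))).
  - apply: nearW => n; rewrite -ler_norml !orbit_avgE -mulrBr normrM ger0_norm ?invr_ge0//.
    apply: ler_wpM2l; first by rewrite invr_ge0.
    have -> : orbit_sum F (psi \o snd) n (F z) - orbit_sum F (psi \o snd) n z =
        psi (iter n F z).2 - psi z.2.
      have := orbit_sumS F (psi \o snd) n z.
      have -> : orbit_sum F (psi \o snd) n.+1 z = orbit_sum F (psi \o snd) n z + psi (iter n F z).2.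
        by rewrite /orbit_sum big_ord_recr.
      by rewrite /=; move: (orbit_sum _ _ n z) (orbit_sum _ _ n (F z)) (psi _) (psi _) => a b c' e; lra.
    by rewrite (le_trans (ler_normB _ _))// mulr_natl mulr2n lerD.
  - by rewrite -oppr0; apply: cvgN; exact: cvg_inv_natM.
  - exact: cvg_inv_natM.
apply/seteqP; split=> z /= H; rewrite /avg_basin/=.
  rewrite (_ : (fun n => _) = fun n => orbit_avg psi n (F z) - (orbit_avg psi n (F z) - orbit_avg psi n z)).
    by rewrite -[X in _ --> X]subr0; apply: cvgB.
  by apply/funext => n; rewrite subKr.
rewrite (_ : (fun n => _) = fun n => orbit_avg psi n z + (orbit_avg psi n (F z) - orbit_avg psi n z)).
  by rewrite -[X in _ --> X]addr0; apply: cvgD.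
by apply/funext => n; rewrite addrC subrK.
Qed.

(** Birkhoff's theorem for the skew product and the observable [psi \o snd], whose integral is that
    of [psi] because [P] has mass 1. *)
Lemma ergodic_avg (mu : probability X R) (psi : X -> R) (M : R) : ergodic_stationary p P f mu ->
  measurable_fun setT psi -> (forall x, `|psi x| <= M) ->
  (P \x mu)%E (avg_basin psi (\int[mu]_x psi x)) = 1%E.
Proof.
move=> [_ [inv erg]] mpsi psiM.
pose nu := product_probability P mu.
have mphi : measurable_fun setT (psi \o snd : Om * X -> R) by exact: (measurableT_comp mpsi measurable_snd).
have mB := measurable_avg_basin (\int[mu]_x psi x) mpsi.
apply/(ae_probability1 nu mB).
have := @birkhoff _ _ _ nu F (measurable_skew f) inv erg (psi \o snd) M mphi (fun z => psiM z.2).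
have -> : \int[nu]_z (psi \o snd) z = \int[mu]_x psi x.
  rewrite /Rintegral; congr fine.
  have ipsi : (P \x mu)%E.-integrable setT (EFin \o (psi \o snd)).
    exact: (integrable_bounded nu mphi (fun z => psiM z.2)).
  rewrite -(integral12_prod_meas1 ipsi) /fubini_F /=.
  by rewrite integral_cst//= probability_setT mule1.
apply: filterS => z; rewrite /avg_basin/= (_ : (fun n => orbit_avg psi n z) =
  (fun n => n%:R^-1 * orbit_sum F (psi \o snd) n z))//.
by apply/funext => n; exact: orbit_avgE.
Qed.

End birkhoff_averages.

Section koopman_dual.
Context dT (T : measurableType dT) dX (X : measurableType dX) (R : realType).
Variables (p : probability T R) (m : probability X R).
Variable f : {mfun (T * X)%type >-> X}.
Hypothesis ns : nonsingular_transition p m f.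
Local Notation L := (annealed_PF p m f).

Lemma koopman_bound (w : X -> R) (M : R) x : measurable_fun setT w -> (forall y, 0 <= w y <= M) ->
  (0 <= koopman p f (EFin \o w) x <= M%:E)%E.
Proof.
move=> mw wM; apply/andP; split.
  by apply: koopman_ge0 => y; rewrite lee_fin; case/andP: (wM y).
rewrite -[leRHS]mule1 -(probability_setT p) -integral_cst//.
apply: ge0_le_integral => //.
- by move=> t _; rewrite lee_fin; case/andP: (wM (f (t, x))).
- apply/measurable_EFinP; apply: measurableT_comp => //; exact: (measurableT_comp (f := f)).
- by move=> t _; rewrite lee_fin; case/andP: (wM (f (t, x))).
Qed.

Lemma L1_pair_koopman (w : X -> R) (M : R) h : measurable_fun setT w ->
  (forall y, 0 <= w y <= M) -> L1_le 0 h ->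
  L1_pair w (L h) = L1_pair (fun x => fine (koopman p f (EFin \o w) x)) h.
Proof.
move=> mw wM h0.
have Mw x : `|w x| <= M by have /andP[? ?] := wM x; rewrite ger0_norm.
have kb x := koopman_bound x mw wM.
have kfin x : koopman p f (EFin \o w) x \is a fin_num.
  by have /andP[k0 k1] := kb x; rewrite ge0_fin_numE// (le_lt_trans k1)// ltry.
have mk : measurable_fun setT (fun x => fine (koopman p f (EFin \o w) x)).
  apply: measurableT_comp => //; apply: measurable_koopman; first exact/measurable_EFinP.
  by move=> x; rewrite lee_fin; case/andP: (wM x).
have kM x : `|fine (koopman p f (EFin \o w) x)| <= M.
  have /andP[k0 k1] := kb x; rewrite ger0_norm ?fine_ge0//.
  by rewrite -lee_fin fineK.
apply: EFin_inj.
rewrite -(integral_L1_measure_pair mw Mw); last exact: (markov_ge0 (annealed_markov ns)).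
rewrite -(integral_L1_measure_pair mk kM)//.
rewrite -(integral_koopman (p := p) (f := f) (nu := L1_measure h)).
- by apply: eq_integral => x _; rewrite fineK.
- by move=> A mA; exact: L1_measure_PF.
- exact/measurable_EFinP.
- by move=> x; rewrite lee_fin; case/andP: (wM x).
Qed.

End koopman_dual.

Section constrictive_FPM.
Context dT (T : measurableType dT) dX (X : measurableType dX) (R : realType).
Variables (p : probability T R) (P : probability (seq_space T) R).
Hypothesis prodP : is_product_measure p P.
Variable m : probability X R.
Variable f : {mfun (T * X)%type >-> X}.
Hypothesis ns : nonsingular_transition p m f.
Local Notation Om := (seq_space T).
Local Notation F := (@skew_product _ T _ X f).
Local Notation L := (annealed_PF p m f).
Local Notation A := (cesaro_mean L).
Let ML := annealed_markov ns.

Lemma density_stationary h (dh : densities h) : L h = h -> stationary p f (density_probability dh).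
Proof.
move=> Lh B mB; have [h0 _] := (densityP h).1 dh.
rewrite /= -[in LHS]Lh (L1_measure_PF ns h0 mB).
have mfB : measurable (f @^-1` B) by rewrite -[X in measurable X]setTI; exact: measurable_funPT.
by rewrite -(product_measure_ysection p (L1_measure h) mfB) product_measure_xsection.
Qed.

Definition L1_restr (B : set X) (h : L1 m) : L1 m := mkL1 m (fun x => \1_B x * L1_fun h x).

Lemma L1_restrE B h : measurable B ->
  {ae m, forall x, L1_fun (L1_restr B h) x = \1_B x * L1_fun h x}.
Proof.
move=> mB; apply: mkL1K; apply: (integrable_pair h (M := 1)); first exact: measurable_indic.
by move=> x; rewrite ger0_norm// indicE lern1 leq_b1.
Qed.

Lemma L1_restr_ge0 B h : measurable B -> L1_le 0 h -> L1_le 0 (L1_restr B h).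
Proof.
move=> mB /L1_le0P h0; apply/L1_le0P.
by apply: filterS2 h0 (L1_restrE h mB) => x hx ->; rewrite mulr_ge0.
Qed.

Lemma L1_measure_restr B h C : measurable B -> measurable C -> L1_le 0 h ->
  L1_measure (L1_restr B h) C = L1_measure h (C `&` B).
Proof.
move=> mB mC h0; rewrite L1_measureE//; last exact: L1_restr_ge0.
rewrite L1_measureE//; last exact: measurableI.
rewrite integral_mkcondr; apply: ae_eq_integral => //.
- by apply: measurable_funTS; apply/measurable_EFinP; exact: measurable_L1.
- apply: measurable_funTS; apply/(measurable_restrictT _ mB); apply: measurable_funTS.
  exact: measurable_int (L1_integrable h).
- apply: filterS (L1_restrE h mB) => x -> _; rewrite patchE indicE.
  by case: ifPn => _; rewrite ?mul1r ?mul0r.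
Qed.

(** Tested on [C], the image of the restricted density counts the steps that start in [B] and end in
    [C]. As [B] is invariant along almost every step, these are the steps ending in both [C] and
    [B], and stationarity gives the mass of the intersection. *)
Lemma restr_fix h (dh : densities h) B : L h = h -> measurable B ->
  {ae (p \x density_probability dh)%E, forall z, B (f z) <-> B z.2} ->
  L (L1_restr B h) = L1_restr B h.
Proof.
move=> Lh mB Binv; have [h0 _] := (densityP h).1 dh.
have k0 := L1_restr_ge0 mB h0.
have mpre C : measurable C -> measurable (f @^-1` C).
  by move=> mC; rewrite -[X in measurable X]setTI; exact: measurable_funPT.
have mpret C t : measurable C -> measurable [set x | C (f (t, x))].
  by move=> mC; rewrite -[X in measurable X]setTI; exact: (measurableT_comp (f := f)).
apply: L1_ext => C mC.
rewrite -!L1_measureE//; last exact: (markov_ge0 ML).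
rewrite (L1_measure_PF ns k0 mC) L1_measure_restr//.
have mfC := mpre C mC.
rewrite -(product_measure_ysection p (L1_measure (L1_restr B h)) mfC) product_measure_xsection.
transitivity ((p \x density_probability dh)%E ((f @^-1` C) `&` (snd @^-1` B))).
  rewrite product_measure_xsection; apply: eq_integral => t _ /=.
  by rewrite (L1_measure_restr mB (mpret C t mC) h0).
have mBs : measurable (snd @^-1` B : set (T * X)).
  by rewrite -[X in measurable X]setTI; exact: measurable_snd.
transitivity ((p \x density_probability dh)%E (f @^-1` (C `&` B))).
  apply: measure_ae_eq.
  - exact: measurableI.
  - by apply: mpre; exact: measurableI.
  - by apply: filterS Binv => z /= Bz; tauto.
have := density_stationary dh Lh (measurableI _ _ mC mB).
by move=> e; rewrite product_measure_xsection; apply/esym/e.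
Qed.

(** An invariant [B] of positive mass cuts out of [h] an invariant function carried by the support
    of [h]. Once normalized it is [h] by extremality, so [h] vanishes off [B]. *)
Lemma extremal_ergodic h (dh : densities h) : L h = h ->
  (forall k, inv_density L k -> {ae m, forall x, L1_fun h x = 0 -> L1_fun k x = 0} -> k = h) ->
  ergodic_stationary p P f (density_probability dh).
Proof.
move=> Lh ext; have [h0 _] := (densityP h).1 dh.
apply: ergodic_criterion => //; first exact: density_stationary.
move=> B mB Binv.
have Lk := restr_fix Lh mB Binv.
have k0 := L1_restr_ge0 mB h0.
have [B0|k_neq0] := pselect (L1_restr B h = 0).
  left; have := L1_measure_restr mB measurableT h0; rewrite setTI B0 => e.
  rewrite -[LHS]/(L1_measure h B) -e.
  rewrite L1_measureE//; last by apply: aeW.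
  rewrite (ae_eq_integral (cst 0%E)) ?integral0//.
    by apply: measurable_int (L1_integrable _).
  by apply: filterS (L1_fun0 m) => x ->.
right.
have := ext _ (inv_density_normalize ML k_neq0 k0 Lk) _ => kh.
have {}kh : `|L1_restr B h|^-1 *: L1_restr B h = h.
  apply: kh; apply: filterS2 (L1_funZ `|L1_restr B h|^-1 (L1_restr B h)) (L1_restrE h mB) => x -> -> ->.
  by rewrite !mulr0.
have hB : {ae m, forall x, ~ B x -> L1_fun h x = 0}.
  have := L1_funZ `|L1_restr B h|^-1 (L1_restr B h); rewrite kh => H.
  apply: filterS2 H (L1_restrE h mB) => x -> -> nB.
  by rewrite indicE memNset// mul0r mulr0.
rewrite -(probability_setT (density_probability dh)) /= !L1_measureE//.
rewrite [LHS]integral_mkcond; apply: ae_eq_integral => //.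
- by apply/(measurable_restrictT _ mB); apply: measurable_funTS; apply: measurable_int (L1_integrable h).
- exact: measurable_int (L1_integrable h).
- apply: filterS hB => x Hx _; rewrite patchE; case: ifPn => // /negP nB.
  by rewrite Hx// => Bx; apply: nB; exact: mem_set.
Qed.

Theorem constrictive_FPM : mean_constrictive L -> FPM p P f m.
Proof.
move=> mc; have [r [g [[gi gd] dec ext]]] := constrictive_decomposition ML mc.
pose mu i := density_probability (gi i).1.
have g0 i : L1_le 0 (g i) by case: (gi i) => /densityP[].
have erg i : ergodic_stationary p P f (mu i).
  by apply: extremal_ergodic; [case: (gi i)|exact: ext].
exists r, mu; split=> //.
- by move=> i; exact: L1_measure_dominated.
- move=> i j ij; have := gd i j ij => gij.
  transitivity (m set0); last exact: measure0.
  apply: measure_ae_eq => //.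
    have mRN k : measurable (density_support m (mu k)).
      have mk : measurable_fun setT (Radon_Nikodym (charge_of_finite_measure (mu k)) m).
        apply: (measurable_int m); apply: Radon_Nikodym_integrable.
        exact: L1_measure_dominated.
      by rewrite -[density_support _ _]setTI; exact: emeasurable_neq.
    exact: measurableI.
  apply: filterS3 gij (density_probability_RN (gi i).1) (density_probability_RN (gi j).1) => x gx ei ej.
  split=> //; rewrite /density_support/= ei ej !eqe => -[/eqP a /eqP b].
  by move/eqP: gx; rewrite mulf_eq0 => /orP[/eqP|/eqP].
move=> psi mpsi [M' [_ HM]].
pose M := `|M' + 1|; have psiM x : `|psi x| <= M.
  apply: le_trans (HM (M' + 1) _ x I) (ler_norm _); by rewrite ltrDl.
pose G : set (Om * X) := \bigcup_i avg_basin f psi (\int[mu i]_x psi x).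
have mG : measurable G.
  apply: fin_bigcup_measurable; first exact: finite_finset.
  by move=> i _; exact: measurable_avg_basin.
have GF : F @^-1` G = G.
  rewrite /G preimage_bigcup; apply: eq_bigcupr => i _.
  exact: (avg_basin_invariant f _ psiM).
suff G1 : (P \x m)%E G = 1%E.
  move: ((ae_product1 P m mG).1 G1); apply: filterS => w <-; congr (m _).
pose N := ~` G; have mN : measurable N by exact: measurableC.
have NF : F @^-1` N = N by rewrite /N -[in RHS]GF.
have PN x : (P [set w | N (w, x)] <= 1)%E by apply: probability_le1; exact: measurable_fiber.
(* The probability that the averages started at [x] converge to none of the candidate limits. *)
pose w x := fine (P [set w | N (w, x)]).
have wE x : (w x)%:E = P [set w | N (w, x)].
  by rewrite fineK// ge0_fin_numE ?measure_ge0// (le_lt_trans (PN x))// ltry.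
have mw : measurable_fun setT w.
  by apply: measurableT_comp => //; exact: measurable_fiber_measure.
have w01 x : 0 <= w x <= 1 by rewrite -!lee_fin wE measure_ge0 PN.
have w1 x : `|w x| <= 1 by have /andP[? ?] := w01 x; rewrite ger0_norm.
have wg : {ae m, forall x, (exists i, L1_fun (g i) x != 0) -> w x = 0}.
  suff H i : {ae m, forall x, L1_fun (g i) x != 0 -> w x = 0}.
    by apply: filterS (ae_forall_ord H) => x Hx [i]; exact: Hx.
  have N0 : (P \x mu i)%E N = 0%E.
    have Gi1 : (P \x mu i)%E G = 1%E.
      apply/eqP; rewrite eq_le; apply/andP; split.
        exact: (@probability_le1 _ _ _ (product_probability P (mu i))).
      rewrite -(ergodic_avg (erg i) mpsi psiM); apply: le_measure.
      - by apply/mem_set; exact: measurable_avg_basin.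
      - exact/mem_set.
      - by move=> z Hz; exists i.
    have := @probability_setC _ _ _ (product_probability P (mu i)) G mG.
    by rewrite [product_probability _ _ G]Gi1 subee.
  have : L1_pair w (g i) = 0.
    apply: EFin_inj; rewrite -(integral_L1_measure_pair mw w1)// -[RHS]N0.
    by rewrite product_measure_ysection//; apply: eq_integral => x _; exact: wE.
  move=> pw0.
  have aeg0 := (L1_le0P (g i)).1 (g0 i).
  have mp : measurable_fun setT (fun x => (w x * L1_fun (g i) x)%:E).
    by apply/measurable_EFinP; apply: measurable_funM => //; exact: measurable_L1.
  have : (\int[m]_x `|(w x * L1_fun (g i) x)%:E| = 0)%E.
    rewrite (ae_eq_integral (fun x => (w x * L1_fun (g i) x)%:E))//.
    - rewrite -(fineK (integrable_fin_num measurableT (integrable_pair (g i) mw w1))).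
      by rewrite -[fine _]/(L1_pair w (g i)) pw0.
    - exact: measurableT_comp.
    - apply: filterS aeg0 => x gx _; rewrite gee0_abs// lee_fin mulr_ge0//.
      by case/andP: (w01 x).
  move/(ae_eq_integral_abs m measurableT mp); apply: filterS => x /(_ I)[] /eqP.
  by rewrite mulf_eq0 => /orP[/eqP//|->].
have Kw x : fine (koopman p f (EFin \o w) x) = w x.
  rewrite (_ : EFin \o w = fun y => P [set w | N (w, y)]); last by apply/funext.
  by rewrite -(fiber_skew_set prodP f x mN) /w -[in RHS]NF.
have pairL h : L1_le 0 h -> L1_pair w (L h) = L1_pair w h.
  move=> h0; rewrite (L1_pair_koopman ns mw w01 h0); congr fine.
  by apply: eq_integral => x _; rewrite Kw.
(* The density of [m] itself: the pairing of [w] with it is the measure of [N]. *)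
pose one := mkL1 m (cst 1).
have oneE : {ae m, forall x, L1_fun one x = 1}.
  by apply: mkL1K; exact: finite_measure_integrable_cst.
have d1 : densities one.
  apply/densityP; split; first by apply/L1_le0P; apply: filterS oneE => x ->.
  rewrite /L1_int (eq_ae_Rintegral (v := cst 1))//; last exact: measurable_L1.
  by rewrite Rintegral_cst//= probability_setT mulr1.
have [one0 _] := (densityP one).1 d1.
have pairA n : (0 < n)%N -> L1_pair w (A n one) = L1_pair w one.
  move=> n0; rewrite /cesaro_mean (L1_pairZ mw w1) (L1_pair_sum mw w1).
  rewrite (eq_bigr (fun=> L1_pair w one)); last first.
    move=> i _; elim: (i : nat) => //= k IH; rewrite pairL//.
    by elim: {IH}k => //= k IH; exact: (markov_ge0 ML).
  by rewrite sumr_const card_ord -(mulr_natl (L1_pair w one)) mulrA mulVf ?mul1r// pnatr_eq0 -lt0n.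
have [Pi iPi cvPi] := constrictive_cvg ML mc d1.
have pairPi : L1_pair w Pi = 0.
  rewrite /L1_pair (eq_ae_Rintegral (v := cst 0))//; first by rewrite Rintegral_cst//= mul0r.
    by apply: measurable_funM => //; exact: measurable_L1.
  apply: filterS2 wg (dec Pi iPi) => x Hw Hd.
  have [H|/existsNP[i gx]] := pselect (forall i, L1_fun (g i) x = 0).
    by rewrite (Hd H) mulr0.
  by rewrite Hw ?mul0r//; exists i; exact/eqP.
have pair1 : L1_pair w one = 0.
  apply/eqP; rewrite -normr_eq0 eq_le normr_ge0 andbT.
  apply/ler_addgt0Pr => e e0; rewrite add0r.
  have [n0 Hn0] := (cvg0_natP _).1 cvPi e e0.
  have := Hn0 (maxn 1 n0) (leq_maxr _ _); rewrite normr_id => He.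
  rewrite -(pairA (maxn 1 n0)) ?leq_max// -[X in `|X|]subr0 -pairPi -(L1_pairB mw w1).
  by apply: le_trans (L1_pair_norm mw w1 _) _; rewrite mul1r ltW.
have N0 : (P \x m)%E N = 0%E.
  rewrite product_measure_ysection// -[RHS]/(0%:E) -pair1 /L1_pair fineK; last first.
    by apply: integrable_fin_num => //; exact: (integrable_pair one mw w1).
  apply: ae_eq_integral => //.
  - exact: measurable_fiber_measure.
  - by apply/measurable_EFinP; apply: measurable_funM => //; exact: measurable_L1.
  - by apply: filterS oneE => x -> _; rewrite mulr1 wE.
rewrite -[G]setCK.
have := @probability_setC _ _ _ (product_probability P m) N mN.
by rewrite [product_probability _ _ N]N0 sube0.
Qed.

End constrictive_FPM.

(** * From (FPM) to mean constrictivity *)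

Section FPM_index.
Context dT (T : measurableType dT) dX (X : measurableType dX) (R : realType).
Variables (p : probability T R) (P : probability (seq_space T) R).
Variable m : probability X R.
Variable f : {mfun (T * X)%type >-> X}.
Variables (r : nat) (mu : 'I_r -> probability X R).
Hypothesis fpm : FPM_family p P f m mu.
Local Notation Om := (seq_space T).
Local Notation F := (@skew_product _ T _ X f).
Local Notation S i := (density_support m (mu i)).

Let dom i : mu i `<< m. Proof. by case: fpm. Qed.

Lemma measurable_RN i : measurable_fun setT (Radon_Nikodym (charge_of_finite_measure (mu i)) m).
Proof. by apply: (measurable_int m); apply: Radon_Nikodym_integrable; exact: dom. Qed.

Lemma measurable_support i : measurable (S i).
Proof. by rewrite -[S i]setTI; apply: emeasurable_neq => //; exact: measurable_RN. Qed.

Lemma support_full i : {ae (mu i), forall x, S i x}.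
Proof.
exists (~` S i); split=> //; first exact/measurableC/measurable_support.
have mC := measurableC (measurable_support i).
have num' : charge_of_finite_measure (mu i) `<< m by exact: dom.
rewrite -[LHS]/(charge_of_finite_measure (mu i) (~` S i)) (Radon_Nikodym_integral num' mC).
rewrite (eq_integral (cst 0%E)) ?integral0// => x /set_mem Sx.
by apply/eqP; apply: contrapT => /negP.
Qed.

Lemma support_disjoint i j : i != j -> {ae (mu j), forall x, ~ S i x}.
Proof.
move=> ij; have [_ _ dis _] := fpm.
have mij := measurableI _ _ (measurable_support i) (measurable_support j).
have n0 : {ae (mu j), forall x, ~ (S i `&` S j) x}.
  exists (S i `&` S j); split=> //; last by move=> x /= /contrapT.
  by have /null_content_dominatesP H := dom j; apply: H => //; exact: dis.
by apply: filterS2 n0 (support_full j) => x n1 s1 s2; apply: n1.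
Qed.

(* The Birkhoff averages of this function reveal which [mu i] governs an orbit. *)
Definition index_fun (x : X) : R := \sum_(i < r) (i : nat)%:R * \1_(S i) x.

Lemma measurable_index_fun : measurable_fun setT index_fun.
Proof.
apply: measurable_sum => i; apply: measurable_funM => //.
exact/measurable_indic/measurable_support.
Qed.

Lemma index_fun_bounded x : `|index_fun x| <= \sum_(i < r) (i : nat)%:R.
Proof.
apply: le_trans (ler_norm_sum _ _ _) _; apply: ler_sum => i _.
by rewrite normrM !ger0_norm// ler_piMr// indicE lern1 leq_b1.
Qed.

Lemma index_fun_ae j : {ae (mu j), forall x, index_fun x = (j : nat)%:R}.
Proof.
have H i : {ae (mu j), forall x, i != j -> ~ S i x}.
  have [->|ij] := eqVneq i j; first by apply: aeW => x.
  by apply: filterS (support_disjoint ij).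
apply: filterS2 (ae_forall_ord H) (support_full j) => x nS Sj.
rewrite /index_fun (bigD1 j)//= indicE mem_set// mulr1 big1 ?addr0// => i ij.
by rewrite indicE memNset ?mulr0//; exact: nS.
Qed.

Lemma index_fun_int j : \int[mu j]_x index_fun x = (j : nat)%:R.
Proof.
rewrite (eq_ae_Rintegral (v := cst (j : nat)%:R))//.
- by rewrite Rintegral_cst//= probability_setT mulr1.
- exact: measurable_index_fun.
- exact: index_fun_ae.
Qed.

Definition index_set (i : 'I_r) : set (Om * X) := avg_basin f index_fun (i : nat)%:R.

Lemma measurable_index_set i : measurable (index_set i).
Proof. by apply: measurable_avg_basin; exact: measurable_index_fun. Qed.

Lemma index_set_inj i j z : index_set i z -> index_set j z -> i = j.
Proof.
move=> zi zj; apply/val_inj/eqP; rewrite -(eqr_nat R); apply/eqP.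
exact: (cvg_unique _ zi zj).
Qed.

Lemma FPM_avg (psi : X -> R) (M : R) : measurable_fun setT psi -> (forall x, `|psi x| <= M) ->
  {ae (P \x m)%E, forall z, exists i, avg_basin f psi (\int[mu i]_x psi x) z}.
Proof.
move=> mpsi psiM; have [_ _ _ H] := fpm.
have mB : measurable (\bigcup_i avg_basin f psi (\int[mu i]_x psi x)).
  apply: fin_bigcup_measurable; first exact: finite_finset.
  by move=> i _; exact: measurable_avg_basin.
have bpsi : bounded_fun psi.
  exists M; split; first exact: num_real.
  by move=> N MN x _; exact: le_trans (psiM x) (ltW MN).
have B1 : (P \x m)%E (\bigcup_i avg_basin f psi (\int[mu i]_x psi x)) = 1%E.
  apply/(ae_product1 P m mB); apply: filterS (H psi mpsi bpsi) => w <-; congr (m _).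
have := (@ae_probability1 _ _ _ (product_probability P m) _ mB).1 B1.
by apply: filterS => z [i _ Hi]; exists i.
Qed.

Lemma index_cover : {ae (P \x m)%E, forall z, exists i, index_set i z}.
Proof.
apply: filterS (FPM_avg measurable_index_fun index_fun_bounded) => z [i].
by rewrite index_fun_int; exists i.
Qed.

Lemma orbit_avg_bounded (psi : X -> R) (M : R) n z : (forall x, `|psi x| <= M) ->
  `|orbit_avg f psi n z| <= M.
Proof.
move=> psiM; have M0 : 0 <= M by exact: le_trans (psiM point).
rewrite /orbit_avg normrM ger0_norm ?invr_ge0//.
have [->|n0] := posnP n; first by rewrite big_ord0 normr0 mulr0.
rewrite ler_pdivrMl ?ltr0n// (le_trans (ler_norm_sum _ _ _))//.
rewrite mulr_natl -[in leRHS](card_ord n) -sumr_const.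
by apply: ler_sum => i _.
Qed.

(* Apply (FPM) to [index_fun + c psi] with [c] so small that the limit of its
   averages still determines the index. *)
Lemma same_index (psi : X -> R) (M : R) : measurable_fun setT psi -> (forall x, `|psi x| <= M) ->
  {ae (P \x m)%E, forall z, forall i, index_set i z -> avg_basin f psi (\int[mu i]_x psi x) z}.
Proof.
move=> mpsi psiM; have M0 : 0 <= M by exact: le_trans (psiM point).
(* With this choice both [c * M] and [c * |\int psi|] are at most [1 / 4], so the two indices [i]
   and [j] below differ by at most [1 / 2]. *)
pose c := (4 * (M + 1))^-1; have c0 : 0 < c by rewrite invr_gt0 mulr_gt0// ltr_wpDl.
have cM : c * M <= 4^-1.
  by rewrite /c mulrC ler_pdivrMr ?mulr_gt0 ?ltr_wpDl//; lra.
pose phi x := index_fun x + c * psi x.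
have mphi : measurable_fun setT phi.
  by apply: measurable_funD; [exact: measurable_index_fun|exact: measurable_funM].
have phiM x : `|phi x| <= \sum_(i < r) (i : nat)%:R + c * M.
  rewrite (le_trans (ler_normD _ _))// lerD ?index_fun_bounded// normrM (gtr0_norm c0).
  by rewrite ler_pM2l.
have intM i : `|\int[mu i]_x psi x| <= M.
  apply: le_trans (le_normr_Rintegral _ _) _ => //.
    exact: (integrable_bounded (mu i) mpsi psiM).
  apply: le_trans (_ : \int[mu i]_x cst M x <= _).
    apply: le_Rintegral => //.
    - by have := integrable_bounded (mu i) mpsi psiM; exact: integrable_abse.
    - exact: finite_measure_integrable_cst.
  by rewrite Rintegral_cst//= probability_setT mulr1.
have intphi i : \int[mu i]_x phi x = (i : nat)%:R + c * \int[mu i]_x psi x.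
  rewrite /phi RintegralD//.
  - rewrite index_fun_int RintegralZl//; exact: (integrable_bounded (mu i) mpsi psiM).
  - exact: (integrable_bounded (mu i) measurable_index_fun index_fun_bounded).
  - apply: (integrable_bounded (M := c * M) (mu i)); first exact: measurable_funM.
    by move=> x; rewrite normrM (gtr0_norm c0) ler_pM2l.
apply: filterS (FPM_avg mphi phiM) => z [j Hj] i Hi.
(* The averages of [phi] minus those of [index_fun] are [c] times those of [psi]. The resulting
   limit involves both [j] and [i], and its bound by [M] forces them to agree. *)
have Hpsi : orbit_avg f psi n z @[n --> \oo] --> c^-1 * (((j : nat)%:R + c * \int[mu j]_x psi x) - (i : nat)%:R).
  rewrite (_ : (fun n => _) = fun n => c^-1 * (orbit_avg f phi n z - orbit_avg f index_fun n z)).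
    apply: cvgMl_tmp; apply: cvgB => //; by rewrite -intphi.
  apply/funext => n; rewrite /orbit_avg -mulrBr -sumrB mulrCA; congr (_ * _).
  rewrite mulr_sumr; apply: eq_bigr => k _; rewrite /phi addrC addKr mulrA mulVf ?mul1r//.
  by rewrite gt_eqF.
have : `|c^-1 * (((j : nat)%:R + c * \int[mu j]_x psi x) - (i : nat)%:R)| <= M.
  rewrite -(cvg_lim _ (cvg_norm Hpsi))//; apply: limr_le.
    by apply/cvg_ex; eexists; exact: cvg_norm Hpsi.
  by apply: nearW => n; exact: orbit_avg_bounded.
have ci0 : 0 < c^-1 by rewrite invr_gt0.
rewrite normrM (gtr0_norm ci0) ler_pdivrMl// => Hle.
suff ij : j = i.
  by move: Hpsi; rewrite ij addrAC subrr add0r mulrA mulVf ?gt_eqF// mul1r.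
have cI : `|c * \int[mu j]_x psi x| <= 4^-1.
  by rewrite normrM (gtr0_norm c0) (le_trans _ cM)// ler_pM2l.
have : `|(j : nat)%:R - (i : nat)%:R : R| < 1.
  move: Hle cI; rewrite !ler_norml ltr_norml.
  move: (c * M) (c * \int[mu j]_x psi x) cM => a b h /andP[h1 h2] /andP[h3 h4].
  by apply/andP; split; lra.
move=> ji; apply/val_inj/eqP; apply: contraT; rewrite neq_ltn => /orP[] lt;
  move: ji; rewrite ltr_norml => /andP[]; move: lt; rewrite -(ler_nat R) -natr1; lra.
Qed.

End FPM_index.

Lemma continuous_lincomb (R : realType) (V : normedModType R) n (g : 'I_n -> V) :
  continuous (fun v : 'rV[R]_n => \sum_(i < n) v ord0 i *: g i).
Proof.
move=> v; elim: (index_enum _) => [|i s IH].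
  rewrite (_ : (fun _ => _) = cst 0); first exact: cst_continuous.
  by apply/funext => u; rewrite big_nil.
rewrite (_ : (fun _ => _) = fun u : 'rV[R]_n => u ord0 i *: g i + \sum_(j <- s) u ord0 j *: g j).
  exact: (@cvgD _ _ _ _ _ _ _ _ _ (@cvgZr_tmp _ _ _ _ _ _ _ (g i) (@coord_continuous _ _ _ ord0 i v)) IH).
by apply/funext => u; rewrite big_cons.
Qed.

(** * Weak and strong limits of the Cesaro means under (FPM) *)

Section FPM_constrictive.
Context dT (T : measurableType dT) dX (X : measurableType dX) (R : realType).
Variables (p : probability T R) (P : probability (seq_space T) R).
Hypothesis prodP : is_product_measure p P.
Variable m : probability X R.
Variable f : {mfun (T * X)%type >-> X}.
Hypothesis ns : nonsingular_transition p m f.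
Variables (r : nat) (mu : 'I_r -> probability X R).
Hypothesis fpm : FPM_family p P f m mu.
Local Notation Om := (seq_space T).
Local Notation F := (@skew_product _ T _ X f).
Local Notation L := (annealed_PF p m f).
Local Notation A := (cesaro_mean L).
Let ML := annealed_markov ns.
Let dom i : mu i `<< m. Proof. by case: fpm. Qed.
Let domc i : charge_of_finite_measure (mu i) `<< m. Proof. exact: dom. Qed.

Definition FPM_density i : L1 m := mkL1 m (fine \o Radon_Nikodym (charge_of_finite_measure (mu i)) m).
Local Notation g := FPM_density.

Lemma FPM_densityE i : {ae m, forall x,
  (L1_fun (g i) x)%:E = Radon_Nikodym (charge_of_finite_measure (mu i)) m x}.
Proof.
have finRN x : Radon_Nikodym (charge_of_finite_measure (mu i)) m x \is a fin_num.
  exact: Radon_Nikodym_fin_num (domc i).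
have iu : m.-integrable setT (EFin \o (fine \o Radon_Nikodym (charge_of_finite_measure (mu i)) m)).
  by apply: eq_integrable (Radon_Nikodym_integrable (domc i)) => // x _; rewrite /= fineK.
by apply: filterS (mkL1K iu) => x -> /=; rewrite fineK.
Qed.

Lemma FPM_density_integral i B : measurable B ->
  (\int[m]_(x in B) (L1_fun (g i) x)%:E = mu i B)%E.
Proof.
move=> mB; rewrite -[RHS]/(charge_of_finite_measure (mu i) B) (Radon_Nikodym_integral (domc i) mB).
apply: ae_eq_integral => //.
- by apply: measurable_funTS; apply/measurable_EFinP; exact: measurable_L1.
- by apply: measurable_funTS; exact: measurable_int (Radon_Nikodym_integrable (domc i)).
- by apply: filterS (FPM_densityE i).
Qed.

Lemma FPM_density_ge0 i : L1_le 0 (g i).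
Proof.
by apply: L1_ge0_integral => B mB; rewrite FPM_density_integral.
Qed.

Lemma L1_measure_FPM i B : measurable B -> L1_measure (g i) B = mu i B.
Proof. by move=> mB; rewrite L1_measureE// ?FPM_density_integral//; exact: FPM_density_ge0. Qed.

Lemma FPM_density_fix i : L (g i) = g i.
Proof.
have [erg _ _ _] := fpm; have [st _] := erg i.
apply: L1_ext => B mB; have g0 := FPM_density_ge0 i.
rewrite -!L1_measureE//; last exact: (markov_ge0 ML).
rewrite (L1_measure_PF ns g0 mB) L1_measure_FPM// (stationary_transition st mB).
by apply: eq_measure_integral => C mC _; exact: L1_measure_FPM.
Qed.

Lemma FPM_pair i (w : X -> R) (M : R) : measurable_fun setT w -> (forall x, `|w x| <= M) ->
  \int[mu i]_x w x = L1_pair w (g i).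
Proof.
move=> mw wM; rewrite /Rintegral -[RHS]/(fine (L1_pair w (g i))%:E); congr fine.
rewrite -(integral_L1_measure_pair mw wM); last exact: FPM_density_ge0.
by apply: eq_measure_integral => B mB _; apply/esym; exact: L1_measure_FPM.
Qed.

Lemma L1_measure_iter (k : L1 m) n (u : Om * X -> \bar R) : L1_le 0 k ->
  measurable_fun setT u -> (forall z, 0 <= u z)%E ->
  (\int[P \x L1_measure k]_z u (iter n F z) = \int[P \x L1_measure (iter n L k)]_z u z)%E.
Proof.
move=> k0 mu' u0; elim: n k k0 => [|n IH] k k0; first by apply: eq_integral.
rewrite (iterSr n L k); apply: etrans (IH (L k) (markov_ge0 ML k0)).
have mFn : measurable_fun setT (u \o iter n F).
  by apply: measurableT_comp => //; exact: measurable_iter_skew.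
have img := ge0_integral_image (P \x L1_measure k)%E (measurable_skew f) mFn (fun z => u0 _).
transitivity (\int[P \x L1_measure k]_z (u \o iter n F) (F z))%E.
  by apply: eq_integral => z _; rewrite (iterSr n F z).
apply: etrans (esym img) _; apply: eq_measure_integral => E mE _.
exact: (skew_measure prodP (fun B mB => L1_measure_PF ns k0 mB) mE).
Qed.

(** [iter j L h] is the density of the position at time [j] of an orbit started with density [h];
    pairings with Cesaro means thereby become integrals of orbit averages. *)
Lemma L1_pair_orbit (h : L1 m) (dh : densities h) (w : X -> R) (M : R) j : measurable_fun setT w ->
  (forall x, 0 <= w x <= M) ->
  \int[product_probability P (density_probability dh)]_z w (random_orbit f z.1 j z.2)
    = L1_pair w (iter j L h).
Proof.
move=> mw wM; have [h0 _] := (densityP h).1 dh.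
have Mw x : `|w x| <= M by have /andP[? ?] := wM x; rewrite ger0_norm.
have itn0 : L1_le 0 (iter j L h) by elim: j => //= j; exact: (markov_ge0 ML).
rewrite /Rintegral -[RHS]/(fine (L1_pair w (iter j L h))%:E); congr fine.
rewrite -(integral_L1_measure_pair mw Mw itn0).
transitivity (\int[P \x L1_measure h]_z (((EFin \o w) \o snd) (iter j F z)))%E.
  by apply: eq_integral => -[om x] _ /=; rewrite iter_skew.
have msnd : measurable_fun setT ((EFin \o w) \o snd : Om * X -> \bar R).
  apply: measurableT_comp; first exact/measurable_EFinP.
  exact: measurable_snd.
rewrite L1_measure_iter//; last by move=> z; rewrite lee_fin; case/andP: (wM z.2).
rewrite (@fubini_tonelli1 _ _ _ _ _ P _ ((EFin \o w) \o snd))//; last first.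
  by move=> z; rewrite lee_fin; case/andP: (wM z.2).
by rewrite /fubini_F/= integral_cst//= probability_setT mule1.
Qed.

(** For almost every [omega] the section of the exceptional set is [m]-null, hence null for the
    measure with density [h]. *)
Lemma dominated_ae (h : L1 m) (dh : densities h) (E : set (Om * X)) : measurable E ->
  {ae (P \x m)%E, forall z, E z} ->
  {ae (product_probability P (density_probability dh)), forall z, E z}.
Proof.
move=> mE H; apply: (ae_probability1 (product_probability P (density_probability dh)) mE).1.
have E1 : (P \x m)%E E = 1%E by apply/(ae_probability1 (product_probability P m) mE).
have mC : measurable (~` E) by exact: measurableC.
have E0 : (P \x m)%E (~` E) = 0%E.
  by have := @probability_setC _ _ _ (product_probability P m) E mE; rewrite [product_probability P m E]E1 subee.
have aeE : {ae P, forall w, m [set x | (~` E) (w, x)] = 0%E}.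
  have : (\int[P]_w `|m [set x | (~` E) (w, x)]| = 0)%E.
    by rewrite -[RHS]E0 product_measure_xsection; apply: eq_integral => y _; rewrite gee0_abs.
  move/(ae_eq_integral_abs P measurableT (measurable_fiberx_measure m mC)).
  by apply: filterS => w /(_ I).
have E0' : (P \x L1_measure h)%E (~` E) = 0%E.
  rewrite product_measure_xsection (ae_eq_integral (cst 0%E)) ?integral0//.
    exact: (measurable_fiberx_measure (L1_measure h) mC).
  apply: filterS aeE => w Hw _.
  have /null_content_dominatesP D := L1_measure_dominated h.
  by apply: D => //; exact: measurable_fiberx.
rewrite -[E]setCK.
have := @probability_setC _ _ _ (product_probability P (density_probability dh)) _ mC.
by rewrite [product_probability P (density_probability dh) (~` E)]E0' sube0.
Qed.

Section limit.
Variable h : L1 m.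
Hypothesis dh : densities h.
Let nu := product_probability P (density_probability dh).

(** The probability that an orbit started with density [h] is governed by [mu i]; it becomes the
    coefficient of [g i] in the limit. *)
Definition index_weight i : R := fine (nu (index_set m f mu i)).
Local Notation lam := index_weight.

Lemma index_weight01 i : 0 <= lam i <= 1.
Proof.
have mi := measurable_index_set fpm i.
have l1 := @probability_le1 _ _ _ nu _ mi.
by rewrite fine_ge0 ?measure_ge0//= -lee_fin fineK// fin_num_measure.
Qed.

Definition FPM_limit : L1 m := \sum_(i < r) lam i *: g i.

(** The pairing with [A n h] is the integral of the orbit averages. These converge boundedly to the
    step function whose value on the set of index [i] is the [mu i]-integral of [w]. *)
Lemma weak_limit_ge0 (w : X -> R) (M : R) : measurable_fun setT w ->
  (forall x, 0 <= w x <= M) -> L1_pair w (A n h) @[n --> \oo] --> L1_pair w FPM_limit.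
Proof.
move=> mw wM.
have Mw x : `|w x| <= M by have /andP[? ?] := wM x; rewrite ger0_norm.
have mI i := measurable_index_set fpm i.
have pairA n : L1_pair w (A n h) = \int[nu]_z orbit_avg f w n z.
  have io j : nu.-integrable setT (EFin \o (fun z => w (random_orbit f z.1 j z.2))).
    apply: (integrable_bounded (M := M)) => //.
    by apply: measurableT_comp => //; exact: measurable_orbit.
  rewrite /cesaro_mean (L1_pairZ mw Mw) (L1_pair_sum mw Mw) /orbit_avg RintegralZl//; last first.
    exact: integrable_sumR (fun j => io j).
  congr (_ * _); rewrite (Rintegral_sum (fun j : 'I_n => io j)).
  by apply: eq_bigr => j _; rewrite -(L1_pair_orbit dh j mw wM).
pose lim z := \sum_(i < r) L1_pair w (g i) * \1_(index_set m f mu i) z.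
have mlim : measurable_fun setT lim.
  by apply: measurable_sum => i; apply: measurable_funM => //; exact: measurable_indic.
have limE : L1_pair w FPM_limit = \int[nu]_z lim z.
  have ii i : nu.-integrable setT (EFin \o (fun z => L1_pair w (g i) * \1_(index_set m f mu i) z)).
    apply: (integrable_bounded (M := `|L1_pair w (g i)|)); first exact: measurable_funM.
    by move=> z; rewrite normrM [X in _ * X]ger0_norm// ler_piMr// indicE lern1 leq_b1.
  rewrite /FPM_limit (L1_pair_sum mw Mw) (Rintegral_sum ii).
  apply: eq_bigr => i _; rewrite (L1_pairZ mw Mw) RintegralZl//; last exact: integrable_indic.
  by rewrite /Rintegral integral_indic// setIT mulrC.
have cvlim : {ae nu, forall z, orbit_avg f w n z @[n --> \oo] --> lim z}.
  (* The limit depends on [z], so convergence is expressed as convergence of the difference to the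
     constant [0], to which [measurable_cvg_set] applies. *)
  have mset : measurable [set z | orbit_avg f w n z - lim z @[n --> \oo] --> (0:R)].
    apply: measurable_cvg_set => n; apply: measurable_funB => //; exact: measurable_orbit_avg.
  suff H : {ae (P \x m)%E, forall z, [set z | orbit_avg f w n z - lim z @[n --> \oo] --> (0:R)] z}.
    apply: filterS (dominated_ae dh mset H) => z /= Hz.
    rewrite (_ : (fun n => _) = fun n => (orbit_avg f w n z - lim z) + lim z).
      by rewrite -[X in _ --> X]add0r; apply: cvgD => //; exact: cvg_cst.
    by apply/funext => n; rewrite subrK.
  apply: filterS2 (index_cover fpm) (same_index fpm mw Mw) => z [i zi] /(_ i zi).
  rewrite (FPM_pair i mw Mw) /avg_basin/= => cz.
  have -> : lim z = L1_pair w (g i).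
    rewrite /lim (bigD1 i)//= indicE mem_set// mulr1 big1 ?addr0// => j ji.
    rewrite indicE memNset ?mulr0// => zj; move/eqP: ji; apply.
    exact: index_set_inj zj zi.
  rewrite -[X in _ --> X](subrr (L1_pair w (g i))); apply: cvgB => //; exact: cvg_cst.
rewrite (_ : (fun n => _) = fun n => \int[nu]_z orbit_avg f w n z); last exact/funext.
rewrite limE.
have [|||||_ _ cv] := @dominated_convergence _ _ _ nu setT measurableT
  (fun n => EFin \o orbit_avg f w n) (EFin \o lim) (EFin \o cst M).
- by move=> n; apply/measurable_EFinP; exact: measurable_orbit_avg.
- exact/measurable_EFinP.
- by apply: filterS cvlim => z Hz _; apply: cvg_EFin => //; exact: nearW.
- exact: finite_measure_integrable_cst.
- by apply: aeW => z n _; rewrite /= lee_fin; exact: orbit_avg_bounded.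
apply: fine_cvg; rewrite [X in _ --> X]fineK; first exact: cv.
apply: integrable_fin_num => //.
apply: (integrable_bounded (M := \sum_(i < r) `|L1_pair w (g i)|)) => // z.
apply: le_trans (ler_norm_sum _ _ _) _; apply: ler_sum => i _.
by rewrite normrM [X in _ * X]ger0_norm// ler_piMr// indicE lern1 leq_b1.
Qed.

Lemma weak_limit (w : X -> R) (M : R) : measurable_fun setT w ->
  (forall x, `|w x| <= M) -> L1_pair w (A n h) @[n --> \oo] --> L1_pair w FPM_limit.
Proof.
move=> mw wM; have M0 : 0 <= M by exact: le_trans (wM point).
have pairE (k : L1 m) : L1_pair w k = L1_pair (fun x => w x + M) k - L1_pair (cst M) k.
  rewrite /L1_pair -RintegralB//.
  - by apply: eq_Rintegral => x _; rewrite mulrDl addrK.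
  - apply: (integrable_pair k (M := M + M)); first exact: measurable_funD.
    by move=> x; rewrite (le_trans (ler_normD _ _))// lerD// ger0_norm.
  - by apply: (integrable_pair k (M := M)) => // x; rewrite ger0_norm.
rewrite pairE (_ : (fun n => _) = fun n => L1_pair (fun x => w x + M) (A n h) - L1_pair (cst M) (A n h)).
  apply: cvgB.
    apply: (weak_limit_ge0 (M := M + M)); first exact: measurable_funD.
    by move=> x; have := wM x; rewrite ler_norml => /andP[? ?]; apply/andP; split; lra.
  by apply: (weak_limit_ge0 (M := M)) => // x; rewrite M0 lexx.
by apply/funext => n; rewrite pairE.
Qed.

(** Weak convergence enters twice: it makes the mass of the means off the supports vanish, as
    [cesaro_cauchy] asks, and it identifies the limit of the Cauchy sequence. *)
Lemma FPM_strong_limit : `|A n h - FPM_limit| @[n --> \oo] --> 0.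
Proof.
have [h0 _] := (densityP h).1 dh.
pose G : L1 m := \sum_(i < r) g i.
have G0 : L1_le 0 G by apply: L1_le0_sum => i; exact: FPM_density_ge0.
have LG : L G = G.
  rewrite /G (lin_op_sum (markovD ML) (markovZ ML)).
  by apply: eq_bigr => i _; exact: FPM_density_fix.
have cau : cauchy_means L h.
  apply: (cesaro_cauchy ML G0 LG h0) => e e0.
  (* The indicator of the zero set of [G], where every [g i] vanishes and with it the weak limit. *)
  pose w x : R := (L1_fun G x == 0)%:R.
  have mw : measurable_fun setT w.
    rewrite (_ : w = fun x => if L1_fun G x == 0 then 1 else 0).
      apply: measurable_fun_ifT => //; apply: measurable_fun_eqr => //; exact: measurable_L1.
    by apply/funext => x; rewrite /w; case: eqP.
  have w1 x : `|w x| <= 1 by rewrite ger0_norm// lern1 leq_b1.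
  have offE (k : L1 m) : L1_int (L1_off G k) = L1_pair w k.
    apply: eq_ae_Rintegral; first exact: measurable_L1.
      by apply: measurable_funM => //; exact: measurable_L1.
    by apply: filterS (L1_offE G k) => x ->; rewrite /w; case: eqP; rewrite ?mul1r ?mul0r.
  have lim0 : L1_pair w FPM_limit = 0.
    rewrite /FPM_limit (L1_pair_sum mw w1) big1// => i _; rewrite (L1_pairZ mw w1).
    rewrite /L1_pair (eq_ae_Rintegral (v := cst 0)) ?Rintegral_cst ?mul0r ?mulr0//.
      by apply: measurable_funM => //; exact: measurable_L1.
    have aeg j : {ae m, forall x, 0 <= L1_fun (g j) x} by apply/L1_le0P; exact: FPM_density_ge0.
    apply: filterS2 (L1_fun_sum (fun i => g i)) (ae_forall_ord aeg) => x Gx gx.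
    rewrite /w /G Gx; case: eqP => [/psumr_eq0P H|]; last by rewrite mul0r.
    by rewrite H ?mulr0// => j _; exact: gx.
  have := weak_limit mw w1; rewrite lim0 => /(cvg0_natP _)/(_ e e0)[N HN].
  exists (maxn 1 N); first by rewrite leq_max.
  rewrite offE; apply: le_lt_trans (ler_norm _) (HN _ _); exact: leq_maxr.
apply/cvg0_natP => e e0; have e2 : 0 < e / 2 by rewrite divr_gt0.
have [N HN] := cau _ e2; exists N => n Nn; rewrite normr_id.
set k := A n h - FPM_limit.
(* A bounded test function whose pairing with [k] is the norm of [k]; this pairing is a limit in [j]
   of quantities bounded by [|A n h - A j h|]. *)
pose s x := Num.sg (L1_fun k x).
have ms : measurable_fun setT s.
  rewrite (_ : s = fun x => if 0 < L1_fun k x then 1 else if L1_fun k x == 0 then 0 else -1).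
    apply: measurable_fun_ifT => //; first by apply: measurable_fun_ltr => //; exact: measurable_L1.
    apply: measurable_fun_ifT => //; apply: measurable_fun_eqr => //; exact: measurable_L1.
  apply/funext => x; rewrite /s; case: ltP => [/gtr0_sg//|].
  by rewrite le_eqVlt; case: eqP => [-> _|_ /= /ltr0_sg//]; rewrite sgr0.
have s1 x : `|s x| <= 1 by rewrite /s normr_sg; case: (_ != _).
have -> : `|k| = L1_pair s k.
  by rewrite L1_normE; apply: eq_Rintegral => x _; rewrite normrEsg.
have cvk : L1_pair s (A n h - A j h) @[j --> \oo] --> L1_pair s k.
  rewrite (L1_pairB ms s1) (_ : (fun j => _) = fun j => L1_pair s (A n h) - L1_pair s (A j h)).
    by apply: cvgB; [exact: cvg_cst|exact: weak_limit ms s1].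
  by apply/funext => j; rewrite (L1_pairB ms s1).
apply: (@le_lt_trans _ _ (e / 2)); last by rewrite ltr_pdivrMr// ltr_pMr// ltr1n.
rewrite -(cvg_lim _ cvk)//; apply: limr_le; first by apply/cvg_ex; exists (L1_pair s k).
exists N => // j /= Nj; apply: le_trans (ler_norm _) _.
by apply: le_trans (L1_pair_norm ms s1 _) _; rewrite mul1r ltW// HN.
Qed.

End limit.

(** The weights of every limit lie in [[0, 1]], so all limits belong to the image of one cube under
    a continuous linear map, whatever the density. *)
Theorem FPM_constrictive : mean_constrictive L.
Proof.
pose comb (v : 'rV[R]_r) : L1 m := \sum_(i < r) v ord0 i *: g i.
pose C := [set v : 'rV[R]_r | forall i, `[0, 1]%classic (v ord0 i)].
exists (comb @` C); split.
  apply: continuous_compact; last exact: (@rV_compact R r (fun=> `[0, 1]%classic) (fun i => @segment_compact R 0 1)).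
  apply: continuous_subspaceT; exact: continuous_lincomb.
move=> h dh.
have inC : (comb @` C) (FPM_limit dh).
  exists (\row_i index_weight dh i).
    by move=> i /=; rewrite mxE in_itv/=; exact: index_weight01.
  by apply: eq_bigr => i _; rewrite mxE.
have cv := FPM_strong_limit dh.
apply: (@squeeze_cvge _ _ _ _ (cst 0%E) _ (fun n => (`|A n h - FPM_limit dh|)%:E)).
- apply: nearW => n; apply/andP; split.
    by apply: le_ereal_inf_tmp => _ [psi _ <-]; rewrite lee_fin.
  by apply: ereal_inf_lbound; exists (FPM_limit dh).
- exact: cvg_cst.
- by apply: cvg_EFin => //; exact: nearW.
Qed.

End FPM_constrictive.

(** * Weak* basins *)

Section test_functions.
Context (R : realType) (X : ptopologicalType).

Lemma continuous_measurable_borel (phi : X -> R) : continuous phi ->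
  measurable_fun [set: borel X] (phi : borel X -> R).
Proof.
move=> cphi; refine (@measurability _ _ (borel X) R setT phi (@RGenOInfty.G R) _ _).
  exact: RGenOInfty.measurableE.
move=> _ [_ [a ->] <-]; rewrite setTI; apply: sub_sigma_algebra.
by apply: open_comp; [move=> x _; exact: cphi|exact: interval_open].
Qed.

Lemma cvg_maxr (Y : Type) (F : set_system Y) (FF : Filter F) (u v : Y -> R) (a b : R) :
  u y @[y --> F] --> a -> v y @[y --> F] --> b -> Num.max (u y) (v y) @[y --> F] --> Num.max a b.
Proof.
move=> ua vb; rewrite maxr_absE (_ : (fun y => Num.max (u y) (v y)) =
  fun y => (u y + v y + `|u y - v y|) / 2); last by apply/funext => y; rewrite maxr_absE.
by apply: cvgMl; apply: cvgD; [exact: cvgD|apply: cvg_norm; exact: cvgB].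
Qed.

Variables (M : metricType R) (g : X -> M).
Hypothesis cg : continuous g.

Lemma metric_1lip (a x y : M) : `|mdist a x - mdist a y| <= mdist x y.
Proof.
rewrite ler_norml; have := metric_triangle a x y; have := metric_triangle a y x.
by rewrite (metric_sym y x) => h1 h2; apply/andP; split; lra.
Qed.

Lemma continuous_mdist (a : M) : continuous (fun x : X => mdist a (g x)).
Proof.
move=> x; apply/cvgrPdist_lt => e e0.
have H : nbhs x (g @^-1` ball (g x) e) by apply: (@cg x); exact: nbhsx_ballx.
apply: (filterS _ H) => y; rewrite /= ballEmdist /= => h.
exact: le_lt_trans (metric_1lip _ _ _) h.
Qed.

Variable s : nat -> X.

(** The absolute value makes the slope nonnegative for every rational, so that the hats are indexed
    by a whole countable type. *)
Definition hat (k : nat * (rat * rat)) (x : X) : R :=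
  Num.max 0 (ratr k.2.1 - `|ratr k.2.2| * mdist (g (s k.1)) (g x)).

Definition max_hat (t : seq (nat * (rat * rat))) (x : X) : R :=
  foldr (fun k v => Num.max (hat k x) v) 0 t.

Lemma hat_ge0 k x : 0 <= hat k x. Proof. by rewrite le_max lexx. Qed.

Lemma max_hat_ge0 t x : 0 <= max_hat t x.
Proof. by case: t => //= k t; rewrite le_max hat_ge0. Qed.

Lemma continuous_hat k : continuous (hat k).
Proof.
move=> x; rewrite /hat; apply: cvg_maxr; first exact: cvg_cst.
apply: cvgB; first exact: cvg_cst.
by apply: cvgMl_tmp; exact: continuous_mdist.
Qed.

Lemma continuous_max_hat t : continuous (max_hat t).
Proof.
elim: t => [|k t IH] x; first exact: cst_continuous.
by rewrite /=; apply: cvg_maxr; [exact: continuous_hat|exact: IH].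
Qed.

Definition max_hat_bound (t : seq (nat * (rat * rat))) : R :=
  foldr (fun k v => Num.max `|ratr k.2.1| v) 0 t.

Lemma max_hat_bounded t x : `|max_hat t x| <= max_hat_bound t.
Proof.
rewrite ger0_norm ?max_hat_ge0//; elim: t => //= k t IH.
rewrite ge_max !le_max IH orbT andbT; apply/orP; left.
rewrite /hat ge_max normr_ge0/=; apply: le_trans (ler_norm _).
by rewrite gerBl mulr_ge0// mdist_ge0.
Qed.

Variable g' : M -> X.
Hypotheses (gK : cancel g g') (cg' : continuous g').

Lemma mdist_nbhs (x : X) (U : set X) : nbhs x U ->
  exists2 e : R, 0 < e & forall y, mdist (g x) (g y) < e -> U y.
Proof.
move=> Ux; have : nbhs (g x) (g' @^-1` U) by apply: (@cg' (g x)); rewrite gK.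
move/nbhs_ballP => [e /= e0 He]; exists e => // y xy.
by have := He (g y); rewrite ballEmdist/= gK; apply.
Qed.

Hypothesis sdense : forall (x : X) (U : set X), nbhs x U -> exists k, U (s k).

(** For [v >= 0], a rational height [a] is taken between [v] and [phi x]; a steep slope confines the
    hat to a ball where [phi > a], and a centre near [x] keeps its value at [x] above [v]. *)
Lemma hat_approx (phi : X -> R) (x : X) (v : R) : continuous phi -> (forall y, 0 <= phi y) ->
  v < phi x -> exists2 k, (forall y, hat k y <= phi y) & v < hat k x.
Proof.
move=> cphi phi0 vx; have [v0|v0] := ltP v 0.
  exists (0%N, (0, 0)) => [y|]; last exact: lt_le_trans v0 (hat_ge0 _ _).
  by rewrite /hat/= rmorph0 normr0 mul0r subrr maxxx.
have /rat_in_itvoo[a] := vx; rewrite in_itv/= => /andP[va ax].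
have a0 : 0 < ratr a :> R by exact: le_lt_trans va.
have : nbhs x [set y | ratr a < phi y].
  exact: (cvgr_gt _ (cphi x) _ ax).
move=> /mdist_nbhs[e e0 He].
have : 2 * ratr a / e < 2 * ratr a / e + 1 by rewrite ltrDl.
move=> /rat_in_itvoo[b]; rewrite in_itv/= => /andP[ab _].
have b0 : 0 < ratr b :> R by apply: lt_trans ab; rewrite divr_gt0// mulr_gt0.
(* The slope gives the hat a radius below [e / 2], so a centre within [e / 2] of [x] keeps it in the
   ball of radius [e]; the second bound limits the loss of height at [x] to less than [a - v]. *)
pose dl := Num.min (e / 2) ((ratr a - v) / ratr b).
have dl0 : 0 < dl by rewrite lt_min; apply/andP; split; apply: divr_gt0; rewrite ?subr_gt0.
have nU : nbhs x [set y | mdist (g x) (g y) < dl].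
  have H : nbhs x (g @^-1` ball (g x) dl) by apply: (@cg x); exact: nbhsx_ballx.
  by apply: (filterS _ H) => y; rewrite /= ballEmdist.
have [n /= Hn] := sdense nU.
have [d1 d2] : dl <= e / 2 /\ dl <= (ratr a - v) / ratr b by rewrite !ge_min !lexx orbT.
exists (n, (a, b)) => [y|]; rewrite /hat/= (gtr0_norm b0).
  have [h|h] := ltP 0 (ratr a - ratr b * mdist (g (s n)) (g y)); last exact: phi0.
  apply: le_trans (ltW (He y _)); first by rewrite gerBl mulr_ge0 ?mdist_ge0 ?ltW.
  apply: le_lt_trans (metric_triangle _ (g (s n)) _) _.
  have h1 : mdist (g (s n)) (g y) < e / 2.
    rewrite -(ltr_pM2l b0); move: h; rewrite subr_gt0 => h; apply: lt_trans h _.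
    by rewrite mulrA ltr_pdivlMr// mulrC -ltr_pdivrMr.
  by rewrite (splitr e) ltrD// (lt_le_trans Hn).
rewrite lt_max; apply/orP; right; rewrite ltrBrDl -ltrBrDr metric_sym mulrC -ltr_pdivlMr//.
exact: lt_le_trans Hn d2.
Qed.

(** Term [n] collects, among the first [n] codes of hats, those lying below [phi]; by [hat_approx]
    every level below [phi y] is eventually passed at [y]. *)
Lemma max_hat_approx (phi : X -> R) : continuous phi -> (forall y, 0 <= phi y) ->
  exists t : nat -> seq (nat * (rat * rat)), (forall n y, max_hat (t n) y <= phi y) /\
    forall y, max_hat (t n) y @[n --> \oo] --> phi y.
Proof.
move=> cphi phi0.
pose ok k := `[< forall y, hat k y <= phi y >].
pose t n := [seq k <- pmap (@choice.unpickle (nat * (rat * rat))%type) (iota 0 n) | ok k].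
exists t; split=> [n y|y].
  rewrite /t; elim: (pmap _ _) => [|k u IH] /=; first exact: phi0.
  by case: ifP => //= /asboolP Hk; rewrite ge_max Hk IH.
have le n : max_hat (t n) y <= phi y.
  rewrite /t; elim: (pmap _ _) => [|k u IH] /=; first exact: phi0.
  by case: ifP => //= /asboolP Hk; rewrite ge_max Hk IH.
apply/cvgrPdist_lt => e e0.
have [k Hk kx] : exists2 k, (forall z, hat k z <= phi z) & phi y - e < hat k y.
  by apply: hat_approx => //; rewrite gtrBl.
exists (choice.pickle k).+1 => // n /= kn.
rewrite ger0_norm ?subr_ge0 ?le// ltrBlDl -ltrBlDr.
apply: lt_le_trans kx _.
have : k \in t n.
  rewrite mem_filter; apply/andP; split; first exact/asboolP.
  by rewrite mem_pmap; apply/mapP; exists (choice.pickle k); rewrite ?mem_iota// choice.pickleK.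
elim: (t n) => //= k' u IH; rewrite inE => /orP[/eqP <-|/IH ku].
  by rewrite le_max lexx.
by rewrite le_max ku orbT.
Qed.

End test_functions.

Section basins.
Context (R : realType) (X : ptopologicalType) dT (T : measurableType dT).
Variable f : {mfun (T * borel X)%type >-> borel X}.
Local Notation Om := (seq_space T).

Lemma integral_empirical (phi : borel X -> R) n (z : Om * borel X) :
  measurable_fun setT phi ->
  \int[@empirical_measure R X _ T f z.1 z.2 n]_x phi x = orbit_avg f phi n z.
Proof.
move=> mphi.
have pos (u : borel X -> R) : measurable_fun setT u -> (forall x, 0 <= u x) ->
    (\int[@empirical_measure R X _ T f z.1 z.2 n]_x (u x)%:E = (orbit_avg f u n z)%:E)%E.
  move=> mu u0; have mu' : measurable_fun setT (EFin \o u) by exact/measurable_EFinP.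
  have u0' x : setT x -> (0 <= (EFin \o u) x)%E by move=> _; rewrite lee_fin.
  rewrite /empirical_measure (ge0_integral_mscale _ measurableT _ mu' u0').
  rewrite (ge0_integral_measure_sum _ measurableT u0' mu').
  rewrite /orbit_avg EFinM -sumEFin; congr (_ * _)%E; apply: eq_bigr => j _.
  by rewrite integral_dirac// diracT mul1e.
pose up x := Num.max 0 (phi x); pose un x := Num.max 0 (- phi x).
have mup : measurable_fun setT up by exact: measurable_maxr.
have mun : measurable_fun setT un by apply: measurable_maxr => //; exact: measurableT_comp.
have phiE x : phi x = up x - un x.
  by rewrite /up /un; case: (ltP 0 (phi x)) => a; case: (ltP 0 (- phi x)) => b; lra.
rewrite /Rintegral integralE.
have -> : (\int[@empirical_measure R X _ T f z.1 z.2 n]_x ((fun x => (phi x)%:E)^\+%E) x)%E = (orbit_avg f up n z)%:E.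
  rewrite -(pos up)//; last by move=> x; rewrite le_max lexx.
  by apply: eq_integral => x _; rewrite funeposE -EFin_max maxC.
have -> : (\int[@empirical_measure R X _ T f z.1 z.2 n]_x ((fun x => (phi x)%:E)^\-%E) x)%E = (orbit_avg f un n z)%:E.
  rewrite -(pos un)//; last by move=> x; rewrite le_max lexx.
  by apply: eq_integral => x _; rewrite funenegE -EFinN -EFin_max maxC.
rewrite -EFinB /= /orbit_avg -mulrBr -sumrB; congr (_ * _).
by apply: eq_bigr => j _; rewrite -phiE.
Qed.

Lemma orbit_avgD (u v : borel X -> R) n (z : Om * borel X) :
  orbit_avg f (fun x => u x + v x) n z = orbit_avg f u n z + orbit_avg f v n z.
Proof. by rewrite /orbit_avg big_split/= mulrDr. Qed.

Lemma orbit_avgN (u : borel X -> R) n (z : Om * borel X) :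
  orbit_avg f (fun x => - u x) n z = - orbit_avg f u n z.
Proof. by rewrite /orbit_avg sumrN mulrN. Qed.

Lemma orbit_avg_cst (c : R) n (z : Om * borel X) : (0 < n)%N -> orbit_avg f (fun=> c) n z = c.
Proof.
move=> n0; rewrite /orbit_avg sumr_const card_ord -(mulr_natl c) mulrA mulVf ?mul1r//.
by rewrite pnatr_eq0 -lt0n.
Qed.

Lemma le_orbit_avg (u v : borel X -> R) n (z : Om * borel X) : (forall x, u x <= v x) ->
  orbit_avg f u n z <= orbit_avg f v n z.
Proof.
by move=> uv; apply: ler_wpM2l; [rewrite invr_ge0|apply: ler_sum => j _; exact: uv].
Qed.

Variables (M : metricType R) (g : X -> M) (g' : M -> X).
Hypotheses (cg : continuous g) (gK : cancel g g') (cg' : continuous g').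
Variable s : nat -> X.
Hypothesis sdense : forall (x : X) (U : set X), nbhs x U -> exists k, U (s k).
Local Notation max_hat := (max_hat g s).

Let measurable_max_hat t : measurable_fun [set: borel X] (max_hat t : borel X -> R).
Proof. by apply: continuous_measurable_borel; exact: continuous_max_hat. Qed.

Section fixed_measure.
Variable mu : probability (borel X) R.

(** Lists of hat codes being countable, these are countably many conditions; [basinP] identifies
    them with the weak* basin, which is thereby measurable. *)
Definition test_basin (z : Om * borel X) : Prop :=
  forall t, avg_basin f (max_hat t) (\int[mu]_x max_hat t x) z.

(** A maximum of hats below [phi] with nearly the same integral has converging averages, and these
    bound the averages of [phi] from below. *)
Lemma test_lower (phi : X -> R) (B : R) z : test_basin z -> continuous phi ->
  (forall x, 0 <= phi x <= B) -> forall e : R, 0 < e ->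
  exists N, forall n, (N <= n)%N -> \int[mu]_x phi x - e < orbit_avg f phi n z.
Proof.
move=> tz cphi phiB e e0; have e2 : 0 < e / 2 by rewrite divr_gt0.
have phi0 x : 0 <= phi x by case/andP: (phiB x).
have [t [tle tcv]] := max_hat_approx cg gK cg' sdense cphi phi0.
have mphi := continuous_measurable_borel cphi.
have cv : \int[mu]_x max_hat (t n) x @[n --> \oo] --> \int[mu]_x phi x.
  have [|||||_ _ cv] := @dominated_convergence _ _ _ mu setT measurableT
    (fun n => EFin \o max_hat (t n)) (EFin \o phi) (EFin \o cst B).
  - by move=> n; apply/measurable_EFinP; exact: measurable_max_hat.
  - exact/measurable_EFinP.
  - by apply: aeW => x _; apply: cvg_EFin; [exact: nearW|exact: tcv].
  - exact: finite_measure_integrable_cst.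
  - apply: aeW => x n _; rewrite /= lee_fin ger0_norm ?max_hat_ge0//.
    by apply: le_trans (tle n x) _; case/andP: (phiB x).
  apply: fine_cvg; rewrite [X in _ --> X]fineK; first exact: cv.
  apply: integrable_fin_num => //; apply: (integrable_bounded (M := B)) => // x.
  by rewrite ger0_norm//; case/andP: (phiB x).
have [n0 _ Hn0] := (cvgrPdist_lt _ _).1 cv _ e2.
have {}Hn0 := Hn0 n0 (leqnn n0).
have [N _ HN] := (cvgrPdist_lt _ _).1 (tz (t n0)) _ e2.
exists N => n /HN /= Hn.
apply: lt_le_trans (le_orbit_avg n z (tle n0)).
move: Hn0 Hn; rewrite /= !ltr_norml => /andP[_ h1] /andP[_ h2].
by move: h1 h2; move: (orbit_avg _ _ _ _) (\int[mu]_x phi x) (\int[mu]_x _) => a b c; lra.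
Qed.

(** The lower estimate for the nonnegative functions [B + phi] and [B - phi] gives both bounds on
    the averages of [phi]. *)
Lemma test_cvg (phi : X -> R) (B : R) z : test_basin z -> continuous phi ->
  (forall x, `|phi x| <= B) -> avg_basin f phi (\int[mu]_x phi x) z.
Proof.
move=> tz cphi phiB.
have mphi := continuous_measurable_borel cphi.
have iphi : mu.-integrable setT (EFin \o (phi : borel X -> R)).
  exact: (integrable_bounded (M := B)).
have icst : mu.-integrable setT (EFin \o cst B) by exact: finite_measure_integrable_cst.
have intB : \int[mu]_x cst B x = B by rewrite Rintegral_cst//= probability_setT mulr1.
have c1 : continuous (fun x => B + phi x) by move=> x; apply: cvgD; [exact: cvg_cst|exact: cphi].
have c2 : continuous (fun x => B - phi x) by move=> x; apply: cvgB; [exact: cvg_cst|exact: cphi].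
have b1 x : 0 <= B + phi x <= B + B.
  by have := phiB x; rewrite ler_norml => /andP[? ?]; apply/andP; split; lra.
have b2 x : 0 <= B - phi x <= B + B.
  by have := phiB x; rewrite ler_norml => /andP[? ?]; apply/andP; split; lra.
have i1 : \int[mu]_x (B + phi x) = B + \int[mu]_x phi x by rewrite RintegralD// intB.
have i2 : \int[mu]_x (B - phi x) = B - \int[mu]_x phi x by rewrite RintegralB// intB.
apply/cvgrPdist_lt => e e0.
have [N1 H1] := test_lower tz c1 b1 e0; have [N2 H2] := test_lower tz c2 b2 e0.
(* The average of a constant is that constant only for [n >= 1]; at [n = 0] it is [0]. *)
exists (maxn 1 (maxn N1 N2)) => // n /=; rewrite !geq_max => /and3P[n0 n1 n2].
have := H1 n n1; have := H2 n n2; rewrite i1 i2.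
rewrite (orbit_avgD (fun=> B) phi) (orbit_avgD (fun=> B) (fun x => - phi x)) orbit_avgN !orbit_avg_cst//.
move: (orbit_avg _ _ _ _) (\int[mu]_x phi x) => a b h1 h2.
by rewrite ltr_norml; apply/andP; split; lra.
Qed.

Lemma basinP z : basin f mu z <-> test_basin z.
Proof.
split=> [H t|tz phi cphi [B' [_ HB]]].
  rewrite /avg_basin/=; have ct : continuous (max_hat t) by exact: continuous_max_hat.
  rewrite (_ : (fun n => _) = fun n => \int[@empirical_measure R X _ T f z.1 z.2 n]_x max_hat t x).
    apply: H => //; exists (max_hat_bound R t); split; first exact: num_real.
    by move=> N BN x _; apply: le_trans (max_hat_bounded _ _ _ _) (ltW BN).
  by apply/funext => n; rewrite integral_empirical//; exact: measurable_max_hat.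
rewrite (_ : (fun n => _) = fun n => orbit_avg f phi n z).
  apply: (@test_cvg phi (B' + 1)) => // x; apply: (HB (B' + 1)) => //; by rewrite ltrDl.
apply/funext => n; apply: integral_empirical; exact: continuous_measurable_borel.
Qed.

Lemma measurable_basin : measurable (basin f mu).
Proof.
rewrite (_ : basin f mu = \bigcap_n [set z | avg_basin f (max_hat (odflt [::] (choice.unpickle n)))
    (\int[mu]_x max_hat (odflt [::] (choice.unpickle n)) x) z]).
  by apply: bigcapT_measurable => n; apply: measurable_avg_basin; exact: measurable_max_hat.
apply/seteqP; split=> z.
  by move=> /basinP H n _; exact: H.
move=> H; apply/basinP => t.
by have := H (choice.pickle t) I; rewrite choice.pickleK.
Qed.

End fixed_measure.

Variables (p : probability T R) (P : probability Om R) (m : probability (borel X) R).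
Variables (r : nat) (mu : 'I_r -> probability (borel X) R).
Hypothesis fpm : FPM_family p P f m mu.

(** [same_index] uses one index for all test functions, and countably many null sets may be
    discarded, so a single [mu i] passes every test. *)
Lemma basin_cover : {ae (P \x m)%E, forall z, (\bigcup_i basin f (mu i)) z}.
Proof.
have H t := same_index fpm (@measurable_max_hat t) (max_hat_bounded g s t).
have Hall := ae_foralln (fun n => H (odflt [::] (choice.unpickle n))).
apply: filterS2 (index_cover fpm) Hall => z [i zi] Hz; exists i => //.
apply/basinP => t; have := Hz (choice.pickle t) i zi.
by rewrite choice.pickleK.
Qed.

End basins.

Lemma ae_product2 d1 d2 (Y : measurableType d1) (Z : measurableType d2) (R : realType)
    (P : probability Y R) (Q : probability Z R) (E : set (Y * Z)) : measurable E ->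
  (P \x Q)%E E = 1%E -> {ae Q, forall z, P [set y | E (y, z)] = 1%E}.
Proof.
move=> mE E1.
have mfib z : measurable [set y | E (y, z)].
  rewrite (_ : mkset _ = ysection E z); first exact: measurable_ysection.
  by apply/seteqP; split => y /=; rewrite ysectionE.
have mEC : measurable (~` E) by exact: measurableC.
have mfC : measurable_fun setT (fun z => P [set y | (~` E) (y, z)]).
  rewrite (_ : (fun z => _) = P \o ysection (~` E)); first exact: measurable_fun_ysection.
  by apply/funext => z /=; congr (P _); apply/seteqP; split => y /=; rewrite ysectionE.
have : (\int[Q]_z `|P [set y | (~` E) (y, z)]| = 0)%E.
  rewrite (_ : (\int[Q]_z _)%E = (P \x Q)%E (~` E)).
    have := @probability_setC _ _ _ (product_probability P Q) E mE.
    by rewrite [product_probability P Q E]E1 subee.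
  by rewrite product_measure_ysection//; apply: eq_integral => z _; rewrite gee0_abs.
move/(ae_eq_integral_abs Q measurableT mfC); apply: filterS => z /(_ I) /= H.
rewrite -[[set y | _]]setCK.
by have := probability_setC P (measurableC (mfib z)); rewrite H sube0.
Qed.

Lemma polish_dense_seq (R : realType) (X : ptopologicalType) : polish_space R X ->
  exists s : nat -> X, forall (x : X) (U : set X), nbhs x U -> exists k, U (s k).
Proof.
move=> [[D /countable_injP[c cinj] dD] _].
(* The injection [c] of [D] into the integers is inverted; codes attained by no point of [D] are
   sent to the default [point]. *)
exists (fun k => xget point [set x | D x /\ c x = k]) => x U; rewrite nbhsE => -[V [oV Vx] VU].
have [y [Vy Dy]] := dD V (ex_intro _ x Vx) oV.
exists (c y); case: xgetP => [w _ [Dw cw]|/(_ y)[]//].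
have -> : w = y by apply: cinj => //; exact: mem_set.
exact: VU.
Qed.

Theorem theorem3 (R : realType) (X : ptopologicalType)
    (polishX : polish_space R X) (m : probability (borel X) R)
    (dT : measure_display) (T : measurableType dT) (p : probability T R)
    (P : probability (seq_space T) R) (prodP : is_product_measure p P)
    (f : {mfun (T * borel X)%type >-> borel X})
    (nonsing_f : nonsingular_transition p m f) :
  (mean_constrictive (annealed_PF p m f) <-> FPM p P f m) /\
  forall (r : nat) (mu : 'I_r -> probability (borel X) R),
    FPM_family p P f m mu ->
    [/\ (P \x m)%E (\bigcup_i basin f (mu i)) = 1%E,
        {ae m, forall x, P (\bigcup_i basin_at_point f (mu i) x) = 1%E}
      & {ae P, forall omega, m (\bigcup_i basin_at_omega f (mu i) omega) = 1%E}].
Proof.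
split.
  split; first exact: constrictive_FPM.
  by move=> [r [mu fpm]]; exact: FPM_constrictive fpm.
move=> r mu fpm.
have [s sdense] := polish_dense_seq polishX.
have [_ [M [g [g' [gK _ cg cg' _]]]]] := polishX.
have mE : measurable (\bigcup_i basin f (mu i)).
  apply: fin_bigcup_measurable; first exact: finite_finset.
  by move=> i _; exact: (measurable_basin f cg gK cg' sdense).
have E1 : (P \x m)%E (\bigcup_i basin f (mu i)) = 1%E.
  apply: (ae_probability1 (product_probability P m) mE).2.
  exact: (basin_cover cg gK cg' sdense fpm).
split=> //.
- apply: filterS (ae_product2 mE E1) => x <-; congr (P _).
- by apply: filterS ((ae_product1 P m mE).1 E1) => w <-; congr (m _).
Qed.
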